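(* Let $M$ be a smooth manifold, let $\mathcal{E}\to M$ be a smooth Hermitian vector bundle of complex rank $n$, and let $1\le i\le n$. There is a neighborhood of $\Sigma_i^0(\mathcal{E})$ in $\mathbb{HP}_1(\mathcal{E})$ which is isomorphic, as a stratified space, to a neighborhood of $\mathbb{HPD}_1(S^{\perp}_{\mathbb{G}_i(\mathcal{E})})$ inside the total space of $$\mathcal{C}(S_{\mathbb{G}_i(\mathcal{E})})\oplus\mathbb{HPD}_1(S^{\perp}_{\mathbb{G}_i(\mathcal{E})})\subset\mathbb{H}(S_{\mathbb{G}_i(\mathcal{E})})\oplus\mathbb{HPD}_1(S^{\perp}_{\mathbb{G}_i(\mathcal{E})}).$$
   Context: Manifolds are finite-dimensional, Hausdorff, second countable, real $C^\infty$ manifolds without boundary. For a finite-dimensional complex vector space $V$ with a positive definite Hermitian metric, $\mathbb{H}(V)\subset\mathrm{End}(V)$ is the real vector space of Hermitian endomorphisms, $\mathbb{HP}(V)$ the subset of positive (semidefinite) ones, and $\mathbb{HPD}(V)$ the subset of positive definite ones. The lower index $1$ denotes the subset of elements of trace $1$: $\mathbb{H}_1(V)$, $\mathbb{HP}_1(V)$, $\mathbb{HPD}_1(V)$. Put $\Sigma_i^0(V):=\{f\in\mathbb{HP}_1(V):\mathrm{rk}(f)=i\}$. For a Hermitian vector bundle $\mathcal{F}$ over a manifold, $\mathbb{H}(\mathcal{F})$, $\mathbb{HP}(\mathcal{F})$, $\mathbb{HPD}(\mathcal{F})$, $\mathbb{H}_1(\mathcal{F})$, $\mathbb{HP}_1(\mathcal{F})$,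 $\mathbb{HPD}_1(\mathcal{F})$, $\Sigma^0_i(\mathcal{F})$ denote the corresponding subbundles of $\mathrm{End}(\mathcal{F})$ (and their total spaces), defined fibrewise, e.g. $\mathbb{HP}_1(\mathcal{F})_m=\mathbb{HP}_1(\mathcal{F}_m)$. $\mathbb{G}_i(\mathcal{E})\to M$ is the Grassmannian bundle whose fibre over $m$ is the Grassmann manifold of $(n-i)$-dimensional complex subspaces of $\mathcal{E}_m$; its total space is a manifold whose points are pairs $(W,m)$. $S_{\mathbb{G}_i(\mathcal{E})}$ is the tautological vector bundle on $\mathbb{G}_i(\mathcal{E})$, with fibre $W$ at $(W,m)$, and $S^{\perp}_{\mathbb{G}_i(\mathcal{E})}$ is its orthogonal bundle, with fibre $W^\perp\subset\mathcal{E}_m$; both carry the induced Hermitian metrics. $\mathcal{C}(S_{\mathbb{G}_i(\mathcal{E})})\subset\mathbb{H}(S_{\mathbb{G}_i(\mathcal{E})})$ is the sub cone bundle whose fibre at $(W,m)$ is the cone in $\mathbb{H}(W)$ with vertex $0$ and base $\mathbb{HP}_1(W)$, i.e. $\{0\}\cup\{t h: 0\le t\le 1,\ h\in\mathbb{HP}_1(W)\}$. The symbol $\oplus$ is the fibre product over $\mathbb{G}_i(\mathcal{E})$: the total space of $\mathcal{C}(S_{\mathbb{G}_i(\mathcal{E})})\oplus\mathbb{HPD}_1(S^{\perp}_{\mathbb{G}_i(\mathcal{E})})$ consists of the tuples $(h,k,W,m)$ with $h\in\mathcal{C}(S_{\mathbb{G}_i(\mathcal{E})})_{(W,m)}$ and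 $k\in\mathbb{HPD}_1(W^\perp)$. In it, $\mathbb{HPD}_1(S^{\perp}_{\mathbb{G}_i(\mathcal{E})})$ is identified with the subset $h=0$. Stratifications: $\mathbb{HP}_1(\mathcal{E})$ is stratified by the sets $\Sigma_r^0(\mathcal{E})$, $1\le r\le n$ (each a smooth submanifold of $\mathrm{End}(\mathcal{E})$). The cone bundle has the conical stratification induced by the rank stratification of $\mathbb{HP}_1(S_{\mathbb{G}_i(\mathcal{E})})$, so the strata of $\mathcal{C}(S_{\mathbb{G}_i(\mathcal{E})})\oplus\mathbb{HPD}_1(S^{\perp}_{\mathbb{G}_i(\mathcal{E})})$ near $h=0$ are the sets $\{\mathrm{rk}(h)=j\}$, $0\le j\le n-i$ (smooth submanifolds of $\mathbb{H}(S_{\mathbb{G}_i(\mathcal{E})})\oplus\mathbb{H}(S^{\perp}_{\mathbb{G}_i(\mathcal{E})})$). Neighborhoods carry the strata obtained by intersection. An isomorphism of stratified spaces is a homeomorphism that maps each stratum onto a stratum and restricts to a diffeomorphism between corresponding strata. *)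

(* Defs.v *)
From HB Require Import structures.
From mathcomp Require Import all_boot all_order all_algebra sesquilinear.
From mathcomp Require Import complex.
From mathcomp Require Import all_classical all_reals all_analysis.
Set Implicit Arguments.
Unset Strict Implicit.
Unset Printing Implicit Defensive.
Import Order.TTheory GRing.Theory Num.Theory.
Import numFieldNormedType.Exports.
Local Open Scope classical_set_scope.
Local Open Scope ring_scope.
Local Open Scope complex_scope.

Section Smooth.
Variable R : realType.

(* C^k on an open set U of a finite-dimensional space, by iterated directional
   derivatives: all of them up to order k exist and are continuous on U. *)
Fixpoint Ck (k : nat) (V W : normedModType R) (U : set V) (f : V -> W) : Prop :=
  (forall x, U x -> {for x, continuous f}) /\
  if k is k'.+1 then
    forall v : V, (forall x, U x -> derivable f x v) /\
                  Ck k' U (fun x => 'D_v f x)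
  else True.

Definition Cinfty (V W : normedModType R) (U : set V) (f : V -> W) : Prop :=
  forall k, Ck k U f.

(* On A, the map f is locally a C^infty function of phi. When phi embeds A into
   V, this is smoothness of f on A in the sense of local smooth extensions to
   the ambient space V (ordinary smoothness if phi @` A is open, or a
   submanifold). *)
Definition smooth_through (V W : normedModType R) (T : Type) (phi : T -> V)
    (A : set T) (f : T -> W) : Prop :=
  forall x, A x -> exists (O : set V) (g : V -> W),
    [/\ open O, O (phi x), Cinfty O g &
        forall y, A y -> O (phi y) -> f y = g (phi y)].

Definition realify m n (A : 'M[R[i]]_(m, n)) : 'M[R]_(m, n + n) :=
  row_mx (map_mx (@complex.Re R) A) (map_mx (@complex.Im R) A).

(* A family of local coordinate systems x |-> lc_map a x, for x in lc_dom a.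
   They may be charts of a manifold, or restrictions of charts of an ambient
   manifold to an embedded submanifold. *)
Record local_coords (T : Type) := LocalCoords {
  lc_model : normedModType R;
  lc_idx : Type;
  lc_dom : lc_idx -> set T;
  lc_map : lc_idx -> T -> lc_model
}.

Definition lc_open (T : Type) (c : local_coords T) (A : set T) : Prop :=
  forall (a : lc_idx c) x, lc_dom a x -> A x ->
    exists2 O, nbhs (lc_map a x) O &
      forall y, lc_dom a y -> O (lc_map a y) -> A y.

Lemma lc_openT T (c : local_coords T) : lc_open c setT.
Proof. by move=> a x _ _; exists setT => //; exact: filterT. Qed.

Lemma lc_openI T (c : local_coords T) (A B : set T) :
  lc_open c A -> lc_open c B -> lc_open c (A `&` B).
Proof.
move=> oA oB a x ax [Ax Bx].
case: (oA a x ax Ax) (oB a x ax Bx) => [P nP hP] [Q nQ hQ].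
exists (P `&` Q); first exact: filterI.
by move=> y ay [yP yQ]; split; [exact: hP|exact: hQ].
Qed.

Lemma lc_open_bigU T (c : local_coords T) (I : Type) (F : I -> set T) :
  (forall i, lc_open c (F i)) -> lc_open c (\bigcup_i F i).
Proof.
move=> oF a x ax [i _ Fx]; case: (oF i a x ax Fx) => P nP hP.
by exists P => // y ay yP; exists i => //; exact: hP.
Qed.

Definition smooth_map (T U : topologicalType)
    (cT : local_coords T) (cU : local_coords U)
    (A : set T) (f : T -> U) : Prop :=
  {within A, continuous f} /\
  forall (a : lc_idx cT) (b : lc_idx cU),
    smooth_through (lc_map a) [set x | [/\ A x, lc_dom a x & lc_dom b (f x)]]
      (lc_map b \o f).

(* SA and SB are the collections of strata of A and B. *)
Definition stratified_iso (T U : topologicalType)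
    (cT : local_coords T) (cU : local_coords U)
    (A : set T) (SA : set (set T)) (B : set U) (SB : set (set U)) : Prop :=
  exists (f : T -> U) (g : U -> T),
  [/\ [/\ f @` A `<=` B, g @` B `<=` A,
          forall x, A x -> g (f x) = x & forall y, B y -> f (g y) = y],
      {within A, continuous f}, {within B, continuous g} &
      forall S, SA S ->
        [/\ SB (f @` S), smooth_map cT cU S f & smooth_map cU cT (f @` S) g]].

(* The neighborhoods are taken relatively open, so that their traces on
   submanifolds are again submanifolds. *)
Definition rel_open_nbhd (T : topologicalType) (X S N : set T) : Prop :=
  S `<=` N /\ exists2 O, open O & N = X `&` O.

End Smooth.

Section Hermitian.
Variables (R : realType) (V : vectType R[i]) (dot : V -> V -> R[i]).
Implicit Type f : 'End(V).

Definition mx_in (n : nat) (e : n.-tuple V) f : 'M[R[i]]_n :=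
  \matrix_(j, k) coord e k (f (e`_j)).
Definition lfun_tr f : R[i] := \tr (mx_in (vbasis {:V}) f).
Definition lfun_rank f : nat := \dim (limg f).

Definition Herm : set 'End(V) :=
  [set f | forall u v, dot (f u) v = dot u (f v)].
Definition HP : set 'End(V) := [set f | Herm f /\ forall u, 0 <= dot (f u) u].
Definition HPD : set 'End(V) :=
  [set f | Herm f /\ forall u, u != 0 -> 0 < dot (f u) u].
Definition HP1 : set 'End(V) := [set f | HP f /\ lfun_tr f = 1].
Definition HPD1 : set 'End(V) := [set f | HPD f /\ lfun_tr f = 1].

Definition coneHP1 : set 'End(V) :=
  [set h | h = 0 \/ exists (t : R) (h1 : 'End(V)),
             [/\ 0 <= t <= 1, HP1 h1 & h = t%:C *: h1]].
End Hermitian.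

Record smooth_manifold (R : realType) (d : nat) := SmoothManifold {
  pts :> topologicalType;
  pts_hausdorff : hausdorff_space pts;
  pts_second_countable : @second_countable pts;
  chart_idx : Type;
  chart_dom : chart_idx -> set pts;
  chart : chart_idx -> pts -> 'rV[R]_d;
  chart_cover : forall x, exists a, chart_dom a x;
  chart_dom_open : forall a, open (chart_dom a);
  chart_inj : forall a, set_inj (chart_dom a) (chart a);
  chart_continuous : forall a, {within chart_dom a, continuous (chart a)};
  chart_open : forall a (O : set pts),
    O `<=` chart_dom a -> open O -> open (chart a @` O);
  chart_compat : forall a b,
    smooth_through (chart a) (chart_dom a `&` chart_dom b) (chart b)
}.

Section Bundles.
Variables (R : realType) (d : nat).

(* Local trivializations are given as local frames, with smooth transition
   matrices; this determines the smooth structure of all the total spaces. *)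
Record hermitian_bundle (M : smooth_manifold R d) (n : nat) :=
  HermitianBundle {
  fib :> M -> vectType R[i];
  metric : forall m, {dot (fib m) for @Num.conj R[i]};
  frame_idx : Type;
  frame_dom : frame_idx -> set M;
  frame : frame_idx -> forall m, n.-tuple (fib m);
  frame_cover : forall m, exists b, frame_dom b m;
  frame_dom_open : forall b, open (frame_dom b);
  frame_basis : forall b m, frame_dom b m -> basis_of {:fib m} (frame b m);
  frame_compat : forall (a : chart_idx M) b b',
    smooth_through (chart a)
      (chart_dom a `&` (frame_dom b `&` frame_dom b'))
      (fun m => realify (\matrix_(j < n, k < n)
                           coord (frame b' m) k (frame b m)`_j));
  metric_smooth : forall (a : chart_idx M) b,
    smooth_through (chart a) (chart_dom a `&` frame_dom b)
      (fun m => realify (\matrix_(j < n, k < n)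
                           metric m (frame b m)`_j (frame b m)`_k))
}.

Variables (M : smooth_manifold R d) (n : nat) (E : hermitian_bundle M n).

Record endE := EndE { end_pt : M; end_map : 'End(E end_pt) }.

Definition endE_coords : local_coords R endE :=
  @LocalCoords R endE
    ('rV[R]_d * 'M[R]_(n, n + n))%type
    (chart_idx M * frame_idx E)%type
    (fun ab => [set x | chart_dom ab.1 (end_pt x) /\ frame_dom ab.2 (end_pt x)])
    (fun ab x => (chart ab.1 (end_pt x),
                  realify (mx_in (frame ab.2 (end_pt x)) (end_map x)))).

HB.instance Definition _ := gen_eqMixin endE.
HB.instance Definition _ := gen_choiceMixin endE.
HB.instance Definition _ := isOpenTopological.Build endE
  (@lc_openT _ _ endE_coords) (@lc_openI _ _ endE_coords)
  (@lc_open_bigU _ _ endE_coords).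

Definition HP1_E : set endE :=
  [set x | HP1 (metric E (end_pt x)) (end_map x)].
Definition Sigma0 (r : nat) : set endE :=
  [set x | HP1_E x /\ lfun_rank (end_map x) = r].

Section Grassmannian.
Variable i : nat.

Record grass := Grass {
  gr_base : M;
  gr_sub : {vspace E gr_base};
  gr_dim : \dim gr_sub = (n - i)%N
}.

Definition gr_perp (w : grass) : {vspace E (gr_base w)} :=
  orthov (metric E (gr_base w)) (gr_sub w).

Record endSS := EndSS {
  ss_gr : grass;
  ss_h : 'End(subvs_of (gr_sub ss_gr));
  ss_k : 'End(subvs_of (gr_perp ss_gr))
}.

Definition ss_pt (y : endSS) : M := gr_base (ss_gr y).

Definition ortho_proj m (W : {vspace E m}) : 'End(E m) :=
  daddv_pi W (orthov (metric E m) W).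

(* Extension of h by zero on the orthogonal complement of W. *)
Definition ext0 m (W : {vspace E m}) (h : 'End(subvs_of W)) : 'End(E m) :=
  (linfun (@vsval _ _ W) \o h \o linfun (@vsproj _ _ W) \o ortho_proj W)%VF.

(* The smooth structure: a subspace W is recorded by its orthogonal projection,
   which embeds the Grassmannian bundle into End(E); since S and its orthogonal
   bundle are subbundles of the pullback of E, endomorphisms of their fibres
   are recorded by their extensions by zero. So End(S) (+) End(S^perp) is an
   embedded submanifold of End(E) (+) End(E) (+) End(E). *)
Definition endSS_coords : local_coords R endSS :=
  @LocalCoords R endSS
    ('rV[R]_d * ('M[R]_(n, n + n) * ('M[R]_(n, n + n) * 'M[R]_(n, n + n))))%type
    (chart_idx M * frame_idx E)%type
    (fun ab => [set y | chart_dom ab.1 (ss_pt y) /\ frame_dom ab.2 (ss_pt y)])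
    (fun ab y =>
       let mx f := realify (mx_in (frame ab.2 (ss_pt y)) f) in
       (chart ab.1 (ss_pt y),
        (mx (ortho_proj (gr_sub (ss_gr y))),
         (mx (ext0 (ss_h y)), mx (ext0 (ss_k y)))))).

HB.instance Definition _ := gen_eqMixin endSS.
HB.instance Definition _ := gen_choiceMixin endSS.
HB.instance Definition _ := isOpenTopological.Build endSS
  (@lc_openT _ _ endSS_coords) (@lc_openI _ _ endSS_coords)
  (@lc_open_bigU _ _ endSS_coords).

Definition sub_metric m (W : {vspace E m}) (u v : subvs_of W) : R[i] :=
  metric E m (vsval u) (vsval v).

Definition coneHPD : set endSS :=
  [set y | coneHP1 (@sub_metric _ _) (ss_h y) /\ HPD1 (@sub_metric _ _) (ss_k y)].
Definition zeroHPD : set endSS :=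
  [set y | ss_h y = 0 /\ HPD1 (@sub_metric _ _) (ss_k y)].
(* Points of the cone bundle away from the base of the cone; on this
   neighborhood of the vertex section the conical strata are the sets where h
   has constant rank. *)
Definition coneHPD_lt1 : set endSS :=
  [set y | coneHPD y /\ lfun_tr (ss_h y) < 1].
Definition cone_stratum (j : nat) : set endSS :=
  [set y | coneHPD y /\ lfun_rank (ss_h y) = j].

Definition strata_E (N : set endE) : set (set endE) :=
  [set S | exists2 r, (1 <= r <= n)%N & S = N `&` Sigma0 r /\ S !=set0].
Definition strata_cone (N : set endSS) : set (set endSS) :=
  [set S | exists2 j, (j <= n - i)%N & S = N `&` cone_stratum j /\ S !=set0].

End Grassmannian.
End Bundles.

Arguments HP1_E {R d M n} E.
Arguments Sigma0 {R d M n} E r.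
Arguments strata_E {R d M n} E N.
Arguments coneHPD {R d M n} E i.
Arguments zeroHPD {R d M n} E i.
Arguments coneHPD_lt1 {R d M n} E i.
Arguments cone_stratum {R d M n} E i j.
Arguments strata_cone {R d M n} E i N.

(* Main.v *)
Require Import Defs.
From HB Require Import structures.
From mathcomp Require Import all_boot all_order all_algebra.
From mathcomp Require Import sesquilinear spectral complex ring.
From mathcomp Require Import all_classical all_reals all_analysis.
(** Consider first a single hermitian space [V] of dimension [n].  Near an [f]
    of rank [i] in HP1(V), the spectrum of an element of HP1(V) splits into
    [n - i] eigenvalues below some [c > 0] and [i] eigenvalues above it.  Let [W] be
    the sum of the eigenspaces of the small eigenvalues.  Then [f] is the
    orthogonal sum of [h = f|W], which is positive of trace less than 1, hence in
    the cone over HP1(W), and of [f|W^perp], which is positive definite of trace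
    [1 - tr h]; dividing by this trace gives [k] in HPD1(W^perp).  Conversely
    [f = h + (1 - tr h) k], and the rank of [f] is [i] plus the rank of [h].  So the
    isomorphism and its inverse are explicit, and rank strata correspond to rank
    strata.

    Both neighbourhoods are cut out by the same condition, [gap W c f]: [W] is
    invariant under the hermitian [f], and [f < c] on [W], [f > c] on [W^perp].  It is
    encoded by the positive definiteness of [(f - c) (1 - 2 pi)], where [pi] is the
    orthogonal projection onto [W].  [tubeE] consists of the [f] in HP1 that have
    a gap at some [W] of dimension [n - i], and [tubeSS] of the [(h, k, W)] with
    [tr h < 1] for which [recombine (h, k, W)] has a gap at [W].  The subspace [W] is
    determined by [f] and its dimension ([gap_unique]), so [recombine] is a
    bijection from [tubeSS] to [tubeE].  An [f] of rank [i] has a gap at its kernel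
    ([gap_of_rank]), and so does the vertex [h = 0] at [W] ([gap_splice0]).

    Fibrewise constructions are made smooth over [M] by computing in local
    frames.  [recombine] is polynomial in the matrices of [h] and [k].  For its
    inverse, [h = f pi] and [k = (f - h) / (1 - tr h)], so it only remains to see
    that [pi] depends smoothly on [f].  Put [B = f - c].  The reflection
    [J = 1 - 2 pi] commutes with [B] and [J B] is positive definite, so that
    [J B] is the square root of [B B] and [J = (B B)^(-1/2) B].  This formula also
    defines, for every hermitian matrix near [f], an involution, hence a projection
    whose range is a gap; its dimension is an integer that varies continuously,
    hence is locally constant ([sign_mx_local], [spectral_local]).  Therefore
    the gap condition is open as well.

    The analytic core is thus the smoothness of the square root of a positive
    definite matrix depending smoothly on a parameter ([Ck_sqrt]).  For two
    square roots [S], [S'] of [T], [T'] one has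
    [S (S' - S) + (S' - S) S' = T' - T].  The operator [X |-> S X + X S'] is
    invertible when [S] and [S'] are positive definite, because
    [tr (X^* S X) + tr (X S' X^* ) > 0] for [X] nonzero.  A quantitative form of
    this gives the continuity of the square root; dividing by a real increment
    and passing to the limit then gives its directional derivatives as rational
    functions of [S] and of the derivatives of [T], and induction on the order
    of differentiability concludes.  The same square root, applied to Gram
    matrices, turns smooth frames into smooth orthonormal ones ([lowdin]).

    The topologies of the total spaces are those generated by their charts.
    Since chart changes are smooth, neighbourhoods can be tested in a single
    chart ([lc_nbhs]), and this turns the smoothness of coordinate expressions
    into continuity. *)
Set Implicit Arguments.
Unset Strict Implicit.
Unset Printing Implicit Defensive.
Import Order.TTheory GRing.Theory Num.Theory.
Import numFieldNormedType.Exports.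
Local Open Scope classical_set_scope.
Local Open Scope ring_scope.
Local Open Scope complex_scope.
Local Open Scope sesquilinear_scope.

(** * Closure properties of the classes C^k *)
Section CkTheory.
Variables (R : realType) (V : normedModType R).
Implicit Types (U : set V) (k : nat).

Lemma Ck_continuous (W : normedModType R) k U (f : V -> W) x :
  Ck k U f -> U x -> {for x, continuous f}.
Proof. by case: k => [|k] [cf _]; exact: cf. Qed.

Lemma CkS (W : normedModType R) k U (f : V -> W) : Ck k.+1 U f -> Ck k U f.
Proof.
elim: k f => [|k IH] f [cf df]; first by split.
split=> // v; have [dv Dv] := df v.
by split=> //; exact: IH.
Qed.

Lemma Ck_sub (W : normedModType R) k U U' (f : V -> W) :
  U' `<=` U -> Ck k U f -> Ck k U' f.
Proof.
move=> sU; elim: k f => [|k IH] f [cf df]; split=> //; try by move=> x /sU /cf.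
by move=> v; have [dv Dv] := df v; split; [move=> x /sU /dv|exact: IH].
Qed.

Lemma Ck_ext (W : normedModType R) k U (f g : V -> W) : open U ->
  (forall x, U x -> f x = g x) -> Ck k U f -> Ck k U g.
Proof.
move=> oU; have nearU x (f' g' : V -> W) : (forall x, U x -> f' x = g' x) ->
    U x -> \near x, f' x = g' x.
  by move=> fg Ux; near=> y; apply: fg; near: y; exact: open_nbhs_nbhs.
elim: k f g => [|k IH] f g fg [cf df].
  split=> // x Ux; rewrite /prop_for /continuous_at -(fg x Ux).
  by apply: cvg_trans (cf x Ux); apply: near_eq_cvg; exact: nearU.
split=> [x Ux|v].
  rewrite /prop_for /continuous_at -(fg x Ux).
  by apply: cvg_trans (cf x Ux); apply: near_eq_cvg; exact: nearU.
have [dv Dv] := df v; split.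
  by move=> x Ux; apply: near_eq_derivable (dv x Ux); exact: nearU.
by apply: IH Dv => x Ux; apply: near_eq_derive; exact: nearU.
Unshelve. all: by end_near. Qed.

Lemma Ck_cst (W : normedModType R) k U (c : W) : Ck k U (fun=> c).
Proof.
elim: k c => [|k IH] c; first by split=> // x _; exact: cvg_cst.
split=> [x _|v]; first exact: cvg_cst.
split=> [x _|]; first exact: derivable_cst.
rewrite (_ : 'D_v (fun=> c) = fun=> 0) //.
by apply/funext => x; exact: derive_cst.
Qed.

Lemma CkD k U (f g : V -> R) : open U ->
  Ck k U f -> Ck k U g -> Ck k U (fun x => f x + g x).
Proof.
move=> oU; elim: k f g => [|k IH] f g [cf df] [cg dg].
  by split=> // x Ux; apply: cvgD; [exact: cf|exact: cg].
split=> [x Ux|v]; first by apply: cvgD; [exact: cf|exact: cg].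
have [dfv Dfv] := df v; have [dgv Dgv] := dg v; split.
  by move=> x Ux; apply: derivableD; [exact: dfv|exact: dgv].
apply: (Ck_ext oU _ (IH _ _ Dfv Dgv)) => // x Ux.
by rewrite -deriveD//; [exact: dfv|exact: dgv].
Qed.

Lemma CkM k U (f g : V -> R) : open U ->
  Ck k U f -> Ck k U g -> Ck k U (fun x => f x * g x).
Proof.
move=> oU; elim: k f g => [|k IH] f g Cf Cg.
  by split=> // x Ux; apply: cvgM; apply: Ck_continuous Ux; eassumption.
split=> [x Ux|v]; first by apply: cvgM; apply: Ck_continuous Ux; eassumption.
have [dfv Dfv] := Cf.2 v; have [dgv Dgv] := Cg.2 v; split.
  by move=> x Ux; apply: derivableM; [exact: dfv|exact: dgv].
apply: (Ck_ext oU _ (CkD oU (IH _ _ (CkS Cf) Dgv) (IH _ _ (CkS Cg) Dfv))) => // x Ux.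
by rewrite -[_ * 'D_v g x]/(_ *: _) -[_ * 'D_v f x]/(_ *: _) -deriveM//;
  [exact: dfv|exact: dgv].
Qed.

Lemma CkV k U (f : V -> R) : open U ->
  (forall x, U x -> f x != 0) -> Ck k U f -> Ck k U (fun x => (f x)^-1).
Proof.
move=> oU; elim: k f => [|k IH] f f0 Cf.
  by split=> // x Ux; apply: cvgV; [exact: f0|apply: Ck_continuous Ux; eassumption].
split=> [x Ux|v].
  by apply: cvgV; [exact: f0|apply: Ck_continuous Ux; eassumption].
have [dfv Dfv] := Cf.2 v; split.
  by move=> x Ux; apply: derivableV; [exact: f0|exact: dfv].
have Ci := IH _ f0 (CkS Cf).
have C1 : Ck k U (fun=> -1 : R) by exact: Ck_cst.
have := CkM oU C1 (CkM oU (CkM oU Ci Ci) Dfv).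
apply: (Ck_ext oU) => // x Ux.
rewrite deriveV//; [|exact: f0|exact: dfv].
by rewrite mulN1r scaleNr expr2 invfM.
Qed.

(** Derivatives in [Ck] are taken along straight lines, which a linear map
    preserves, so the chain rule is not involved. *)
Lemma Ck_precomp (V' W : normedModType R) (L : {linear V' -> V}) k U
    (f : V -> W) : continuous L ->
  Ck k U f -> Ck k (L @^-1` U) (f \o L).
Proof.
move=> cL; elim: k f => [|k IH] f [cf df].
  by split=> // x Ux; apply: continuous_comp; [exact: cL|exact: cf].
split=> [x Ux|v]; first by apply: continuous_comp; [exact: cL|exact: cf].
have [dv Dv] := df (L v).
have E x : (fun h => h^-1 *: (((f \o L) \o shift x) (h *: v) - (f \o L) x)) =
           (fun h => h^-1 *: ((f \o shift (L x)) (h *: L v) - f (L x))).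
  apply/funext => h /=; by rewrite (linearD L) (linearZ_LR L).
split; first by move=> x Ux; rewrite /derivable E; exact: dv.
rewrite (_ : 'D_v (f \o L) = 'D_(L v) f \o L); first exact: IH.
by apply/funext => x /=; rewrite /derive E.
Qed.

(** The product topology makes both continuity and directional derivatives
    entrywise. *)
Lemma Ck_mxP k U (m n : nat) (f : V -> 'M[R]_(m, n)) : open U ->
  Ck k U f <-> forall i j, Ck k U (fun x => f x i j).
Proof.
move=> oU; have ctP (h : V -> 'M[R]_(m, n)) (x : V) :
    {for x, continuous h} <-> forall i j, {for x, continuous (fun x => h x i j)}.
  split=> [ch i j|ch].
    apply: (@continuous_comp _ _ _ h (fun M : 'M[R]_(m, n) => M i j)) => //.
    exact: coord_continuous.
  apply/cvgrPdist_le => /= e e0; near=> y.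
  rewrite /Num.Def.normr/= mx_normrE (bigmax_le _ (ltW e0))//= => i _.
  rewrite !mxE/=; move: i; near: y; apply: filter_forall => /= i.
  exact: ((cvgrPdist_le _ _).1 (ch i.1 i.2)).
elim: k f => [|k IH] f.
  split=> [[cf _] i j|cf].
    by split=> // x Ux; exact: (ctP f x).1 (cf x Ux) i j.
  by split=> // x Ux; apply: (ctP f x).2 => i j; exact: (cf i j).1.
split=> [[cf df] i j|cf].
  split=> [x Ux|v]; first exact: (ctP f x).1 (cf x Ux) i j.
  have [dv Dv] := df v; split; first by move=> x Ux; exact: (derivable_mxP f x v).1 (dv x Ux) i j.
  have := (IH _).1 Dv i j; apply: (Ck_ext oU) => x Ux.
  by rewrite derive_mx ?mxE//; exact: dv.
split=> [x Ux|v]; first by apply: (ctP f x).2 => i j; exact: (cf i j).1.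
have dv x : U x -> derivable f x v.
  by move=> Ux; apply/derivable_mxP => i j; exact: ((cf i j).2 v).1.
split=> //; apply/IH => i j; apply: (Ck_ext oU _ ((cf i j).2 v).2) => x Ux.
by rewrite derive_mx ?mxE//; exact: dv.
Unshelve. all: by end_near. Qed.

Lemma Ck_pair (W W' : normedModType R) k U (f : V -> W) (g : V -> W') : open U ->
  Ck k U f -> Ck k U g -> Ck k U (fun x => (f x, g x)).
Proof.
move=> oU; elim: k f g => [|k IH] f g [cf df] [cg dg].
  by split=> // x Ux; apply: cvg_pair; [exact: cf|exact: cg].
split=> [x Ux|v]; first by apply: cvg_pair; [exact: cf|exact: cg].
have [dfv Dfv] := df v; have [dgv Dgv] := dg v.
have E (x : V) : U x ->
  (fun h : R => h^-1 *: (((fun x => (f x, g x)) \o shift x) (h *: v) - (f x, g x)))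
   @ 0^' --> ('D_v f x, 'D_v g x).
  move=> Ux; apply: (@cvg_pair _ _ _ _ (nbhs ('D_v f x)) (nbhs ('D_v g x))).
    exact: dfv.
  exact: dgv.
split; first by move=> x Ux; apply/cvg_ex; eexists; exact: E.
by apply: (Ck_ext oU _ (IH _ _ Dfv Dgv)) => // x Ux; apply/esym/cvg_lim => //; exact: E.
Qed.

End CkTheory.

(** * Classes of functions closed under rational operations *)

(** The C^k functions on an open set, the functions continuous at a point and
    the functions smooth through given coordinates all form such classes.  The
    closure properties of complex matrices with entries in the class, among them
    inversion, are proved once for the three.  The set [A] is the place where
    functions matter: values off [A] may be changed, and only zeros in [A] prevent
    inversion. *)
Definition regular_class (R : realType) (T : Type) (A : set T)
    (K : (T -> R) -> Prop) : Prop :=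
  [/\ forall f g, (forall x, A x -> f x = g x) -> K f -> K g,
      forall c, K (fun=> c),
      forall f g, K f -> K g -> K (fun x => f x + g x),
      forall f g, K f -> K g -> K (fun x => f x * g x) &
      forall f, (forall x, A x -> f x != 0) -> K f -> K (fun x => (f x)^-1)].

Section RegularClass.
Variables (R : realType) (T : Type) (A : set T) (K : (T -> R) -> Prop).
Hypothesis KA : regular_class A K.
Local Notation C := R[i].

Definition cplx_in (f : T -> C) :=
  K (fun x => complex.Re (f x)) /\ K (fun x => complex.Im (f x)).
Definition mx_in_class m n (F : T -> 'M[C]_(m, n)) :=
  forall j k, cplx_in (fun x => F x j k).

Lemma cplx_in_ext f g : (forall x, A x -> f x = g x) -> cplx_in f -> cplx_in g.
Proof.
by case: KA => Ke _ _ _ _ fg [fr fi]; split; [apply: Ke fr|apply: Ke fi] => x Ax /=;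
  rewrite fg.
Qed.

Lemma cplx_in_cst c : cplx_in (fun=> c).
Proof. by case: KA => _ Kc _ _ _; split; exact: Kc. Qed.

Lemma cplx_inD f g : cplx_in f -> cplx_in g -> cplx_in (fun x => f x + g x).
Proof.
case: KA => _ _ KD _ _ [fr fi] [gr gi]; split.
  rewrite (_ : (fun x => _) = fun x => complex.Re (f x) + complex.Re (g x)); first exact: KD.
  by apply/funext => x; case: (f x) (g x) => [? ?] [].
rewrite (_ : (fun x => _) = fun x => complex.Im (f x) + complex.Im (g x)); first exact: KD.
by apply/funext => x; case: (f x) (g x) => [? ?] [].
Qed.

Lemma cplx_inM f g : cplx_in f -> cplx_in g -> cplx_in (fun x => f x * g x).
Proof.
case: KA => _ Kc KD KM _ [fr fi] [gr gi]; split.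
  rewrite (_ : (fun x => _) = fun x => complex.Re (f x) * complex.Re (g x) +
     (-1) * (complex.Im (f x) * complex.Im (g x))).
    by apply: (KD); [|apply: (KM) => //]; exact: KM.
  by apply/funext => x; case: (f x) (g x) => [? ?] [? ?] /=; rewrite mulN1r.
rewrite (_ : (fun x => _) = fun x => complex.Re (f x) * complex.Im (g x) +
     complex.Im (f x) * complex.Re (g x)).
  by apply: (KD); exact: KM.
by apply/funext => x; case: (f x) (g x) => [? ?] [].
Qed.

Lemma cplx_inN f : cplx_in f -> cplx_in (fun x => - f x).
Proof.
move=> Kf; rewrite (_ : (fun x => _) = fun x => -1 * f x).
  by apply: cplx_inM => //; exact: cplx_in_cst.
by apply/funext => x; rewrite mulN1r.
Qed.

Lemma cplx_inJ f : cplx_in f -> cplx_in (fun x => (f x)^*%R).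
Proof.
case: KA => _ Kc _ KM _ [fr fi]; split.
  by rewrite (_ : (fun x => _) = fun x => complex.Re (f x)) //; apply/funext => x; case: (f x).
rewrite (_ : (fun x => _) = fun x => -1 * complex.Im (f x)); first exact: KM.
by apply/funext => x; case: (f x) => a b /=; rewrite mulN1r.
Qed.

Lemma cplx_inV f : (forall x, A x -> f x != 0) -> cplx_in f ->
  cplx_in (fun x => (f x)^-1).
Proof.
move=> f0 Kf; case: KA => _ Kc KD KM KV; have [fr fi] := Kf.
pose n2 x := complex.Re (f x) * complex.Re (f x) + complex.Im (f x) * complex.Im (f x).
have Kn : cplx_in (fun x => (n2 x)^-1%:C).
  split => /=; last exact: Kc.
  apply: (KV); last by apply: (KD); exact: KM.
  move=> x /f0; rewrite /n2 -!expr2 eq_complex /= => fx.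
  by rewrite paddr_eq0 ?sqr_ge0// !sqrf_eq0.
rewrite (_ : (fun x => _) = fun x => (f x)^*%R * (n2 x)^-1%:C).
  by apply: cplx_inM => //; exact: cplx_inJ.
apply/funext => x; rewrite /n2; case: (f x) => a b /=.
by apply/eqP; rewrite eq_complex /= !mulr0 subr0 add0r !expr2 mulNr !eqxx.
Qed.

Lemma cplx_in_sum (I : finType) (F : I -> T -> C) :
  (forall j, cplx_in (F j)) -> cplx_in (fun x => \sum_j F j x).
Proof.
move=> KF; suff : forall s : seq I, cplx_in (fun x => \sum_(j <- s) F j x) by apply.
elim=> [|j s IH].
  rewrite (_ : (fun x => _) = fun=> 0); first exact: cplx_in_cst.
  by apply/funext => x; rewrite big_nil.
rewrite (_ : (fun x => _) = fun x => F j x + \sum_(j <- s) F j x).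
  exact: cplx_inD.
by apply/funext => x; rewrite big_cons.
Qed.

Lemma cplx_in_prod (I : finType) (F : I -> T -> C) :
  (forall j, cplx_in (F j)) -> cplx_in (fun x => \prod_j F j x).
Proof.
move=> KF; suff : forall s : seq I, cplx_in (fun x => \prod_(j <- s) F j x) by apply.
elim=> [|j s IH].
  rewrite (_ : (fun x => _) = fun=> 1); first exact: cplx_in_cst.
  by apply/funext => x; rewrite big_nil.
rewrite (_ : (fun x => _) = fun x => F j x * \prod_(j <- s) F j x).
  exact: cplx_inM.
by apply/funext => x; rewrite big_cons.
Qed.

Section MatrixValued.
Variables (m n p : nat).
Implicit Types (F G : T -> 'M[C]_(m, n)).

Lemma class_mx_cst (M : 'M[C]_(m, n)) : mx_in_class (fun=> M).
Proof. by move=> j k; exact: cplx_in_cst. Qed.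

Lemma class_mxD F G : mx_in_class F -> mx_in_class G -> mx_in_class (fun x => F x + G x).
Proof.
move=> KF KG j k; rewrite (_ : (fun x => _) = fun x => F x j k + G x j k).
  exact: cplx_inD.
by apply/funext => x; rewrite mxE.
Qed.

Lemma class_mxN F : mx_in_class F -> mx_in_class (fun x => - F x).
Proof.
move=> KF j k; rewrite (_ : (fun x => _) = fun x => - F x j k).
  exact: cplx_inN.
by apply/funext => x; rewrite mxE.
Qed.

Lemma class_mxZ a F : cplx_in a -> mx_in_class F -> mx_in_class (fun x => a x *: F x).
Proof.
move=> Ka KF j k; rewrite (_ : (fun x => _) = fun x => a x * F x j k).
  exact: cplx_inM.
by apply/funext => x; rewrite mxE.
Qed.

Lemma class_mxJ F : mx_in_class F -> mx_in_class (fun x => (F x)^t*).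
Proof.
move=> KF j k; rewrite (_ : (fun x => _) = fun x => (F x k j)^*%R).
  exact: cplx_inJ.
by apply/funext => x; rewrite !mxE.
Qed.

Lemma class_mxM F (G : T -> 'M[C]_(n, p)) :
  mx_in_class F -> mx_in_class G -> mx_in_class (fun x => F x *m G x).
Proof.
move=> KF KG j k; rewrite (_ : (fun x => _) = fun x => \sum_l F x j l * G x l k).
  by apply: cplx_in_sum => l; exact: cplx_inM.
by apply/funext => x; rewrite mxE.
Qed.

End MatrixValued.

Lemma cplx_in_tr n (F : T -> 'M[C]_n) : mx_in_class F -> cplx_in (fun x => \tr (F x)).
Proof. by move=> KF; exact: cplx_in_sum. Qed.

Lemma cplx_in_det n (F : T -> 'M[C]_n) : mx_in_class F -> cplx_in (fun x => \det (F x)).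
Proof.
move=> KF; apply: cplx_in_sum => s; apply: cplx_inM; first exact: cplx_in_cst.
by apply: cplx_in_prod.
Qed.

Lemma class_mx_ext m n (F G : T -> 'M[C]_(m, n)) : (forall x, A x -> F x = G x) ->
  mx_in_class F -> mx_in_class G.
Proof. by move=> FG KF j k; apply: cplx_in_ext (KF j k) => x Ax; rewrite FG. Qed.

(** Cramer's rule expresses the inverse by the adjugate and the determinant. *)
Lemma class_mx_inv n (F : T -> 'M[C]_n) : (forall x, A x -> F x \in unitmx) ->
  mx_in_class F -> mx_in_class (fun x => invmx (F x)).
Proof.
move=> uF KF.
have : mx_in_class (fun x => (\det (F x))^-1 *: \adj (F x)).
  apply: class_mxZ.
    by apply: cplx_inV (cplx_in_det KF) => x /uF; rewrite unitmxE unitfE.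
  move=> j k; rewrite (_ : (fun x => _) = fun x => cofactor (F x) k j); last first.
    by apply/funext => x; rewrite mxE.
  apply: cplx_inM; first exact: cplx_in_cst.
  apply: cplx_in_det => a b.
  rewrite (_ : (fun x => _) = fun x => F x (lift k a) (lift j b)); first exact: KF.
  by apply/funext => x; rewrite !mxE.
by apply: class_mx_ext => x /uF uFx; rewrite /invmx uFx.
Qed.

End RegularClass.

(** * Functions that are smooth through coordinates *)
Section Instances.
Variables (R : realType).

Lemma regular_Ck (V : normedModType R) k (U : set V) : open U ->
  regular_class U (fun f : V -> R => Ck k U f).
Proof.
move=> oU; split.
- by move=> f g fg; exact: Ck_ext.
- by move=> c; exact: Ck_cst.
- by move=> f g; exact: CkD.
- by move=> f g; exact: CkM.
- by move=> f f0; exact: CkV.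
Qed.

Lemma regular_continuous (V : topologicalType) (x : V) (B : set V) : nbhs x B ->
  regular_class B (fun f : V -> R => {for x, continuous f}).
Proof.
move=> Bx; have Bxx := nbhs_singleton Bx; split.
- move=> f g fg cf; rewrite /prop_for /continuous_at -(fg x Bxx).
  apply: cvg_trans cf; apply: near_eq_cvg; near=> y; apply: fg.
  by near: y.
- by move=> c; exact: cvg_cst.
- by move=> f g cf cg; exact: cvgD.
- by move=> f g cf cg; exact: cvgM.
- by move=> f f0 cf; apply: cvgV => //; exact: f0.
Unshelve. all: by end_near. Qed.

Section Through.
Variables (V : normedModType R) (T : Type) (phi : T -> V).
Implicit Types A : set T.

Lemma smooth_through_sub (W : normedModType R) A B (f : T -> W) :
  B `<=` A -> smooth_through phi A f -> smooth_through phi B f.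
Proof.
move=> BA sf x /BA Ax; have [U [g [oU Ux Cg fg]]] := sf x Ax; exists U, g; split=> // y /BA.
exact: fg.
Qed.

Lemma smooth_through_ext (W : normedModType R) A (f g : T -> W) :
  (forall x, A x -> f x = g x) -> smooth_through phi A f -> smooth_through phi A g.
Proof.
move=> fg sf x Ax; have [U [h [oU Ux Ch fh]]] := sf x Ax.
by exists U, h; split=> // y Ay Uy; rewrite -fg// fh.
Qed.

(** The definition asks for one local extension near each point. *)
Lemma smooth_through_local (W : normedModType R) A (f : T -> W) :
  (forall x, A x -> exists2 U, nbhs (phi x) U &
     smooth_through phi (A `&` phi @^-1` U) f) -> smooth_through phi A f.
Proof.
move=> lf x Ax; have [U nU sU] := lf x Ax.
have [U' [g [oU' U'x Cg fg]]] := sU x (conj Ax (nbhs_singleton nU)).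
exists (U' `&` U°), g; split; [|by []| |].
- by apply: openI => //; exact: open_interior.
- by move=> k; apply: Ck_sub (Cg k) => y [].
- by move=> y Ay [U'y Uy]; apply: fg => //; split=> //; exact: interior_subset.
Qed.

(** An operation that preserves C^k can be applied to local extensions. *)
Lemma smooth_through_comp2 (W1 W2 W : normedModType R) A
    (op : W1 -> W2 -> W) (f : T -> W1) (g : T -> W2) :
  (forall k U (f : V -> W1) (g : V -> W2), open U -> Ck k U f -> Ck k U g ->
     Ck k U (fun x => op (f x) (g x))) ->
  smooth_through phi A f -> smooth_through phi A g ->
  smooth_through phi A (fun x => op (f x) (g x)).
Proof.
move=> Cop sf sg x Ax.
have [Uf [f' [oUf Ufx Cf ff']]] := sf x Ax.
have [Ug [g' [oUg Ugx Cg gg']]] := sg x Ax.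
have oI := openI oUf oUg.
exists (Uf `&` Ug), (fun x => op (f' x) (g' x)); split=> //.
  by move=> k; apply: Cop => //; [apply: Ck_sub (Cf k)|apply: Ck_sub (Cg k)] => y [].
by move=> y Ay [yf yg]; rewrite ff'// gg'.
Qed.

Lemma regular_through A : regular_class A (fun f : T -> R => smooth_through phi A f).
Proof.
split.
- by move=> f g; exact: smooth_through_ext.
- move=> c x _; exists setT, (fun=> c); split=> //; first exact: openT.
  by move=> k; exact: Ck_cst.
- by move=> f g; apply: smooth_through_comp2 => *; exact: CkD.
- by move=> f g; apply: smooth_through_comp2 => *; exact: CkM.
- move=> f f0 sf x Ax; have [U [g [oU Ux Cg fg]]] := sf x Ax.
  have oU' : open (U `&` [set y | g y != 0]).
    rewrite openE => y [Uy gy0]; apply: filterI; first exact: open_nbhs_nbhs.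
    have : {for y, continuous g} by apply: Ck_continuous (Cg 0%N) Uy.
    by move=> /(_ [set r | r != 0]); apply; apply: open_nbhs_nbhs; split=> //; exact: open_neq.
  exists (U `&` [set y | g y != 0]), (fun y => (g y)^-1); split=> //.
  + by split=> //=; rewrite -fg//; exact: f0.
  + move=> k; apply: CkV; [|by move=> y []|by apply: Ck_sub (Cg k) => y []].
    exact: oU'.
  + by move=> y Ay [Uy _]; rewrite fg.
Qed.

Lemma smooth_through_mxP m n A (F : T -> 'M[R]_(m, n)) :
  smooth_through phi A F <-> forall i j, smooth_through phi A (fun x => F x i j).
Proof.
split=> [sF i j x Ax|sF x Ax].
  have [U [g [oU Ux Cg fg]]] := sF x Ax.
  exists U, (fun y => g y i j); split=> //.
    by move=> k; exact: (Ck_mxP k g oU).1 (Cg k) i j.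
  by move=> y Ay Uy; rewrite fg.
have /choice [Ug HUg] : forall ij : 'I_m * 'I_n, exists Ug : set V * (V -> R),
    [/\ open Ug.1, Ug.1 (phi x), Cinfty Ug.1 Ug.2 &
     forall y, A y -> Ug.1 (phi y) -> F y ij.1 ij.2 = Ug.2 (phi y)].
  by move=> [i j]; have [U [g H]] := sF i j x Ax; exists (U, g).
have sub ij : [set y | forall ij, (Ug ij).1 y] `<=` (Ug ij).1 by move=> y /(_ ij).
have oI : open [set y | forall ij, (Ug ij).1 y].
  rewrite openE => y Hy; apply: filter_forall => ij.
  by apply: open_nbhs_nbhs; split=> //; have [] := HUg ij.
exists [set y | forall ij, (Ug ij).1 y], (fun y => \matrix_(i, j) (Ug (i, j)).2 y).
split=> //.
- by move=> ij; have [] := HUg ij.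
- move=> k; apply: (Ck_mxP k _ oI).2 => i j.
  have [_ _ Cg _] := HUg (i, j); apply: (Ck_ext oI _ (Ck_sub (sub (i, j)) (Cg k))).
  by move=> y _; rewrite mxE.
- move=> y Ay Uy; apply/matrixP => i j; rewrite mxE.
  by have [_ _ _] := HUg (i, j); apply.
Qed.

Definition smooth_mx m n A (F : T -> 'M[R[i]]_(m, n)) :=
  mx_in_class (fun f : T -> R => smooth_through phi A f) F.

Lemma smooth_realifyP m n A (F : T -> 'M[R[i]]_(m, n)) :
  smooth_through phi A (fun x => realify (F x)) <-> smooth_mx A F.
Proof.
split=> [/smooth_through_mxP sF j k|sF].
  split.
    apply: smooth_through_ext (sF j (lshift n k)) => x _.
    by rewrite row_mxEl mxE.
  apply: smooth_through_ext (sF j (rshift n k)) => x _.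
  by rewrite row_mxEr mxE.
apply/smooth_through_mxP => j k; rewrite -[k]fintype.splitK; case: (fintype.split k) => {}k /=.
  by apply: smooth_through_ext (sF j k).1 => x _; rewrite row_mxEl mxE.
by apply: smooth_through_ext (sF j k).2 => x _; rewrite row_mxEr mxE.
Qed.

Lemma smooth_through_pair (W1 W2 : normedModType R) A (f : T -> W1) (g : T -> W2) :
  smooth_through phi A f -> smooth_through phi A g ->
  smooth_through phi A (fun x => (f x, g x)).
Proof. by apply: smooth_through_comp2 => *; exact: Ck_pair. Qed.

(** A local extension of [f] is continuous; this is how smoothness yields
    openness and continuity below. *)
Lemma smooth_through_nbhs (W : normedModType R) A (f : T -> W) x (B : set W) :
  smooth_through phi A f -> A x -> nbhs (f x) B ->
  exists2 U, nbhs (phi x) U & forall y, A y -> U (phi y) -> B (f y).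
Proof.
move=> sf Ax nB; have [U [g [oU Ux Cg fg]]] := sf x Ax.
exists (U `&` g @^-1` B).
  apply: filterI; first exact: open_nbhs_nbhs.
  have : {for phi x, continuous g} by apply: Ck_continuous (Cg 0%N) Ux.
  by apply; rewrite -fg.
by move=> y Ay [Uy By]; rewrite fg.
Qed.

End Through.

(** For functions on the base of a bundle: [p] is the projection, and [L]
    forgets the fibre coordinates. *)
Lemma smooth_through_precomp (V V' W : normedModType R) (T T' : Type)
    (phi : T -> V) (phi' : T' -> V') (A : set T) (A' : set T') (p : T' -> T)
    (L : {linear V' -> V}) (f : T -> W) :
  continuous L -> (forall x, A' x -> A (p x)) -> (forall x, L (phi' x) = phi (p x)) ->
  smooth_through phi A f -> smooth_through phi' A' (f \o p).
Proof.
move=> cL pA pL sf x A'x; have [U [g [oU Ux Cg fg]]] := sf _ (pA x A'x).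
exists (L @^-1` U), (g \o L); split.
- by apply: open_comp => // y _; exact: cL.
- by rewrite /preimage /= pL.
- by move=> k; apply: Ck_precomp.
- by move=> y A'y; rewrite /preimage /= pL => Uy; apply: fg => //; exact: pA.
Qed.

End Instances.

(** * Positive definite hermitian matrices *)
Section PosDef.
Variable C : numClosedFieldType.

(** Vectors are rows and matrices act on the right, so the form of [A] is
    [u A u^*]. *)
Definition hform n (A : 'M[C]_n) (u : 'rV[C]_n) : C := (u *m A *m u^t*) 0 0.
Definition posdefmx n (A : 'M[C]_n) : Prop :=
  A^t* = A /\ forall u, u != 0 -> 0 < hform A u.

Lemma adjmxM m n p (A : 'M[C]_(m, n)) (B : 'M[C]_(n, p)) :
  (A *m B)^t* = B^t* *m A^t*.
Proof. by rewrite trmx_mul map_mxM. Qed.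

Lemma adjmxD m n (A B : 'M[C]_(m, n)) : (A + B)^t* = A^t* + B^t*.
Proof. by rewrite linearD /= map_mxD. Qed.

Lemma adjmxB m n (A B : 'M[C]_(m, n)) : (A - B)^t* = A^t* - B^t*.
Proof. by rewrite linearB /= map_mxB. Qed.

Lemma adjmxZ m n a (A : 'M[C]_(m, n)) : (a *: A)^t* = a^*%R *: A^t*.
Proof. by rewrite linearZ /= map_mxZ. Qed.

Lemma adjmx1 n : (1%:M : 'M[C]_n)^t* = 1%:M.
Proof. by rewrite trmx1 map_mx1. Qed.

Lemma adjmx_unit n (A : 'M[C]_n) : (A^t* \in unitmx) = (A \in unitmx).
Proof. by rewrite map_unitmx unitmx_tr. Qed.

Lemma adjmx_inv n (A : 'M[C]_n) : (invmx A)^t* = invmx (A^t*).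
Proof. by rewrite trmx_inv map_invmx. Qed.

Lemma hformD n (A B : 'M[C]_n) u : hform (A + B) u = hform A u + hform B u.
Proof. by rewrite /hform mulmxDr mulmxDl mxE. Qed.

Lemma hformZ n a (A : 'M[C]_n) u : hform (a *: A) u = a * hform A u.
Proof. by rewrite /hform -scalemxAr -scalemxAl mxE. Qed.

Lemma hform1 n (u : 'rV[C]_n) : hform 1%:M u = \sum_j `|u 0 j| ^+ 2.
Proof.
by rewrite /hform mulmx1 mxE; apply: eq_bigr => j _; rewrite !mxE normCK.
Qed.

Lemma hform1_gt0 n (u : 'rV[C]_n) : u != 0 -> 0 < hform 1%:M u.
Proof.
move=> u0; rewrite hform1 lt_def; apply/andP; split.
  apply: contraNneq u0 => /eqP; rewrite psumr_eq0 => [/allP u0|j _]; last exact: exprn_ge0.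
  apply/eqP/rowP => j; rewrite mxE; have := u0 j (mem_index_enum j).
  by rewrite sqrf_eq0 normr_eq0 => /eqP.
by apply: sumr_ge0 => j _; exact: exprn_ge0.
Qed.

Lemma hform1_ge0 n (u : 'rV[C]_n) : 0 <= hform 1%:M u.
Proof. by rewrite hform1; apply: sumr_ge0 => j _; exact: exprn_ge0. Qed.

Lemma hform_conj m n (X : 'M[C]_(m, n)) (A : 'M[C]_n) u :
  hform (X *m A *m X^t*) u = hform A (u *m X).
Proof. by rewrite /hform adjmxM !mulmxA. Qed.

Lemma hform_conjt m n (X : 'M[C]_(n, m)) (A : 'M[C]_n) u :
  hform (X^t* *m A *m X) u = hform A (u *m X^t*).
Proof. by rewrite -hform_conj trmxCK. Qed.

Lemma hform_diag n (d u : 'rV[C]_n) :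
  hform (diag_mx d) u = \sum_j d 0 j * `|u 0 j| ^+ 2.
Proof.
rewrite /hform mul_mx_diag mxE; apply: eq_bigr => j _.
by rewrite !mxE normCK mulrAC mulrC.
Qed.

Lemma mxtrace_conj m n (X : 'M[C]_(m, n)) (A : 'M[C]_n) :
  \tr (X *m A *m X^t*) = \sum_i hform A (row i X).
Proof.
apply: eq_bigr => i _; rewrite /hform -row_mul !mxE.
by apply: eq_bigr => j _; rewrite !mxE.
Qed.

Lemma posdef_ge0 n (A : 'M[C]_n) u : posdefmx A -> 0 <= hform A u.
Proof.
move=> [_ pA]; have [->|/pA/ltW//] := eqVneq u 0.
by rewrite /hform !mul0mx mxE.
Qed.

Lemma posdef_unit n (A : 'M[C]_n) : posdefmx A -> A \in unitmx.
Proof.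
move=> [_ pA]; rewrite -row_free_unit -kermx_eq0; apply/eqP/row_matrixP => i.
rewrite row0; apply/eqP/negPn/negP => /pA.
by rewrite /hform -row_mul mulmx_ker row0 mul0mx mxE ltxx.
Qed.

Lemma posdef_conj n (X A : 'M[C]_n) :
  X \in unitmx -> posdefmx A -> posdefmx (X *m A *m X^t*).
Proof.
move=> uX [hA pA]; split; first by rewrite !adjmxM trmxCK hA mulmxA.
move=> u u0; rewrite hform_conj; apply: pA.
by rewrite -(mul0mx _ X) (can_eq (mulmxK uX)).
Qed.

Lemma posdef1 n : posdefmx (1%:M : 'M[C]_n).
Proof. by split; [exact: adjmx1|move=> u; exact: hform1_gt0]. Qed.

Lemma herm_sqr_posdef n (B : 'M[C]_n) :
  B^t* = B -> B \in unitmx -> posdefmx (B *m B).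
Proof.
by move=> hB uB; have := posdef_conj uB (posdef1 n); rewrite mulmx1 hB.
Qed.

Lemma herm_spectral n (A : 'M[C]_n) : A^t* = A ->
  exists (P : 'M[C]_n) (d : 'rV[C]_n),
    P \is unitarymx /\ A = P^t* *m diag_mx d *m P.
Proof.
move=> hA; have nA : A \is normalmx by apply/normalmxP; rewrite hA.
exists (spectralmx A), (spectral_diag A); split; first exact: spectral_unitarymx.
by rewrite -invmx_unitary ?spectral_unitarymx//; exact/orthomx_spectralP.
Qed.

Lemma posdef_spectral n (A : 'M[C]_n) : posdefmx A ->
  exists (P : 'M[C]_n) (d : 'rV[C]_n),
    [/\ P \is unitarymx, A = P^t* *m diag_mx d *m P & forall j, 0 < d 0 j].
Proof.
move=> pA; have [P [d [uP AE]]] := herm_spectral pA.1; exists P, d; split=> // j.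
have : posdefmx (P *m A *m P^t*) by apply: posdef_conj => //; exact: unitarymx_unit.
rewrite AE !mulmxA (unitarymxP uP) mul1mx mulmxtVK// => -[_ pd].
have /pd : delta_mx 0 j != 0 :> 'rV[C]_n.
  by apply/eqP => /rowP/(_ j)/eqP; rewrite !mxE !eqxx oner_eq0.
rewrite hform_diag (bigD1 j) //= big1 => [|k kj]; last first.
  by rewrite mxE (negPf kj) andbF normr0 expr0n mulr0.
by rewrite mxE !eqxx normr1 expr1n mulr1 addr0.
Qed.

Lemma posdef_diag n (P : 'M[C]_n) (d : 'rV[C]_n) : P \is unitarymx ->
  (forall j, 0 < d 0 j) -> posdefmx (P^t* *m diag_mx d *m P).
Proof.
move=> uP d0; rewrite -[in X in _ *m X](trmxCK P); apply: posdef_conj.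
  by rewrite adjmx_unit unitarymx_unit.
split.
  rewrite tr_diag_mx map_diag_mx; congr diag_mx; apply/rowP => j; rewrite mxE.
  by apply/CrealP; rewrite realE ltW.
move=> u u0; rewrite hform_diag.
have /existsP[j uj] : [exists j, u 0 j != 0].
  rewrite -negb_forall; apply: contraNN u0 => /forallP u0.
  by apply/eqP/rowP => j; rewrite mxE; apply/eqP; have := u0 j.
rewrite (bigD1 j) //= ltr_pwDl ?mulr_gt0 ?exprn_gt0 ?normr_gt0 ?d0//.
by apply: sumr_ge0 => k _; rewrite mulr_ge0 ?exprn_ge0// ltW.
Qed.

Lemma posdef_lower_bound n (A : 'M[C]_n) : posdefmx A ->
  exists2 e, 0 < e & forall u, e * hform 1%:M u <= hform A u.
Proof.
move=> /posdef_spectral [P [d [uP -> d0]]].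
have s0 : 0 <= \sum_j (d 0 j)^-1 by apply: sumr_ge0 => j _; rewrite invr_ge0 ltW.
(* The order on C is partial and offers no minimum of the eigenvalues; the
   inverse of 1 plus the sum of their inverses is below all of them. *)
exists (1 + \sum_j (d 0 j)^-1)^-1; first by rewrite invr_gt0 ltr_pwDl.
move=> u; have -> : hform 1%:M u = hform 1%:M (u *m P^t*).
  have /unitarymxP uP' : P^t* \is unitarymx by rewrite trmxC_unitary.
  by rewrite -hform_conjt mulmx1 -[X in _ *m X]trmxCK uP'.
rewrite hform_conjt hform_diag hform1 mulr_sumr.
apply: ler_sum => j _; rewrite ler_wpM2r ?exprn_ge0//.
rewrite -[leRHS]invrK lef_pV2 ?posrE ?invr_gt0 ?ltr_pwDl//.
rewrite (bigD1 j) //= addrCA lerDl addr_ge0 ?ler01//.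
by apply: sumr_ge0 => k _; rewrite invr_ge0 ltW.
Qed.

Lemma posdef_sqrt n (A : 'M[C]_n) : posdefmx A ->
  exists2 S, posdefmx S & S *m S = A.
Proof.
move=> /posdef_spectral [P [d [uP -> d0]]].
exists (P^t* *m diag_mx (\row_j sqrtC (d 0 j)) *m P).
  by apply: posdef_diag => // j; rewrite mxE sqrtC_gt0.
rewrite !mulmxA -[_ *m P *m P^t*]mulmxA (unitarymxP uP) mulmx1.
rewrite -[_ *m diag_mx _ *m diag_mx _]mulmxA mulmx_diag; congr (_ *m diag_mx _ *m _).
by apply/rowP => j; rewrite !mxE -expr2 sqrtCK.
Qed.

Lemma posdef_trace_ge0 m n (A : 'M[C]_n) (X : 'M[C]_(m, n)) :
  posdefmx A -> 0 <= \tr (X *m A *m X^t*).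
Proof.
by move=> pA; rewrite mxtrace_conj; apply: sumr_ge0 => i _; exact: posdef_ge0.
Qed.

Lemma posdef_trace_eq0 m n (A : 'M[C]_n) (X : 'M[C]_(m, n)) :
  posdefmx A -> \tr (X *m A *m X^t*) = 0 -> X = 0.
Proof.
move=> pA /eqP; rewrite mxtrace_conj psumr_eq0 => [/allP trX|i _]; last exact: posdef_ge0.
apply/row_matrixP => i; rewrite row0; apply/eqP/negPn/negP => /pA.2.
by have /eqP -> := trX i (mem_index_enum i); rewrite ltxx.
Qed.

Lemma trace_sylvester n (S S' X : 'M[C]_n) :
  \tr (X^t* *m (S *m X + X *m S')) =
  \tr (X^t* *m S *m X^t*^t*) + \tr (X *m S' *m X^t*).
Proof.
by rewrite trmxCK mulmxDr linearD /= [\tr (X *m S' *m _)]mxtrace_mulC !mulmxA.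
Qed.

(** The trace of [X^* (S X + X S')] is a sum of two nonnegative terms, each of
    which vanishes only for [X = 0]. *)
Lemma posdef_sylvester n (S S' X : 'M[C]_n) : posdefmx S -> posdefmx S' ->
  S *m X + X *m S' = 0 -> X = 0.
Proof.
move=> pS pS' SX; have /esym/eqP := trace_sylvester S S' X.
rewrite SX mulmx0 mxtrace0 paddr_eq0 ?posdef_trace_ge0// => /andP[_ /eqP].
exact: posdef_trace_eq0.
Qed.

(** [S (S - S') + (S - S') S' = S S - S' S']. *)
Lemma posdef_sqrt_unique n (S S' : 'M[C]_n) : posdefmx S -> posdefmx S' ->
  S *m S = S' *m S' -> S = S'.
Proof.
move=> pS pS' SS; apply/eqP; rewrite -subr_eq0; apply/eqP.
apply: (posdef_sylvester pS pS').
by rewrite mulmxBr mulmxBl addrA subrK SS subrr.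
Qed.

(** With the trace inner product, [e |X|^2 <= <X, L>] for [L = S X + X S'].
    Instead of the Cauchy-Schwarz inequality, [0 <= |e X - L|^2] is expanded. *)
Lemma sylvester_bound n (S S' X : 'M[C]_n) e : 0 < e -> posdefmx S ->
  posdefmx S' -> (forall u, e * hform 1%:M u <= hform S u) ->
  e ^+ 2 * \tr (X *m X^t*) <=
  \tr ((S *m X + X *m S') *m (S *m X + X *m S')^t*).
Proof.
move=> e0 pS pS' eS; set L := S *m X + X *m S'.
have eX : e * \tr (X *m X^t*) <= \tr (X^t* *m L).
  rewrite /L trace_sylvester ler_wpDr ?posdef_trace_ge0//.
  have -> : \tr (X *m X^t*) = \tr (X^t* *m 1%:M *m X^t*^t*).
    by rewrite mulmx1 trmxCK mxtrace_mulC.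
  by rewrite !mxtrace_conj mulr_sumr; apply: ler_sum => j _; exact: eS.
have trXL : \tr (L *m X^t*) = \tr (X *m L^t*).
  rewrite /L adjmxD !adjmxM pS.1 pS'.1.
  rewrite mulmxDl mulmxDr !linearD /= !mulmxA; congr (_ + _).
  by rewrite -mulmxA mxtrace_mulC.
have eX' : e * \tr (X *m X^t*) <= \tr (L *m X^t*) by rewrite [leRHS]mxtrace_mulC.
have := posdef_trace_ge0 (e *: X - L) (posdef1 n).
have e_real : e^*%R = e by apply/CrealP; rewrite realE ltW.
clearbody L.
rewrite !mulmx1 adjmxB adjmxZ e_real mulmxBl !mulmxBr -!scalemxAl -!scalemxAr scalerA.
rewrite !raddfB /= !mxtraceZ -trXL -expr2 => ge0.
have /(ler_wpM2l (ltW e0)) := eX'; rewrite mulrA -expr2 => eeX.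
rewrite -subr_ge0; rewrite -subr_ge0 in eeX; move: ge0 eeX.
set a := e ^+ 2 * _; set b := e * _; set c := \tr (L *m L^t*) => ge0 ba.
rewrite (_ : c - a = a - b - (b - c) + ((b - a) + (b - a))); last by ring.
by apply: addr_ge0; [rewrite opprD|exact: addr_ge0].
Qed.

(** The constant depends on [S] alone, which makes this an estimate of continuity
    at [S S]. *)
Lemma posdef_sqrt_lipschitz n (S S' : 'M[C]_n) e : 0 < e -> posdefmx S ->
  posdefmx S' -> (forall u, e * hform 1%:M u <= hform S u) ->
  e ^+ 2 * \sum_j \sum_k `|(S' - S) j k| ^+ 2 <=
  \sum_j \sum_k `|(S' *m S' - S *m S) j k| ^+ 2.
Proof.
move=> e0 pS pS' eS.
have sqE (M : 'M[C]_n) : \sum_j \sum_k `|M j k| ^+ 2 = \tr (M *m M^t*).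
  rewrite -[X in X *m M^t*]mulmx1 mxtrace_conj; apply: eq_bigr => j _; rewrite hform1.
  by apply: eq_bigr => k _; rewrite mxE.
rewrite !sqE (_ : S' *m S' - S *m S = S *m (S' - S) + (S' - S) *m S').
  exact: sylvester_bound.
by rewrite mulmxBr mulmxBl [RHS]addrC addrA subrK.
Qed.

Lemma hform_real n (A : 'M[C]_n) u : A^t* = A -> hform A u \is Num.real.
Proof.
move=> hA; apply/CrealP; rewrite /hform.
have -> : (((u *m A *m u^t*) 0 0)^*)%R = ((u *m A *m u^t*)^t*) 0 0 by rewrite !mxE.
by rewrite !adjmxM trmxCK hA mulmxA.
Qed.

(** [2 |u_j| |u_k| <= |u_j|^2 + |u_k|^2], summed over all entries. *)
Lemma hform_le_norm n (A : 'M[C]_n) u e : (forall j k, `|A j k| <= e) ->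
  `|hform A u| <= e * n%:R * hform 1%:M u.
Proof.
move=> Ae; have [n0|n_gt0] := posnP n.
  by subst n; rewrite /hform !mxE !big_ord0 normr0 mulr0.
have e0 : 0 <= e by apply: le_trans (Ae (Ordinal n_gt0) (Ordinal n_gt0)); exact: normr_ge0.
have -> : hform A u = \sum_k \sum_j u 0 j * A j k * (u 0 k)^*.
  rewrite /hform mxE; apply: eq_bigr => k _; rewrite !mxE mulr_suml.
  by apply: eq_bigr.
have le_mean j k : `|u 0 j * A j k * (u 0 k)^*| <=
    e * ((`|u 0 j| ^+ 2 + `|u 0 k| ^+ 2) / 2%:R).
  rewrite !normrM norm_conjC mulrAC mulrC; apply: ler_pM; rewrite ?mulr_ge0//.
  exact: (real_leif_mean_square (normr_real _) (normr_real _)).1.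
apply: le_trans (ler_norm_sum _ _ _) _.
apply: le_trans (ler_sum _ (fun k _ => ler_norm_sum _ _ _)) _.
apply: le_trans (ler_sum _ (fun k _ => ler_sum _ (fun j _ => le_mean j k))) _.
rewrite hform1; set a := fun j => `|u 0 j| ^+ 2.
suff -> : \sum_k \sum_j e * ((a j + a k) / 2%:R) = e * n%:R * \sum_j a j by [].
have inner k : \sum_j e * ((a j + a k) / 2%:R) = e / 2%:R * (\sum_j a j + n%:R * a k).
  rewrite -mulr_sumr -mulr_suml big_split /= sumr_const card_ord mulr_natl; ring.
rewrite (eq_bigr _ (fun k _ => inner k)) -mulr_sumr big_split /= sumr_const card_ord.
by rewrite -mulr_sumr -mulr_natl; field.
Qed.

(** The lower bound [e] of the form of [A] on unit vectors absorbs a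
    perturbation whose form is less than [e]. *)
Lemma posdef_perturb n (A : 'M[C]_n) : posdefmx A ->
  exists2 e, 0 < e & forall B : 'M[C]_n, B^t* = B ->
    (forall j k, `|B j k - A j k| <= e) -> posdefmx B.
Proof.
move=> pA; have [e e0 eA] := posdef_lower_bound pA.
exists (e / (n.+1)%:R); first by rewrite divr_gt0 ?ltr0n.
move=> B hB BA; split=> // u u0.
rewrite -[B](subrK A) addrC hformD.
have hE : (B - A)^t* = B - A by rewrite adjmxB hB pA.1.
have Ee j k : `|(B - A) j k| <= e / n.+1%:R by rewrite !mxE.
have := hform_le_norm u Ee; rewrite real_ler_norml ?hform_real// => /andP[lowE _].
apply: lt_le_trans (lerD (eA u) lowE).
rewrite subr_gt0 ltr_pM2r ?hform1_gt0// -mulrA gtr_pMr//.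
by rewrite mulrC ltr_pdivrMr ?ltr0n// mul1r ltr_nat.
Qed.

End PosDef.

Section Sylvester.
Variables (F : fieldType) (n : nat).

(** The matrix of [X |-> A X + X B] on vectorised matrices, whose inverse is
    then covered by the closure properties of regular classes. *)
Definition sylvester_mx (A B : 'M[F]_n) : 'M[F]_(n * n) :=
  lin_mulmx A + lin_mulmxr B.

Lemma mul_sylvester_mx A B X :
  mxvec X *m sylvester_mx A B = mxvec (A *m X + X *m B).
Proof. by rewrite mulmxDr !mul_vec_lin linearD. Qed.
End Sylvester.

Lemma posdef_sylvester_unit (C : numClosedFieldType) n (S S' : 'M[C]_n) :
  posdefmx S -> posdefmx S' -> sylvester_mx S S' \in unitmx.
Proof.
move=> pS pS'; rewrite -row_free_unit -kermx_eq0; apply/eqP/row_matrixP => i.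
rewrite row0 -[row i _]vec_mxK.
suff -> : vec_mx (row i (kermx (sylvester_mx S S'))) = 0 by rewrite linear0.
apply: (posdef_sylvester pS pS'); apply: (can_inj mxvecK).
by rewrite -mul_sylvester_mx vec_mxK -row_mul mulmx_ker row0 linear0.
Qed.

(** * Smoothness of the square root *)
Section SmoothSqrt.
Variables (R : realType).
Local Notation C := R[i].

Lemma class_mx_mxvec (T : Type) (K : (T -> R) -> Prop) m n (F : T -> 'M[C]_(m, n)) :
  mx_in_class K F -> mx_in_class K (fun x => mxvec (F x)).
Proof.
move=> KF i j; case/mxvec_indexP: j => a b.
by rewrite (_ : (fun x => _) = fun x => F x a b) //; apply/funext => x; rewrite ord1 mxvecE.
Qed.

Lemma class_mx_vec_mx (T : Type) (K : (T -> R) -> Prop) m n (F : T -> 'rV[C]_(m * n)) :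
  mx_in_class K F -> mx_in_class K (fun x => vec_mx (F x)).
Proof.
move=> KF i j.
by rewrite (_ : (fun x => _) = fun x => F x 0 (mxvec_index i j)) //; apply/funext => x; rewrite mxE.
Qed.

Lemma class_mx_sylvester (T : Type) (A : set T) (K : (T -> R) -> Prop) n
    (S S' : T -> 'M[C]_n) : regular_class A K ->
  mx_in_class K S -> mx_in_class K S' ->
  mx_in_class K (fun x => sylvester_mx (S x) (S' x)).
Proof.
move=> KA KS KS'; apply: (class_mxD KA) => i j.
  rewrite (_ : (fun x => _) = fun x => mxvec (S x *m vec_mx (delta_mx 0 i)) 0 j).
    by apply: class_mx_mxvec; apply: (class_mxM KA) => //; exact: (class_mx_cst KA).
  by apply/funext => x; rewrite !mxE.
rewrite (_ : (fun x => _) = fun x => mxvec (vec_mx (delta_mx 0 i) *m S' x) 0 j).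
  by apply: class_mx_mxvec; apply: (class_mxM KA) => //; exact: (class_mx_cst KA).
by apply/funext => x; rewrite !mxE.
Qed.

Section Quotient.
Variables (V : normedModType R) (x v : V).

(** The difference quotient in direction [v], continued by [d] at 0, so that
    differentiability with derivative [d] becomes continuity at 0 and the closure
    properties of continuous functions apply to difference quotients. *)
Definition quot (f : V -> R) (d : R) (h : R) : R :=
  if h == 0 then d else h^-1 * (f (h *: v + x) - f x).

Lemma quot_cvg f d : {for 0, continuous (quot f d)} <->
  (fun h => h^-1 *: ((f \o shift x) (h *: v) - f x)) @ 0^' --> d.
Proof.
have E : {near (0 : R)^', quot f d =1 (fun h => h^-1 *: ((f \o shift x) (h *: v) - f x))}.
  near=> h; rewrite /quot /=.
  have /negPf -> // : h != 0 by near: h; exact: nbhs_dnbhs_neq.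
have q0 : quot f d 0 = d by rewrite /quot eqxx.
split=> [/continuous_withinNx|cf]; first by
  rewrite q0; exact: cvg_trans (near_eq_cvg E).
apply/continuous_withinNx; rewrite q0; apply: cvg_trans cf.
by apply: near_eq_cvg; apply: filterS E => h; exact: esym.
Unshelve. all: by end_near. Qed.

Lemma quot_derivable f d : {for 0, continuous (quot f d)} ->
  derivable f x v /\ 'D_v f x = d.
Proof.
move=> /quot_cvg cf; split; first by apply/cvg_ex; exists d.
by apply: cvg_lim.
Qed.

Lemma derivable_quot f : derivable f x v -> {for 0, continuous (quot f ('D_v f x))}.
Proof. by move=> df; apply/quot_cvg. Qed.

End Quotient.

Definition derive_cmx (V : normedModType R) m n (F : V -> 'M[C]_(m, n)) (v x : V) :
    'M[C]_(m, n) :=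
  \matrix_(j, k) Complex ('D_v (fun y => complex.Re (F y j k)) x)
                         ('D_v (fun y => complex.Im (F y j k)) x).

Section Sqrt.
Variables (V : normedModType R) (U : set V) (n : nat) (F S : V -> 'M[C]_n).
Hypothesis oU : open U.
Hypothesis pS : forall x, U x -> posdefmx (S x).
Hypothesis SS : forall x, U x -> S x *m S x = F x.
Hypothesis CF : forall k, mx_in_class (fun f : V -> R => Ck k U f) F.

Let ctn (x : V) : (V -> R) -> Prop := fun f => {for x, continuous f}.

Let nU x : U x -> nbhs x U.
Proof. by move=> Ux; exact: open_nbhs_nbhs. Qed.

(** By the Lipschitz estimate, an entry of [S y - S x] is controlled by the
    function [G], which is continuous and vanishes at [x]. *)
Lemma sqrt_continuous x : U x -> mx_in_class (ctn x) S.
Proof.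
move=> Ux; have KA := regular_continuous R (nU Ux).
have CFx : mx_in_class (ctn x) F.
  by move=> j k; split; [apply: Ck_continuous (CF 0 j k).1 Ux|
                         apply: Ck_continuous (CF 0 j k).2 Ux].
have [e e0 eS] := posdef_lower_bound (pS Ux).
pose G y : C := \sum_j \sum_k `|(F y - F x) j k| ^+ 2.
have cG : cplx_in (ctn x) G.
  apply: (cplx_in_sum KA) => j; apply: (cplx_in_sum KA) => k.
  rewrite (_ : (fun y => _) = fun y => (F y - F x) j k * ((F y - F x) j k)^*%R).
    have Kd : mx_in_class (ctn x) (fun y => F y - F x).
      by apply: (class_mxD KA) => //; exact: (class_mx_cst KA).
    by apply: (cplx_inM KA); [exact: Kd|apply: (cplx_inJ KA); exact: Kd].
  by apply/funext => y; rewrite normCK.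
have G0 : G x = 0.
  by rewrite /G big1 // => j _; rewrite big1 // => k _; rewrite subrr mxE normr0 expr0n.
have [r r0 er] : exists2 r : R, 0 < r & e = r%:C.
  exists (complex.Re e); first by move: e0; rewrite ltcE => /andP[].
  by move: e0; rewrite ltcE /= => /andP[/eqP]; case: (e) => a b /= ->.
have key y j k : U y -> r ^+ 2 * (complex.Re (S y j k - S x j k) ^+ 2 +
    complex.Im (S y j k - S x j k) ^+ 2) <= complex.Re (G y).
  move=> Uy; have := posdef_sqrt_lipschitz e0 (pS Ux) (pS Uy) eS.
  rewrite !SS// -/(G y) => leG.
  have : e ^+ 2 * `|S y j k - S x j k| ^+ 2 <= G y.
    apply: le_trans leG; rewrite ler_wpM2l ?exprn_ge0 ?(ltW e0)//.
    rewrite (bigD1 j) //= (bigD1 k) //= !mxE -addrA lerDl.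
    by apply: addr_ge0; apply: sumr_ge0 => *; [|apply: sumr_ge0 => *]; exact: exprn_ge0.
  rewrite er -add_Re2_Im2 -rmorphXn -rmorphM /= lecE => /andP[_].
  by rewrite /= !expr2.
have near_small ep : 0 < ep -> \forall y \near x, forall j k,
    `|complex.Re (S x j k) - complex.Re (S y j k)| <= ep /\
    `|complex.Im (S x j k) - complex.Im (S y j k)| <= ep.
  move=> ep0.
  have : \forall y \near x, complex.Re (G y) < r ^+ 2 * ep ^+ 2.
    have := cG.1; rewrite /ctn /prop_for /continuous_at G0 /=.
    move=> /(_ [set z | z < r ^+ 2 * ep ^+ 2]); apply.
    apply: open_nbhs_nbhs; split; first exact: open_lt.
    by rewrite /= mulr_gt0// exprn_gt0.
  move=> nG; near=> y => j k.
  have Uy : U y by near: y; exact: nU.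
  have Gy : complex.Re (G y) < r ^+ 2 * ep ^+ 2 by near: y.
  have := le_lt_trans (key y j k Uy) Gy; rewrite ltr_pM2l ?exprn_gt0//.
  rewrite ![`|_ - complex.Re (S y j k)|]distrC ![`|_ - complex.Im (S y j k)|]distrC.
  case: (S y j k) (S x j k) => [a b] [c d] /= sq.
  by split; rewrite -ler_sqr ?nnegrE ?(ltW ep0)// real_normK ?num_real// (le_trans _ (ltW sq))//
    ?lerDl ?lerDr sqr_ge0.
move=> j k; split; apply/cvgrPdist_le => /= ep /near_small; apply: filterS => y /(_ j k) [//].
Unshelve. all: by end_near. Qed.

(** The difference quotients [Q S h] and [Q F h] in direction [v] satisfy
    [S x (Q S h) + (Q S h) (S (x + h v)) = Q F h] for [h] nonzero.  Solved for
    [Q S h], this is an expression continuous in [h], including [h = 0]. *)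
Lemma sqrt_derive x v : U x ->
  (forall j k, derivable (fun y => complex.Re (S y j k)) x v /\
               derivable (fun y => complex.Im (S y j k)) x v) /\
  derive_cmx S v x =
    vec_mx (mxvec (derive_cmx F v x) *m invmx (sylvester_mx (S x) (S x))).
Proof.
move=> Ux; pose phi (h : R) := h *: v + x.
have phi0 : phi 0 = x by rewrite /phi scale0r add0r.
have cphi : {for 0, continuous phi}.
  rewrite /prop_for /continuous_at /phi.
  by apply: (@cvgD _ _ _ _ _ (fun h : R => h *: v) (fun=> x));
    [exact: scalel_continuous|exact: cvg_cst].
have nB : nbhs 0 (phi @^-1` U) by apply: cphi; rewrite phi0; exact: nU.
have KA := regular_continuous R nB; set K := (fun f => _) in KA.
have KS : mx_in_class K (S \o phi).
  move=> j k; have := sqrt_continuous Ux j k; rewrite -phi0 => -[cr ci].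
  by split; [exact: (continuous_comp cphi cr)|exact: (continuous_comp cphi ci)].
pose Q (A : V -> 'M[C]_n) (D : 'M[C]_n) h : 'M[C]_n := \matrix_(j, k)
  Complex (quot x v (fun y => complex.Re (A y j k)) (complex.Re (D j k)) h)
          (quot x v (fun y => complex.Im (A y j k)) (complex.Im (D j k)) h).
have QE A D h : h != 0 -> Q A D h = (h^-1)%:C *: (A (phi h) - A x).
  move=> /negPf h0; apply/matrixP => j k; rewrite !mxE /quot h0.
  by case: (A _ j k) (A x j k) => a b [c d] /=; apply/eqP; rewrite eq_complex /=
     !mul0r subr0 addr0 !eqxx.
have Q0 A D : Q A D 0 = D.
  by apply/matrixP => j k; rewrite !mxE /quot eqxx; case: (D j k).
have KQF : mx_in_class K (Q F (derive_cmx F v x)).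
  move=> j k; split.
    rewrite (_ : (fun h => _) = quot x v (fun y => complex.Re (F y j k))
        ('D_v (fun y => complex.Re (F y j k)) x)); last by apply/funext => h; rewrite !mxE.
    by apply: derivable_quot; have [_ /(_ v) [dv _]] := (CF 1 j k).1; exact: dv.
  rewrite (_ : (fun h => _) = quot x v (fun y => complex.Im (F y j k))
      ('D_v (fun y => complex.Im (F y j k)) x)); last by apply/funext => h; rewrite !mxE.
  by apply: derivable_quot; have [_ /(_ v) [dv _]] := (CF 1 j k).2; exact: dv.
pose L h := sylvester_mx (S x) (S (phi h)).
have uL h : (phi @^-1` U) h -> L h \in unitmx.
  by move=> Uh; apply: posdef_sylvester_unit; exact: pS.
have KL : mx_in_class K (fun h => invmx (L h)).
  apply: (class_mx_inv KA) => //; apply: (class_mx_sylvester KA) => //.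
  exact: (class_mx_cst KA).
pose D := vec_mx (mxvec (derive_cmx F v x) *m invmx (L 0)).
have KQS : mx_in_class K (Q S D).
  apply: (@class_mx_ext _ _ _ _ KA _ _
    (fun h => vec_mx (mxvec (Q F (derive_cmx F v x) h) *m invmx (L h)))).
    move=> h Uh; have [->|h0] := eqVneq h 0; first by rewrite !Q0.
    rewrite !QE//; apply: (can_inj mxvecK); rewrite vec_mxK.
    apply: (canLR (mulmxK (uL h Uh))); rewrite mul_sylvester_mx; congr mxvec.
    rewrite -scalemxAr -scalemxAl -scalerDr; congr (_ *: _).
    by rewrite mulmxBr mulmxBl [RHS]addrC addrA subrK !SS.
  by apply: class_mx_vec_mx; apply: (class_mxM KA) => //; exact: class_mx_mxvec.
have qD j k : [/\ derivable (fun y => complex.Re (S y j k)) x v,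
    derivable (fun y => complex.Im (S y j k)) x v,
    'D_v (fun y => complex.Re (S y j k)) x = complex.Re (D j k) &
    'D_v (fun y => complex.Im (S y j k)) x = complex.Im (D j k)].
  have [] := KQS j k.
  rewrite (_ : (fun h => _) = quot x v (fun y => complex.Re (S y j k))
    (complex.Re (D j k))); last by apply/funext => h; rewrite !mxE.
  move=> /quot_derivable [dr Dr].
  rewrite (_ : (fun h => _) = quot x v (fun y => complex.Im (S y j k))
    (complex.Im (D j k))); last by apply/funext => h; rewrite !mxE.
  by move=> /quot_derivable [di Di].
split=> [j k|]; first by have [] := qD j k.
rewrite -[X in invmx (sylvester_mx _ (S X))]phi0 -/(L 0) -/D.
by apply/matrixP => j k; rewrite mxE; have [_ _ -> ->] := qD j k; case: (D j k).
Qed.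

(** The formula for the derivative of [S] contains [S] itself and the derivative
    of [F], so if [S] is C^k, then its derivatives are C^k. *)
Lemma Ck_sqrt k : mx_in_class (fun f : V -> R => Ck k U f) S.
Proof.
elim: k => [|k IH].
  move=> j l; split; split=> // x Ux.
    by have [] := sqrt_continuous Ux j l.
  by have [] := sqrt_continuous Ux j l.
have KA := regular_Ck k oU.
have KD v : mx_in_class (fun f : V -> R => Ck k U f) (derive_cmx S v).
  apply: (@class_mx_ext _ _ _ _ KA _ _ (fun x =>
    vec_mx (mxvec (derive_cmx F v x) *m invmx (sylvester_mx (S x) (S x))))).
    by move=> x Ux; rewrite (sqrt_derive v Ux).2.
  apply: class_mx_vec_mx; apply: (class_mxM KA); last first.
    apply: (class_mx_inv KA); last exact: (class_mx_sylvester KA).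
    by move=> x Ux; apply: posdef_sylvester_unit; exact: pS.
  apply: class_mx_mxvec => j l; split.
    rewrite (_ : (fun x => _) = 'D_v (fun y => complex.Re (F y j l))).
      by have [_ /(_ v) []] := (CF k.+1 j l).1.
    by apply/funext => x; rewrite mxE.
  rewrite (_ : (fun x => _) = 'D_v (fun y => complex.Im (F y j l))).
    by have [_ /(_ v) []] := (CF k.+1 j l).2.
  by apply/funext => x; rewrite mxE.
move=> j l; split; split=> [x Ux|v].
- by have [] := sqrt_continuous Ux j l.
- split=> [x Ux|]; first by have [] := (sqrt_derive v Ux).1 j l.
  rewrite (_ : (fun x => _) = fun x => complex.Re (derive_cmx S v x j l)).
    by have [] := KD v j l.
  by apply/funext => x; rewrite mxE.
- by have [] := sqrt_continuous Ux j l.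
- split=> [x Ux|]; first by have [] := (sqrt_derive v Ux).1 j l.
  rewrite (_ : (fun x => _) = fun x => complex.Im (derive_cmx S v x j l)).
    by have [] := KD v j l.
  by apply/funext => x; rewrite mxE.
Qed.

End Sqrt.
End SmoothSqrt.

(** * Smooth families of matrices *)
Section SmoothMatrices.
Variables (R : realType).
Local Notation C := R[i].

Definition unrealify m n (M : 'M[R]_(m, n + n)) : 'M[C]_(m, n) :=
  \matrix_(j, k) Complex (M j (lshift n k)) (M j (rshift n k)).

Lemma realifyK m n : cancel (@realify R m n) (@unrealify m n).
Proof.
by move=> M; apply/matrixP => j k; rewrite mxE row_mxEl row_mxEr !mxE; case: (M j k).
Qed.

Section Through.
Variables (V : normedModType R) (T : Type) (phi : T -> V).
Implicit Types A : set T.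

Lemma smooth_through_id A : smooth_through phi A phi.
Proof.
move=> x _; exists setT, id; split=> //; first exact: openT.
move=> [|k]; first by split=> // y _; exact: cvg_id.
split=> [y _|v]; first exact: cvg_id.
split=> [y _|]; first exact: derivable_id.
rewrite (_ : 'D_v id = fun=> v); first exact: Ck_cst.
by apply/funext => y; exact: derive_id.
Qed.

Lemma smooth_mx_sub m n A B (F : T -> 'M[C]_(m, n)) :
  B `<=` A -> smooth_mx phi A F -> smooth_mx phi B F.
Proof.
by move=> BA sF j k; split; apply: smooth_through_sub BA _; have [] := sF j k.
Qed.

Lemma smooth_mx_close m n A (F : T -> 'M[C]_(m, n)) x (e : C) :
  smooth_mx phi A F -> A x -> 0 < e ->
  exists2 U, nbhs (phi x) U &
    forall y, A y -> U (phi y) -> forall j k, `|F y j k - F x j k| <= e.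
Proof.
move=> sF Ax e0; have KA := regular_through phi A.
pose G y : C := \sum_j \sum_k `|(F y - F x) j k| ^+ 2.
have [sG _] : cplx_in (fun f : T -> R => smooth_through phi A f) G.
  apply: (cplx_in_sum KA) => j; apply: (cplx_in_sum KA) => k.
  rewrite (_ : (fun y => _) = fun y => (F y - F x) j k * ((F y - F x) j k)^*%R).
    have Kd : smooth_mx phi A (fun y => F y - F x).
      by apply: (class_mxD KA) => //; exact: (class_mx_cst KA).
    by apply: (cplx_inM KA); [exact: Kd|apply: (cplx_inJ KA); exact: Kd].
  by apply/funext => y; rewrite normCK.
have G0 : G x = 0.
  by rewrite /G big1 // => j _; rewrite big1 // => k _; rewrite subrr mxE normr0 expr0n.
have e2 : 0 < e ^+ 2 by rewrite exprn_gt0.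
have nG : nbhs (complex.Re (G x)) [set r | r < complex.Re (e ^+ 2)].
  rewrite G0; apply: open_nbhs_nbhs; split; first exact: open_lt.
  by move: e2; rewrite ltcE => /andP[].
have [U nU HU] := smooth_through_nbhs sG Ax nG.
exists U => // y Ay Uy j k.
rewrite -ler_sqr ?nnegrE ?(ltW e0)//; apply: (@le_trans _ _ (G y)).
  rewrite /G (bigD1 j) //= (bigD1 k) //= !mxE -addrA lerDl.
  by apply: addr_ge0; apply: sumr_ge0 => *; [|apply: sumr_ge0 => *]; exact: exprn_ge0.
rewrite lecE (ltW (HU y Ay Uy)) andbT.
have /ger0_Im -> : 0 <= G y by apply: sumr_ge0 => *; apply: sumr_ge0 => *; exact: exprn_ge0.
by rewrite (ger0_Im (ltW e2)).
Qed.

Lemma smooth_mx_posdef_nbhs n A (F : T -> 'M[C]_n) x :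
  smooth_mx phi A F -> (forall y, A y -> (F y)^t* = F y) -> A x ->
  posdefmx (F x) ->
  exists2 U, nbhs (phi x) U & forall y, A y -> U (phi y) -> posdefmx (F y).
Proof.
move=> sF hF Ax /posdef_perturb [e e0 pe].
have [U nU HU] := smooth_mx_close sF Ax e0.
by exists U => // y Ay Uy; apply: pe; [exact: hF|exact: HU].
Qed.

End Through.

(** [F] is only defined on [A], while [Ck_sqrt] requires an open set of
    parameters.  A local extension of [F] need not be hermitian; its hermitian part
    [H] is, still extends [F], and is positive definite on the open set [U'].
    The square roots of [H] there extend [S]. *)
Lemma smooth_mx_sqrt (V : normedModType R) (T : Type) (phi : T -> V) (A : set T) n
    (F S : T -> 'M[C]_n) :
  smooth_mx phi A F -> (forall x, A x -> posdefmx (S x)) ->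
  (forall x, A x -> S x *m S x = F x) -> smooth_mx phi A S.
Proof.
move=> sF pS SS; apply/smooth_realifyP => x Ax.
have [U [g [oU Ux Cg Fg]]] := (smooth_realifyP phi A F).2 sF x Ax.
pose H y := (2%:R^-1 : C) *: (unrealify (g y) + (unrealify (g y))^t*).
have hH y : (H y)^t* = H y.
  by rewrite /H adjmxZ adjmxD trmxCK addrC fmorphV rmorph_nat.
have HF y : A y -> U (phi y) -> H (phi y) = F y.
  move=> Ay Uy; rewrite /H -Fg// realifyK -SS// adjmxM (pS _ Ay).1.
  by rewrite -mulr2n -[X in _ *: X]scaler_nat scalerA mulVf ?scale1r// pnatr_eq0.
have KH (K : (V -> R) -> Prop) : regular_class U K -> 
    mx_in_class K (fun y => unrealify (g y)) -> mx_in_class K H.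
  move=> KU Kg; apply: (class_mxZ KU); first exact: (cplx_in_cst KU).
  by apply: (class_mxD KU) => //; exact: (class_mxJ KU).
have CH k : mx_in_class (fun f : V -> R => Ck k U f) H.
  apply: KH; first exact: regular_Ck.
  have Cgk := (Ck_mxP k g oU).1 (Cg k).
  by move=> j l; split; [apply: (Ck_ext oU _ (Cgk j (lshift n l)))|
    apply: (Ck_ext oU _ (Cgk j (rshift n l)))] => y _; rewrite mxE.
have sH : smooth_mx idfun U H.
  by move=> j k; split=> y Uy; [exists U, (fun z => complex.Re (H z j k))|
    exists U, (fun z => complex.Im (H z j k))]; split=> // l; have [] := CH l j k.
pose U' := U `&` [set y | posdefmx (H y)].
have oU' : open U'.
  rewrite openE => y [Uy py].
  have [W nW HW] := smooth_mx_posdef_nbhs sH (fun z _ => hH z) Uy py.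
  apply: filterS2 (open_nbhs_nbhs (conj oU Uy)) nW => z Uz Wz.
  by split; [exact: Uz|exact: HW].
have /choice [S' HS'] : forall y, exists S' : 'M[C]_n, U' y -> posdefmx S' /\ S' *m S' = H y.
  move=> y; have [[Uy /posdef_sqrt [S' pS' S'S']]|nUy] := pselect (U' y).
    by exists S'.
  by exists 0 => /nUy.
have CS' k : mx_in_class (fun f : V -> R => Ck k U' f) S'.
  apply: (Ck_sqrt oU' (fun y Uy => (HS' y Uy).1) (fun y Uy => (HS' y Uy).2)).
  by move=> l j m; split; apply: (@Ck_sub _ _ _ _ U) => [y []//|];
    have [] := CH l j m.
have U'x : U' (phi x).
  split=> //=; rewrite HF// -SS//; apply: herm_sqr_posdef; first exact: (pS _ Ax).1.
  exact/posdef_unit/pS.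
exists U', (fun y => realify (S' y)); split=> //.
  move=> k; apply/(Ck_mxP k _ oU') => j l.
  rewrite -[l]fintype.splitK; case: (fintype.split l) => {}l /=.
    by apply: (Ck_ext oU' _ (CS' k j l).1) => y _; rewrite row_mxEl mxE.
  by apply: (Ck_ext oU' _ (CS' k j l).2) => y _; rewrite row_mxEr mxE.
move=> y Ay U'y; congr realify; have [pS' S'S'] := HS' _ U'y.
apply: (posdef_sqrt_unique (pS y Ay) pS').
by rewrite (SS y Ay) S'S' (HF y Ay U'y.1).
Qed.

End SmoothMatrices.

(** * Matrices of linear maps in frames *)
Section FrameMatrices.
Variable F : fieldType.

Definition frame_mx (U V : vectType F) m n (e : m.-tuple U) (e' : n.-tuple V)
    (f : 'Hom(U, V)) : 'M[F]_(m, n) := \matrix_(j, k) coord e' k (f e`_j).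

Definition frame_vec (V : vectType F) n (e : n.-tuple V) (u : 'rV[F]_n) : V :=
  \sum_j u 0 j *: e`_j.

Lemma frame_vecE (V : vectType F) n (e : n.-tuple V) v : basis_of {:V} e ->
  v = frame_vec e (\row_j coord e j v).
Proof.
move=> be; rewrite {1}(coord_basis be (memvf v)).
by apply: eq_bigr => j _; rewrite mxE.
Qed.

Lemma frame_vec_inj (V : vectType F) n (e : n.-tuple V) : basis_of {:V} e ->
  injective (frame_vec e).
Proof.
move=> be u v uv; apply/rowP => j.
have := congr1 (coord e j) uv; rewrite !coord_sum_free ?(basis_free be)//.
Qed.

Lemma frame_vec_delta (V : vectType F) n (e : n.-tuple V) j :
  frame_vec e (delta_mx 0 j) = e`_j.
Proof.
rewrite /frame_vec (bigD1 j) //= mxE !eqxx scale1r big1 ?addr0// => k kj.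
by rewrite mxE (negPf kj) andbF scale0r.
Qed.

Lemma lfun_frame_vec (U V : vectType F) m n (e : m.-tuple U) (e' : n.-tuple V)
    (f : 'Hom(U, V)) u : basis_of {:V} e' ->
  f (frame_vec e u) = frame_vec e' (u *m frame_mx e e' f).
Proof.
move=> be'; rewrite /frame_vec linear_sum /=.
under [RHS]eq_bigr do rewrite mxE scaler_suml.
rewrite exchange_big /=; apply: eq_bigr => j _; rewrite linearZ /=.
rewrite {1}(coord_basis be' (memvf (f e`_j))) scaler_sumr.
by apply: eq_bigr => k _; rewrite mxE scalerA.
Qed.

Lemma frame_mx_comp (U V W : vectType F) m n p (e : m.-tuple U) (e' : n.-tuple V)
    (e'' : p.-tuple W) (g : 'Hom(V, W)) (f : 'Hom(U, V)) : basis_of {:V} e' ->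
  frame_mx e e'' (g \o f)%VF = frame_mx e e' f *m frame_mx e' e'' g.
Proof.
move=> be'; apply/matrixP => j k; rewrite !mxE comp_lfunE.
rewrite {1}(coord_basis be' (memvf (f e`_j))) !linear_sum.
by apply: eq_bigr => l _; rewrite !mxE !linearZ.
Qed.

Lemma frame_mx1 (V : vectType F) n (e : n.-tuple V) : basis_of {:V} e ->
  frame_mx e e \1%VF = 1%:M.
Proof.
move=> be; apply/matrixP => j k.
by rewrite !mxE id_lfunE coord_free ?(basis_free be) // eq_sym.
Qed.

Lemma frame_mx_inj (U V : vectType F) m n (e : m.-tuple U) (e' : n.-tuple V) :
  basis_of {:U} e -> basis_of {:V} e' -> injective (frame_mx e e').
Proof.
move=> be be' f g fg; apply/lfunP => u.
by rewrite (frame_vecE u be) !(lfun_frame_vec _ _ _ be') fg.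
Qed.

Lemma frame_mxD (U V : vectType F) m n (e : m.-tuple U) (e' : n.-tuple V) f g :
  frame_mx e e' (f + g) = frame_mx e e' f + frame_mx e e' g.
Proof. by apply/matrixP => j k; rewrite !mxE add_lfunE linearD. Qed.

Lemma frame_mxZ (U V : vectType F) m n (e : m.-tuple U) (e' : n.-tuple V) a f :
  frame_mx e e' (a *: f) = a *: frame_mx e e' f.
Proof. by apply/matrixP => j k; rewrite !mxE scale_lfunE linearZ. Qed.

Lemma frame_mxN (U V : vectType F) m n (e : m.-tuple U) (e' : n.-tuple V) f :
  frame_mx e e' (- f) = - frame_mx e e' f.
Proof. by rewrite -scaleN1r frame_mxZ scaleN1r. Qed.

Lemma frame_mx_sur (V : vectType F) n (e : n.-tuple V) (M : 'M[F]_n) :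
  basis_of {:V} e -> exists f : 'End(V), frame_mx e e f = M.
Proof.
move=> be; pose f v : V := frame_vec e ((\row_j coord e j v) *m M).
have lf : linear f.
  move=> a u v; rewrite /f /frame_vec scaler_sumr -big_split /=.
  apply: eq_bigr => j _; rewrite scalerA -scalerDl; congr (_ *: _).
  have -> : (\row_k coord e k (a *: u + v)) =
            a *: (\row_k coord e k u) + (\row_k coord e k v).
    by apply/rowP => k; rewrite !mxE linearP.
  by rewrite mulmxDl -scalemxAl !mxE.
pose lfm := GRing.isLinear.Build F V V _ f lf.
pose f' : {linear V -> V} := HB.pack f lfm.
exists (linfun f'); apply/matrixP => j k; rewrite mxE lfunE /= /f.
rewrite coord_sum_free ?(basis_free be)// (_ : (\row_l coord e l e`_j) = delta_mx 0 j).
  by rewrite -rowE mxE.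
by apply/rowP => l; rewrite !mxE coord_free ?(basis_free be)// eq_sym.
Qed.

(** Used with [U] a subspace of [V], to compute the trace of an extension by
    zero. *)
Lemma frame_trC (U V : vectType F) m n (e : m.-tuple U) (e' : n.-tuple V)
    (f : 'Hom(U, V)) (g : 'Hom(V, U)) : basis_of {:U} e -> basis_of {:V} e' ->
  \tr (frame_mx e e (g \o f)%VF) = \tr (frame_mx e' e' (f \o g)%VF).
Proof.
by move=> be be'; rewrite (frame_mx_comp _ _ _ _ be') (frame_mx_comp _ _ _ _ be)
  mxtrace_mulC.
Qed.

Lemma frame_tr_indep (V : vectType F) m n (e : m.-tuple V) (e' : n.-tuple V)
    (f : 'End(V)) : basis_of {:V} e -> basis_of {:V} e' ->
  \tr (frame_mx e e f) = \tr (frame_mx e' e' f).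
Proof.
by move=> be be'; rewrite -[f in LHS]comp_lfun1l (frame_trC _ _ be be') comp_lfun1r.
Qed.
End FrameMatrices.

(** * Orthonormal frames *)
Section HermitianSpace.
Variables (R : realType) (V : vectType R[i]) (dot : {dot V for @Num.conj R[i]}).
Local Notation C := R[i].
Implicit Types (f g : 'End(V)) (u v : V) (W : {vspace V}).

Lemma mx_inE n (e : n.-tuple V) f : mx_in e f = frame_mx e e f.
Proof. by []. Qed.

Section MxIn.
Variables (n : nat) (e : n.-tuple V).
Hypothesis be : basis_of {:V} e.

Lemma mx_in_comp f g : mx_in e (g \o f)%VF = mx_in e f *m mx_in e g.
Proof. exact: frame_mx_comp. Qed.

Lemma mx_in_add f g : mx_in e (f + g) = mx_in e f + mx_in e g.
Proof. exact: frame_mxD. Qed.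

Lemma mx_in_opp f : mx_in e (- f) = - mx_in e f.
Proof. exact: frame_mxN. Qed.

Lemma mx_in_scale (a : C) f : mx_in e (a *: f) = a *: mx_in e f.
Proof. exact: frame_mxZ. Qed.

Lemma mx_in_id : mx_in e \1%VF = 1%:M.
Proof. exact: frame_mx1. Qed.

Lemma mx_in_inj : injective (mx_in e).
Proof. exact: frame_mx_inj. Qed.

Lemma mx_in_sur (A : 'M[C]_n) : exists f, mx_in e f = A.
Proof. exact: frame_mx_sur. Qed.
End MxIn.

Lemma lfun_trE n (e : n.-tuple V) f : basis_of {:V} e -> lfun_tr f = \tr (mx_in e f).
Proof. by move=> be; apply: frame_tr_indep be; exact: vbasisP. Qed.

Definition gram n (e : n.-tuple V) : 'M[C]_n := \matrix_(j, k) dot e`_j e`_k.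

Lemma dot_frame_vec n (e : n.-tuple V) (u v : 'rV_n) :
  dot (frame_vec e u) (frame_vec e v) = (u *m gram e *m v^t*) 0 0.
Proof.
rewrite /frame_vec linear_sumr mxE; apply: eq_bigr => k _.
rewrite linearZr_LR /= linear_sumlz mxE mulr_suml mulr_sumr.
by apply: eq_bigr => j _; rewrite linearZl_LR /= !mxE mulrC.
Qed.

Lemma dotC u v : dot u v = (dot v u)^*%R.
Proof. by rewrite hermC expr0 mul1r. Qed.

Lemma dot0r u : dot u 0 = 0.
Proof. by rewrite linear0r. Qed.

Lemma dot0l u : dot 0 u = 0.
Proof. by rewrite dotC dot0r conjC0. Qed.

Lemma dotDl u v w : dot (u + v) w = dot u w + dot v w.
Proof. by rewrite linearDl. Qed.

Lemma dotDr u v w : dot w (u + v) = dot w u + dot w v.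
Proof. by rewrite linearDr. Qed.

Lemma dotBl u v w : dot (u - v) w = dot u w - dot v w.
Proof. by rewrite linearBl. Qed.

Lemma dotBr u v w : dot w (u - v) = dot w u - dot w v.
Proof. by rewrite linearBr. Qed.

Lemma dotZl (a : C) u v : dot (a *: u) v = a * dot u v.
Proof. by rewrite linearZl_LR. Qed.

Lemma dotZr (a : C) u v : dot u (a *: v) = a^*%R * dot u v.
Proof. by rewrite linearZr_LR. Qed.

Lemma gram_herm n (e : n.-tuple V) : (gram e)^t* = gram e.
Proof. by apply/matrixP => j k; rewrite !mxE -dotC. Qed.

Lemma gram_posdef n (e : n.-tuple V) : basis_of {:V} e -> posdefmx (gram e).
Proof.
move=> be; split=> [|u u0]; first exact: gram_herm.
rewrite /hform -dot_frame_vec; apply: neq0_dnorm_gt0.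
apply: contraNneq u0 => u0; apply/eqP/(frame_vec_inj be); rewrite u0.
by rewrite /frame_vec big1 // => j _; rewrite mxE scale0r.
Qed.

Section OrthonormalFrame.
Variables (n : nat) (e : n.-tuple V).
Hypothesis be : basis_of {:V} e.
Hypothesis oe : gram e = 1%:M.

Lemma dot_onframe (u v : 'rV_n) :
  dot (frame_vec e u) (frame_vec e v) = (u *m v^t*) 0 0.
Proof. by rewrite dot_frame_vec oe mulmx1. Qed.

Lemma coord_onframe l v : coord e l v = dot v e`_l.
Proof.
rewrite [in RHS](frame_vecE v be) -(frame_vec_delta e l) dot_onframe.
rewrite mxE (bigD1 l) //= big1 => [|m ml]; rewrite !mxE ?eqxx ?conjC1 ?mulr1 ?addr0//.
by rewrite (negPf ml) andbF conjC0 mulr0.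
Qed.

Lemma Herm_mx f : Herm dot f <-> (mx_in e f)^t* = mx_in e f.
Proof.
split=> [hf|hf u v].
  by apply/matrixP => j k; rewrite !mxE !coord_onframe hf -dotC.
rewrite (frame_vecE u be) (frame_vecE v be) !(lfun_frame_vec _ _ _ be) !dot_onframe.
by rewrite -!mx_inE adjmxM hf mulmxA.
Qed.

Lemma dot_hform f (u : 'rV_n) :
  dot (f (frame_vec e u)) (frame_vec e u) = hform (mx_in e f) u.
Proof. by rewrite (lfun_frame_vec _ _ _ be) dot_onframe. Qed.

Lemma frame_vec_eq0 (u : 'rV_n) : (frame_vec e u == 0) = (u == 0).
Proof.
have E : frame_vec e (0 : 'rV_n) = 0.
  by rewrite /frame_vec big1 // => j _; rewrite mxE scale0r.
by rewrite -[X in _ == X]E (inj_eq (frame_vec_inj be)).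
Qed.

Lemma HPD_mx f : HPD dot f <-> posdefmx (mx_in e f).
Proof.
split=> [[/Herm_mx hf pf]|[/Herm_mx hf pf]]; split=> // u u0.
  by rewrite -dot_hform; apply: pf; rewrite frame_vec_eq0.
rewrite (frame_vecE u be) dot_hform; apply: pf.
by rewrite -frame_vec_eq0 -(frame_vecE u be).
Qed.
End OrthonormalFrame.

(** The Loewdin orthonormalisation of a frame, for [S] the square root of its
    Gram matrix.  Unlike the Gram-Schmidt process it is a closed formula, hence
    visibly smooth in the frame. *)
Definition lowdin n (e : n.-tuple V) (S : 'M[C]_n) : n.-tuple V :=
  [tuple frame_vec e (row j (invmx S)) | j < n].

Section Lowdin.
Variables (n : nat) (e : n.-tuple V) (S : 'M[C]_n).
Hypothesis be : basis_of {:V} e.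
Hypothesis pS : posdefmx S.
Hypothesis SS : S *m S = gram e.

Lemma lowdin_nth (j : 'I_n) : (lowdin e S)`_j = frame_vec e (row j (invmx S)).
Proof. by rewrite (nth_map j) -?tnth_nth ?size_enum_ord// tnth_ord_tuple. Qed.

Lemma frame_vec_lowdin (u : 'rV_n) : frame_vec (lowdin e S) u = frame_vec e (u *m invmx S).
Proof.
rewrite /frame_vec; under [RHS]eq_bigr do rewrite mxE scaler_suml.
rewrite exchange_big; apply: eq_bigr => j _; rewrite lowdin_nth scaler_sumr.
by apply: eq_bigr => k _; rewrite mxE scalerA.
Qed.

Lemma lowdin_basis : basis_of {:V} (lowdin e S).
Proof.
have uS := posdef_unit pS.
rewrite basisEdim (size_basis be) size_tuple leqnn andbT.
apply/subvP => v _; rewrite (frame_vecE v be) -[X in frame_vec _ X](mulmxK uS).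
rewrite -frame_vec_lowdin; apply: rpred_sum => j _; apply: rpredZ.
by apply: memv_span; rewrite mem_nth ?size_tuple.
Qed.

Lemma lowdin_gram : gram (lowdin e S) = 1%:M.
Proof.
have uS := posdef_unit pS.
apply/matrixP => j k; rewrite mxE -!frame_vec_delta !frame_vec_lowdin dot_frame_vec.
rewrite -SS adjmxM adjmx_inv pS.1 !mulmxA mulmxKV// mulmxK//.
rewrite mxE (bigD1 j) //= big1 => [|l lj]; rewrite !mxE ?eqxx ?mul1r ?addr0.
  by rewrite eq_sym; case: eqP => _; rewrite ?conjC1 ?conjC0.
by rewrite (negPf lj) andbF mul0r.
Qed.

(** The change of frame is by [S], so matrices in the given frame and in the
    orthonormal one are smooth together. *)
Lemma lowdin_mx f : mx_in (lowdin e S) f = invmx S *m mx_in e f *m S.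
Proof.
have bl := lowdin_basis; have uS := posdef_unit pS.
apply/row_matrixP => j; rewrite !row_mul; apply: (frame_vec_inj bl).
rewrite [row j (mx_in _ _)]rowE; transitivity (f (frame_vec (lowdin e S) (delta_mx 0 j))).
  by rewrite (lfun_frame_vec _ _ _ bl).
rewrite frame_vec_delta lowdin_nth (lfun_frame_vec _ _ _ be) frame_vec_lowdin.
by rewrite mulmxK.
Qed.
End Lowdin.

Lemma exists_onframe n : \dim {:V} = n ->
  exists2 e : n.-tuple V, basis_of {:V} e & gram e = 1%:M.
Proof.
move=> <-; have [S pS SS] := posdef_sqrt (gram_posdef (vbasisP {:V})).
exists (lowdin (vbasis {:V}) S); first exact: lowdin_basis (vbasisP _) pS.
exact: lowdin_gram.
Qed.

End HermitianSpace.

(** * Orthogonal projections and extensions by zero *)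

(* Locked, as are [oext], [orefl] and [dsum] below: unfolding them leads conversion
   into the coordinates of chosen complements. *)
HB.lock Definition oproj (R : realType) (V : vectType R[i])
    (dot : {dot V for @Num.conj R[i]}) (W : {vspace V}) : 'End(V) :=
  daddv_pi W (orthov dot W).

HB.lock Definition oext (R : realType) (V : vectType R[i])
    (dot : {dot V for @Num.conj R[i]}) (W : {vspace V}) (h : 'End(subvs_of W)) : 'End(V) :=
  (linfun (@vsval _ _ W) \o h \o linfun (@vsproj _ _ W) \o oproj dot W)%VF.

Section Subspaces.
Variables (R : realType) (V : vectType R[i]) (dot : {dot V for @Num.conj R[i]}).
Local Notation C := R[i].
Implicit Types (f g : 'End(V)) (u v : V) (W : {vspace V}).
Local Notation "W ^p" := (orthov dot W) (at level 2, format "W ^p").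

Local Notation oproj := (oproj dot).
Local Notation oext := (oext dot).
Definition orestr W f : 'End(subvs_of W) :=
  (linfun (@vsproj _ _ W) \o f \o linfun (@vsval _ _ W))%VF.
Definition subdot W (u v : subvs_of W) : C := dot (vsval u) (vsval v).

Lemma mem_perpP W u : reflect (forall v, v \in W -> dot u v = 0) (u \in W^p).
Proof. exact: mem_orthovP. Qed.

Lemma dot_perpl W u v : u \in W -> v \in W^p -> dot v u = 0.
Proof. by move=> uW /mem_perpP; apply. Qed.

Lemma dot_perpr W u v : u \in W -> v \in W^p -> dot u v = 0.
Proof. by move=> uW vW; rewrite dotC (dot_perpl uW vW) conjC0. Qed.

Lemma orthov_cap W : (W :&: W^p = 0)%VS.
Proof.
apply/eqP; rewrite -subv0; apply/subvP => v /memv_capP[vW vp].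
by rewrite memv0 -(dnorm_eq0 dot) (dot_perpl vW vp).
Qed.

Lemma orthov_add W : (W + W^p = fullv)%VS.
Proof.
apply/eqP; rewrite eqEsubv subvf /=; apply/subvP => v _.
have [a aW [b [-> _ bW]]] := orthogonal_split dot (vbasis W) v.
rewrite (span_basis (vbasisP W)) in aW; apply: memv_add => //; apply/mem_perpP => w.
rewrite -(span_basis (vbasisP W)) => wW; apply: (span_orthogonal bW) => //.
exact: memv_span1.
Qed.

Lemma oprojE W : oproj W = daddv_pi W W^p.
Proof. by rewrite oproj.unlock. Qed.

Lemma oproj_mem W u : oproj W u \in W.
Proof. by rewrite oprojE memv_pi. Qed.

Lemma oproj_id W u : u \in W -> oproj W u = u.
Proof. by rewrite oprojE; apply: daddv_pi_id; exact: orthov_cap. Qed.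

Lemma oproj_compl W u : u - oproj W u \in W^p.
Proof.
have E : oproj W u + daddv_pi W^p W u = u.
  by rewrite oprojE; apply: daddv_pi_add; [exact: orthov_cap|rewrite orthov_add memvf].
by rewrite -[X in X - _]E addrC addKr memv_pi.
Qed.

Lemma oproj_unique W u a : a \in W -> u - a \in W^p -> oproj W u = a.
Proof.
move=> aW uaW; apply/eqP; rewrite -subr_eq0 -memv0 -(orthov_cap W) memv_cap.
rewrite rpredB ?oproj_mem//=.
have -> : oproj W u - a = (u - a) - (u - oproj W u).
  by rewrite opprB [RHS]addrC addrA subrK.
by rewrite rpredB ?oproj_compl.
Qed.

Lemma oproj_perp W u : u \in W^p -> oproj W u = 0.
Proof. by move=> uW; apply: oproj_unique; rewrite ?mem0v// subr0. Qed.

Lemma oproj_idem W : (oproj W \o oproj W)%VF = oproj W.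
Proof. by apply/lfunP => u; rewrite comp_lfunE oproj_id ?oproj_mem. Qed.

Lemma oproj_Herm W : Herm dot (oproj W).
Proof.
move=> u v; transitivity (dot (oproj W u) (oproj W v)).
  rewrite -[v in LHS](subrK (oproj W v)) dotDr /=.
  by rewrite (dot_perpr (oproj_mem _ _) (oproj_compl _ _)) add0r.
rewrite -[u in RHS](subrK (oproj W u)) dotDl /=.
by rewrite (dot_perpl (oproj_mem _ _) (oproj_compl _ _)) add0r.
Qed.

Lemma oproj_orthov W : oproj W^p = (\1 - oproj W)%VF.
Proof.
apply/lfunP => u; rewrite add_lfunE opp_lfunE id_lfunE.
apply: oproj_unique; first exact: oproj_compl.
rewrite opprB addrCA subrr addr0; apply/mem_perpP => w wW.
exact: dot_perpr (oproj_mem _ _) wW.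
Qed.

(** How a subspace is obtained from a smooth family of idempotent matrices. *)
Lemma Herm_idem_oproj g : Herm dot g -> (g \o g)%VF = g -> oproj (limg g) = g.
Proof.
move=> hg gg; apply/lfunP => u; apply: oproj_unique.
  by apply: memv_img; exact: memvf.
apply/mem_perpP => _ /memv_imgP[w _ ->].
rewrite -(hg (u - g u) w) linearB /= -[g (g u)]comp_lfunE gg subrr.
exact: dot0l.
Qed.

Lemma dim_orthov W : (\dim W + \dim W^p)%N = \dim {:V}.
Proof. by rewrite -dimv_disjoint_sum ?orthov_cap// orthov_add. Qed.

Lemma oextE W (h : 'End(subvs_of W)) u : oext h u = vsval (h (vsproj W (oproj W u))).
Proof. by rewrite oext.unlock !comp_lfunE !lfunE. Qed.

Lemma oext_val W (h : 'End(subvs_of W)) w : oext h (vsval w) = vsval (h w).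
Proof. by rewrite oextE oproj_id ?subvsP// vsvalK. Qed.

Lemma oext_mem W (h : 'End(subvs_of W)) u : oext h u \in W.
Proof. by rewrite oextE subvsP. Qed.

Lemma oext_oproj W (h : 'End(subvs_of W)) : (oext h \o oproj W)%VF = oext h.
Proof.
by apply/lfunP => u; rewrite comp_lfunE !oextE (oproj_id (oproj_mem _ _)).
Qed.

Lemma oproj_oext W (h : 'End(subvs_of W)) : (oproj W \o oext h)%VF = oext h.
Proof. by apply/lfunP => u; rewrite comp_lfunE oproj_id ?oext_mem. Qed.

Lemma oext_inj W : injective (fun h : 'End(subvs_of W) => oext h).
Proof.
move=> h h' /= hh'; apply/lfunP => w; apply: subvs_inj.
by rewrite -!oext_val hh'.
Qed.

Lemma oext_restr W f : (f \o oproj W)%VF = (oproj W \o f)%VF ->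
  oext (orestr W f) = (f \o oproj W)%VF.
Proof.
move=> cf; apply/lfunP => u; rewrite oextE !comp_lfunE !lfunE /=.
rewrite (vsprojK (oproj_mem _ _)) vsprojK// -[f _]comp_lfunE cf comp_lfunE.
exact: oproj_mem.
Qed.

Lemma oext_tr W (h : 'End(subvs_of W)) : lfun_tr (oext h) = lfun_tr h.
Proof.
rewrite /lfun_tr !mx_inE oext.unlock -!comp_lfunA.
rewrite (frame_trC _ _ (vbasisP _) (vbasisP _)).
congr (\tr (frame_mx _ _ _)); apply/lfunP => w.
by rewrite !comp_lfunE !lfunE /= oproj_id ?subvsP// vsvalK.
Qed.

Lemma lfun_tr1 (U : vectType C) : lfun_tr (\1%VF : 'End(U)) = (\dim {:U})%:R.
Proof. by rewrite /lfun_tr mx_inE frame_mx1 ?vbasisP// mxtrace1. Qed.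

Lemma lfun_trD f g : lfun_tr (f + g) = lfun_tr f + lfun_tr g.
Proof. by rewrite /lfun_tr !mx_inE frame_mxD linearD. Qed.

Lemma lfun_trZ (U : vectType C) a (f : 'End(U)) : lfun_tr (a *: f) = a * lfun_tr f.
Proof. by rewrite /lfun_tr !mx_inE frame_mxZ linearZ. Qed.

(** The projection is the extension by zero of the identity of [W]. *)
Lemma oproj_tr W : lfun_tr (oproj W) = (\dim W)%:R.
Proof.
have -> : oproj W = oext (\1%VF : 'End(subvs_of W)).
  by apply/lfunP => u; rewrite oextE id_lfunE (vsprojK (oproj_mem _ _)).
by rewrite oext_tr lfun_tr1 dimvf.
Qed.

Lemma oext_limg W (h : 'End(subvs_of W)) :
  limg (oext h) = (linfun (@vsval _ _ W) @: limg h)%VS.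
Proof.
apply/eqP; rewrite eqEsubv; apply/andP; split; apply/subvP => u.
  move=> /memv_imgP[v _ ->]; rewrite oextE -[vsval _]lfunE /=.
  by rewrite !memv_img ?memvf.
move=> /memv_imgP[_ /memv_imgP[w _ ->] ->]; rewrite lfunE /= -oext_val.
by rewrite memv_img ?memvf.
Qed.

Lemma oext_rank W (h : 'End(subvs_of W)) : lfun_rank (oext h) = lfun_rank h.
Proof.
rewrite /lfun_rank oext_limg limg_dim_eq//.
apply/eqP; rewrite -subv0; apply/subvP => w /memv_capP[_].
by rewrite memv_ker lfunE /= memv0 -(inj_eq (@subvs_inj _ _ W)) linear0.
Qed.

Lemma dot_oext W (h : 'End(subvs_of W)) u v :
  dot (oext h u) v = subdot (h (vsproj W (oproj W u))) (vsproj W (oproj W v)).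
Proof.
rewrite /subdot (vsprojK (oproj_mem _ _)) -oextE.
by rewrite -(oproj_Herm W) oproj_id ?oext_mem.
Qed.

Lemma Herm_oext W (h : 'End(subvs_of W)) : Herm (@subdot W) h <-> Herm dot (oext h).
Proof.
split=> [hh u v|hh u v].
  by rewrite [RHS]dotC !dot_oext hh; exact: dotC.
by rewrite /subdot -!oext_val.
Qed.

Lemma HP_oext W (h : 'End(subvs_of W)) : HP (@subdot W) h <-> HP dot (oext h).
Proof.
split=> -[/Herm_oext hh ph]; split=> // u; first by rewrite dot_oext; exact: ph.
by rewrite /subdot -oext_val; exact: ph.
Qed.

Lemma HPD_oext W (h : 'End(subvs_of W)) : HPD (@subdot W) h <->
  Herm dot (oext h) /\ forall u, u \in W -> u != 0 -> 0 < dot (oext h u) u.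
Proof.
split=> -[/Herm_oext hh ph]; split=> // u.
  move=> uW u0; rewrite dot_oext oproj_id//; apply: ph.
  by rewrite -(inj_eq (@subvs_inj _ _ W)) vsprojK// linear0.
move=> u0; rewrite /subdot -oext_val; apply: ph; first exact: subvsP.
by rewrite -(linear0 (@vsval _ _ W)) (inj_eq (@subvs_inj _ _ W)).
Qed.

End Subspaces.

(** * Spectral gaps *)

(** Two projections that commute with [A] and split its spectrum at [c1 <= c2]
    are nested.  On the range of [p1], [A] is less than [c1], and on the range
    of [1 - p2] it is greater than [c2]; so [X = p1 (1 - p2)], which commutes with
    [A], satisfies a Sylvester equation with positive definite coefficients and
    vanishes. *)
Lemma spectral_gap_mx (C : numClosedFieldType) n (A p1 p2 : 'M[C]_n) c1 c2 :
  c1 <= c2 -> A *m p1 = p1 *m A -> A *m p2 = p2 *m A ->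
  p1 *m p1 = p1 -> p2 *m p2 = p2 ->
  posdefmx ((1%:M - 2%:R *: p1) *m (A - c1%:M)) ->
  posdefmx ((1%:M - 2%:R *: p2) *m (A - c2%:M)) ->
  p1 *m p2 = p1.
Proof.
move=> c12 Ap1 Ap2 pp1 pp2 pS1 pS2; set S1 := _ *m _ in pS1; set S2 := _ *m _ in pS2.
pose X := p1 *m (1%:M - p2).
have pS1' : posdefmx (S1 + (c2 - c1)%:M).
  have cr : (c2 - c1)^*%R = c2 - c1 by apply/CrealP; rewrite realE subr_ge0 c12.
  split=> [|u u0].
    by rewrite adjmxD pS1.1 tr_scalar_mx map_scalar_mx /= cr.
  rewrite hformD -scalemx1 hformZ ltr_wpDr ?(pS1.2 u u0)//.
  by rewrite mulr_ge0 ?subr_ge0// hform1_ge0.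
have p1X : p1 *m X = X by rewrite /X mulmxA pp1.
have Xp2 : X *m p2 = 0 by rewrite /X -mulmxA mulmxBl mul1mx pp2 subrr mulmx0.
have AX : A *m X = X *m A.
  by rewrite /X mulmxA Ap1 -!mulmxA mulmxBr mulmxBl mulmx1 mul1mx Ap2.
have S1X : S1 *m X = c1 *: X - A *m X.
  have AcX : (A - c1%:M) *m X = A *m X - c1 *: X by rewrite mulmxBl mul_scalar_mx.
  have p1A : p1 *m (A *m X - c1 *: X) = A *m X - c1 *: X.
    by rewrite mulmxBr -scalemxAr p1X mulmxA -Ap1 -mulmxA p1X.
  rewrite /S1 -mulmxA AcX mulmxBl mul1mx -scalemxAl p1A scaler_nat mulr2n opprD.
  by rewrite addrA subrr sub0r opprB.
have XS2 : X *m S2 = A *m X - c2 *: X.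
  have X2 : X *m (1%:M - 2%:R *: p2) = X.
    by rewrite mulmxBr mulmx1 -scalemxAr Xp2 scaler0 subr0.
  by rewrite /S2 mulmxA X2 mulmxBr mul_mx_scalar AX.
have /(posdef_sylvester pS1' pS2) X0 : (S1 + (c2 - c1)%:M) *m X + X *m S2 = 0.
  rewrite mulmxDl S1X XS2 mul_scalar_mx scalerBl.
  move: (c1 *: X) (c2 *: X) (A *m X) => a b d.
  by apply/matrixP => j k; rewrite !mxE; ring.
by move/eqP: X0; rewrite /X mulmxBr mulmx1 subr_eq0 => /eqP.
Qed.

HB.lock Definition orefl (R : realType) (V : vectType R[i])
    (dot : {dot V for @Num.conj R[i]}) (W : {vspace V}) : 'End(V) :=
  \1%VF - 2%:R *: oproj dot W.

Section Gap.
Variables (R : realType) (V : vectType R[i]) (dot : {dot V for @Num.conj R[i]}).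
Local Notation C := R[i].
Implicit Types (f g : 'End(V)) (u v : V) (W : {vspace V}) (c : C).
Local Notation "W ^p" := (orthov dot W) (at level 2, format "W ^p").
Local Notation pi := (oproj dot).

Local Notation orefl := (orefl dot).

Lemma oreflE W : orefl W = (\1 - 2%:R *: pi W)%VF.
Proof. by rewrite orefl.unlock. Qed.

(** [f < c] on [W] and [f > c] on its orthogonal complement, for an invariant
    [W]; written as one positive definiteness condition, which is open in [f]
    and [W]. *)
Definition gap W c f : Prop :=
  [/\ 0 < c, Herm dot f, (f \o pi W = pi W \o f)%VF &
      HPD dot ((f - c *: \1) \o orefl W)%VF].

Lemma HermD f g : Herm dot f -> Herm dot g -> Herm dot (f + g).
Proof. by move=> hf hg u v; rewrite !add_lfunE dotDl dotDr /= hf hg. Qed.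

Lemma HermZ f c : c \is Num.real -> Herm dot f -> Herm dot (c *: f).
Proof.
move=> /CrealP cr hf u v; rewrite !scale_lfunE dotZl dotZr /= hf.
by rewrite cr.
Qed.

Lemma Herm_comp f g : Herm dot f -> Herm dot g -> (f \o g = g \o f)%VF ->
  Herm dot (f \o g)%VF.
Proof. by move=> hf hg fg u v; rewrite [in RHS]fg !comp_lfunE hf hg. Qed.

Lemma Herm1 : Herm dot \1%VF.
Proof. by move=> u v; rewrite !id_lfunE. Qed.

Lemma gap_perp W c f u : gap W c f -> u \in W^p -> u != 0 ->
  c * dot u u < dot (f u) u.
Proof.
move=> [_ _ _ [_ pf]] uW /pf; rewrite comp_lfunE.
have -> : orefl W u = u.
  by rewrite oreflE add_lfunE opp_lfunE scale_lfunE id_lfunE oproj_perp// scaler0 subr0.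
rewrite add_lfunE opp_lfunE scale_lfunE id_lfunE dotBl dotZl /=.
by rewrite subr_gt0.
Qed.

Lemma Herm_gap W c f : c \is Num.real -> Herm dot f ->
  (f \o pi W = pi W \o f)%VF -> Herm dot ((f - c *: \1) \o orefl W)%VF.
Proof.
move=> cr hf cf; apply: Herm_comp.
- by rewrite -scaleN1r; apply: HermD => //; rewrite scalerA; apply: HermZ;
    [rewrite mulN1r rpredN|exact: Herm1].
- rewrite oreflE -scaleNr; apply: HermD; [exact: Herm1|apply: HermZ; last exact: oproj_Herm].
  by rewrite rpredN realn.
- apply/lfunP => u; rewrite oreflE !(comp_lfunE, add_lfunE, opp_lfunE, scale_lfunE, id_lfunE).
  rewrite (linearB f) (linearZ_LR f) (linearB (pi W)) (linearZ_LR (pi W)) /=.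
  rewrite -[f (pi W u)]comp_lfunE cf comp_lfunE !scalerBr !scalerA [c * 2%:R]mulrC.
  by rewrite !opprD !opprK addrACA.
Qed.

Lemma gap_intro W c f : 0 < c -> Herm dot f -> (f \o pi W = pi W \o f)%VF ->
  (forall u, u \in W -> u != 0 -> dot (f u) u < c * dot u u) ->
  (forall u, u \in W^p -> u != 0 -> c * dot u u < dot (f u) u) -> gap W c f.
Proof.
move=> c0 hf cf fW fWp; split=> //; have cr : c \is Num.real by rewrite realE ltW.
split.
  exact: Herm_gap.
move=> u u0; set a := pi W u; set b := u - a.
have aW : a \in W := oproj_mem dot W u; have bW : b \in W^p := oproj_compl dot W u.
have ab : u = a + b by rewrite /b addrC subrK.
have fa : f a \in W by rewrite /a -[f _]comp_lfunE cf comp_lfunE oproj_mem.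
have fb : f b \in W^p.
  apply/mem_perpP => w wW; rewrite hf -(oproj_id dot wW) -[f _]comp_lfunE cf comp_lfunE.
  exact: dot_perpl (oproj_mem _ _ _) bW.
have ->: ((f - c *: \1) \o orefl W)%VF u = (f b - c *: b) - (f a - c *: a).
  have -> : ((f - c *: \1) \o orefl W)%VF u = f (orefl W u) - c *: orefl W u.
    by rewrite comp_lfunE add_lfunE opp_lfunE scale_lfunE id_lfunE.
  have -> : orefl W u = b - a.
    rewrite oreflE add_lfunE opp_lfunE scale_lfunE id_lfunE -/a scaler_nat mulr2n opprD.
    by rewrite addrA.
  rewrite linearB scalerBr /=.
  by rewrite !opprD !opprK addrACA.
clearbody b; clearbody a.
have -> : dot (f b - c *: b - (f a - c *: a)) u =
   (dot (f b) b - c * dot b b) + (c * dot a a - dot (f a) a).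
  rewrite [X in dot _ X]ab dotDr /= !dotBl !dotZl /=.
  rewrite (dot_perpl aW fb) (dot_perpl aW bW) (dot_perpr fa bW) (dot_perpr aW bW).
  by rewrite !mulr0 !subr0 sub0r opprB addrC.
have leb : 0 <= dot (f b) b - c * dot b b.
  by have [->|/(fWp _ bW)/ltW] := eqVneq b 0; rewrite subr_ge0// !dot0r mulr0.
have lea : 0 <= c * dot a a - dot (f a) a.
  by have [->|/(fW _ aW)/ltW] := eqVneq a 0; rewrite subr_ge0// !dot0r mulr0.
have [a0|a0] := eqVneq a 0; last by rewrite ltr_wpDl// subr_gt0; exact: fW.
rewrite ltr_wpDr// subr_gt0; apply: fWp => //.
by apply: contraNneq u0 => b0; rewrite ab a0 b0 addr0.
Qed.

Lemma orefl_mx n (e : n.-tuple V) W : basis_of {:V} e ->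
  mx_in e (orefl W) = 1%:M - 2%:R *: mx_in e (pi W).
Proof. by move=> be; rewrite oreflE mx_in_add mx_in_opp mx_in_scale mx_in_id. Qed.

Lemma gap_mx n (e : n.-tuple V) W c f : basis_of {:V} e -> gram dot e = 1%:M ->
  gap W c f -> [/\ mx_in e f *m mx_in e (pi W) = mx_in e (pi W) *m mx_in e f,
    mx_in e (pi W) *m mx_in e (pi W) = mx_in e (pi W) &
    posdefmx ((1%:M - 2%:R *: mx_in e (pi W)) *m (mx_in e f - c%:M))].
Proof.
move=> be oe [_ _ cf pf]; split.
- by rewrite -!mx_in_comp// cf.
- by rewrite -!mx_in_comp// oproj_idem.
have /(HPD_mx be oe) := pf; rewrite (mx_in_comp be) (orefl_mx _ be).
by rewrite mx_in_add mx_in_opp mx_in_scale (mx_in_id be) scalemx1.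
Qed.

(** The smaller of the two cuts defines a spectral subspace contained in the
    other, and dimensions agree. *)
Lemma gap_unique W1 W2 c1 c2 f : gap W1 c1 f -> gap W2 c2 f ->
  \dim W1 = \dim W2 -> W1 = W2.
Proof.
have [e be oe] := exists_onframe dot (erefl (\dim {:V})).
wlog c12 : W1 W2 c1 c2 / c1 <= c2.
  move=> H g1 g2 dW; have [c1r c2r] : c1 \is Num.real /\ c2 \is Num.real.
    by split; rewrite realE ltW//; [case: g1|case: g2].
  have /orP[c12|c21] := real_leVge c1r c2r; first exact: H g1 g2 dW.
  by apply/esym; exact: H g2 g1 (esym dW).
move=> /(gap_mx be oe) [cf1 i1 p1] /(gap_mx be oe) [cf2 i2 p2] dW.
have := spectral_gap_mx c12 cf1 cf2 i1 i2 p1 p2.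
rewrite -mx_in_comp// => /(mx_in_inj be) E.
apply/eqP; rewrite eqEdim dW leqnn andbT; apply/subvP => u uW.
by rewrite -(oproj_id dot uW) -E comp_lfunE oproj_mem.
Qed.

Lemma HPD_lower_bound f : HPD dot f ->
  exists2 e, 0 < e & forall u, e * dot u u <= dot (f u) u.
Proof.
have [e be oe] := exists_onframe dot (erefl (\dim {:V})).
move=> /(HPD_mx be oe) /posdef_lower_bound [r r0 fr]; exists r => // u.
rewrite (frame_vecE u be) (dot_hform be oe) (dot_onframe oe).
by have := fr (\row_j coord e j u); rewrite {1}/hform mulmx1.
Qed.

(** For the positive form [u, v |-> (f u, v)] this is the equality case of the
    Cauchy-Schwarz inequality.  It is obtained from the positivity of the form at
    [u - s f u] for a small [s > 0], whose value is
    [- 2 s |f u|^2 + s^2 (f (f u), f u)]. *)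
Lemma HP_ker f u : HP dot f -> dot (f u) u = 0 -> f u = 0.
Proof.
move=> [hf pf] fu0; apply/eqP; rewrite -(dnorm_eq0 dot).
set w := f u; set a := dot w w; set b := dot (f w) w.
have a0 : 0 <= a := dnorm_ge0 dot w; have b0 : 0 <= b := pf w.
(* The denominator makes s b at most a, and keeps s defined when b = 0. *)
pose s := a / (b + 1); have s0 : 0 <= s by rewrite divr_ge0// addr_ge0.
have sr : s^*%R = s by apply/CrealP; rewrite realE s0.
have := pf (u - s *: w).
rewrite (linearB f) (linearZ_LR f) /= -/w dotBl dotZl !dotBr !dotZr /= fu0.
rewrite (hf w u) -/w -/a -/b sr sub0r => ge0.
apply: contraT => an0; have apos : 0 < a by rewrite lt_def an0.
have sb : s * b <= a.
  rewrite /s mulrAC ler_pdivrMr ?ltr_wpDl// mulrDr mulr1 lerDl//.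
suff : - (s * a) - s * (a - s * b) < 0 by move=> /(le_lt_trans ge0); rewrite ltxx.
have spos : 0 < s by rewrite divr_gt0// ltr_wpDl.
rewrite -opprD oppr_lt0; apply: ltr_pwDl; first exact: mulr_gt0.
by rewrite mulr_ge0 ?subr_ge0.
Qed.

Lemma HP_diag n (e : n.-tuple V) f j : basis_of {:V} e -> gram dot e = 1%:M ->
  mx_in e f j j = dot (f e`_j) e`_j.
Proof. by move=> be oe; rewrite mxE (coord_onframe be oe). Qed.

Lemma HP_tr_ge0 f : HP dot f -> 0 <= lfun_tr f.
Proof.
have [e be oe] := exists_onframe dot (erefl (\dim {:V})).
move=> [_ pf]; rewrite (lfun_trE f be); apply: sumr_ge0 => j _.
by rewrite HP_diag.
Qed.

(** In an orthonormal frame the diagonal entries [(f e_j, e_j)] vanish, hence so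
    do the vectors [f e_j]. *)
Lemma HP_tr_eq0 f : HP dot f -> lfun_tr f = 0 -> f = 0.
Proof.
have [e be oe] := exists_onframe dot (erefl (\dim {:V})).
move=> pf /eqP; rewrite (lfun_trE f be) psumr_eq0 => [/allP trf|j _]; last first.
  by rewrite HP_diag//; exact: pf.2.
apply: (mx_in_inj be); apply/matrixP => j k.
have /eqP := trf j (mem_index_enum j); rewrite HP_diag// => /(HP_ker pf) fj.
by rewrite !mxE fj zero_lfunE linear0.
Qed.

(** [f + pi] is positive definite, hence bounded below by some [e > 0]; the cut
    is at [e / 2]. *)
Lemma gap_exists W f : HP dot f -> (forall u, u \in W -> f u = 0) ->
  (forall u, u \in W^p -> u != 0 -> 0 < dot (f u) u) -> exists c, gap W c f.
Proof.
move=> [hf pf] fW fWp.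
have cf : (f \o pi W = pi W \o f)%VF.
  apply/lfunP => u; rewrite !comp_lfunE fW ?oproj_mem// oproj_perp//.
  by apply/mem_perpP => w wW; rewrite hf fW// dot0r.
have dE u : dot ((f + pi W) u) u = dot (f u) u + dot (pi W u) (pi W u).
  rewrite add_lfunE dotDl /=; congr (_ + _).
  by rewrite -(oproj_Herm dot W) [pi W (pi W u)]oproj_id// oproj_mem.
have [|e e0 fe] := @HPD_lower_bound (f + pi W).
  split=> [|u u0]; first by apply: HermD => //; exact: oproj_Herm.
  rewrite dE; have [a0|a0] := eqVneq (pi W u) 0.
    rewrite ltr_wpDr ?dnorm_ge0//; apply: fWp => //.
    by rewrite -[u]subr0 -a0 oproj_compl.
  by rewrite ltr_wpDl// dnorm_gt0.
exists (e / 2%:R); apply: gap_intro => //.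
- by rewrite divr_gt0 ?ltr0n.
- by move=> u uW u0; rewrite fW// dot0l mulr_gt0 ?divr_gt0 ?ltr0n// dnorm_gt0.
move=> u uW u0; have := fe u; rewrite dE oproj_perp// dot0r addr0.
apply: lt_le_trans; rewrite ltr_pM2r ?dnorm_gt0//.
by rewrite ltr_pdivrMr ?ltr0n// ltr_pMr// ltr1n.
Qed.

End Gap.

(** * The cone coordinates of a positive operator *)
HB.lock Definition dsum (R : realType) (V : vectType R[i])
    (dot : {dot V for @Num.conj R[i]}) (W U : {vspace V}) (a : R[i])
    (h : 'End(subvs_of W)) (k : 'End(subvs_of U)) : 'End(V) :=
  oext dot h + a *: oext dot k.

Section Glue.
Variables (R : realType) (V : vectType R[i]) (dot : {dot V for @Num.conj R[i]}).
Local Notation C := R[i].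
Implicit Types (f g : 'End(V)) (u v : V) (W : {vspace V}) (c : C).
Local Notation "W ^p" := (orthov dot W) (at level 2, format "W ^p").
Local Notation pi := (oproj dot).
Local Notation ext := (oext dot).

Lemma HP_add f g : HP dot f -> HP dot g -> HP dot (f + g).
Proof.
move=> [hf pf] [hg pg]; split=> [|u]; first exact: HermD.
by rewrite add_lfunE dotDl addr_ge0 ?pf ?pg.
Qed.

Lemma HPZ c f : 0 <= c -> HP dot f -> HP dot (c *: f).
Proof.
move=> c0 [hf pf]; split=> [|u]; first by apply: HermZ; rewrite // realE c0.
by rewrite scale_lfunE dotZl mulr_ge0 ?pf.
Qed.

Lemma HP0 : HP dot 0.
Proof.
by split=> [u v|u]; rewrite !zero_lfunE ?dot0l ?dot0r.
Qed.

Lemma oextZ W c (h : 'End(subvs_of W)) : ext (c *: h) = c *: ext h.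
Proof. by apply/lfunP => u; rewrite scale_lfunE !oextE scale_lfunE linearZ. Qed.

Lemma oext0 W : ext (0 : 'End(subvs_of W)) = 0.
Proof. by apply/lfunP => u; rewrite oextE !zero_lfunE linear0. Qed.

Lemma lfun_tr0 (U : vectType C) : lfun_tr (0 : 'End(U)) = 0.
Proof. by rewrite -(scale0r 0) lfun_trZ mul0r. Qed.

(** Normalising the trace: a nonzero positive operator has positive trace. *)
Lemma coneHP1P W (h : 'End(subvs_of W)) :
  coneHP1 (@subdot _ _ dot W) h <-> HP (@subdot _ _ dot W) h /\ lfun_tr h <= 1.
Proof.
split=> [[->|[t [h1 [/andP[t0 t1] [/HP_oext ph1 tr1] ->]]]]|[/HP_oext ph tr1]].
- split; last by rewrite lfun_tr0 ler01.
  by apply/HP_oext; rewrite oext0; exact: HP0.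
- split; last by rewrite lfun_trZ tr1 mulr1 -(lecR t 1) in t1 *.
  by apply/HP_oext; rewrite oextZ; apply: HPZ; rewrite ?ler0c.
have tr0 := HP_tr_ge0 ph; rewrite oext_tr in tr0.
have [trh0|trh0] := eqVneq (lfun_tr h) 0.
  left; apply: (@oext_inj _ _ dot W); rewrite oext0; apply: HP_tr_eq0 ph _.
  by rewrite oext_tr.
right; have [t tE] : exists t : R, lfun_tr h = t%:C.
  by apply/complex_realP; rewrite realE tr0.
exists t, ((lfun_tr h)^-1 *: h); split.
- by rewrite -(ler0c t) -(lecR t 1) -tE tr0.
- split; last by rewrite lfun_trZ mulVf.
  by apply/HP_oext; rewrite oextZ; apply: HPZ; rewrite ?invr_ge0.
- by rewrite -tE scalerA divff// scale1r.
Qed.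

(** A positive operator is positive definite on the complement of its kernel. *)
Lemma gap_of_rank f : HP dot f -> exists c, gap dot (lker f) c f.
Proof.
move=> pf; apply: gap_exists => // [u|u uW u0].
  by rewrite memv_ker => /eqP.
rewrite lt_def pf.2 andbT; apply: contraNneq u0 => /(HP_ker pf)/eqP.
rewrite -memv_ker => uk; rewrite -memv0 -(orthov_cap dot (lker f)).
by rewrite memv_cap uk.
Qed.

Section GlueTheory.
Variables (W U : {vspace V}).
Hypothesis WU : U = W^p.

Local Notation dsum := (dsum dot).
(** The factor [1 - tr h] gives the sum trace 1. *)
Definition splice (h : 'End(subvs_of W)) (k : 'End(subvs_of U)) : 'End(V) :=
  dsum (1 - lfun_tr h) h k.

Lemma projU : pi U = (\1 - pi W)%VF.
Proof. by rewrite WU oproj_orthov. Qed.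

Lemma proj_perp u : u \in U -> pi W u = 0.
Proof. by rewrite WU; exact: oproj_perp. Qed.

Lemma projUW u : pi U (pi W u) = 0.
Proof.
by rewrite projU add_lfunE opp_lfunE id_lfunE (oproj_id dot (oproj_mem dot W u)) subrr.
Qed.

Implicit Types (a : C) (h : 'End(subvs_of W)) (k : 'End(subvs_of U)).

Lemma dsum_proj a h k : (dsum a h k \o pi W)%VF = ext h.
Proof.
rewrite dsum.unlock comp_lfunDl -comp_lfunZl (oext_oproj dot h) -(oext_oproj dot k) -comp_lfunA.
have -> : (pi U \o pi W = 0)%VF.
  by apply/lfunP => u; rewrite comp_lfunE projUW zero_lfunE.
by rewrite comp_lfun0r scaler0 addr0.
Qed.

Lemma proj_dsum a h k : (pi W \o dsum a h k)%VF = ext h.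
Proof.
rewrite dsum.unlock comp_lfunDr -comp_lfunZr (oproj_oext dot h).
have -> : (pi W \o ext k = 0)%VF.
  by apply/lfunP => u; rewrite comp_lfunE zero_lfunE proj_perp// oext_mem.
by rewrite scaler0 addr0.
Qed.

Lemma dsum_tr a h k : lfun_tr (dsum a h k) = lfun_tr h + a * lfun_tr k.
Proof. by rewrite dsum.unlock lfun_trD lfun_trZ (oext_tr dot h) (oext_tr dot k). Qed.

Lemma dsum_HP a h k : 0 <= a -> HP (@subdot _ _ dot W) h ->
  HPD (@subdot _ _ dot U) k -> HP dot (dsum a h k).
Proof.
move=> a0 /HP_oext ph /HPD_oext [hk pk].
rewrite dsum.unlock; apply: (HP_add ph); apply: (HPZ a0).
split; [exact: hk|move=> u]; rewrite dot_oext /subdot -(oext_val dot).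
set v := vsval _; have vU : v \in U by exact: subvsP.
by have [->|/(pk _ vU)/ltW//] := eqVneq v 0; rewrite dot0r.
Qed.

(** A positive definite operator is injective, hence onto. *)
Lemma HPD_limg k : HPD (@subdot _ _ dot U) k -> limg (ext k) = U.
Proof.
move=> [hk pk]; have k0 : lker k == 0%VS.
  rewrite -subv0; apply/subvP => u; rewrite memv_ker memv0 => /eqP ku.
  by apply: contraT => /pk; rewrite /subdot ku linear0 dot0l ltxx.
rewrite oext_limg (lker0_limgf k0).
apply/eqP; rewrite eqEsubv; apply/andP; split; apply/subvP => u.
  by move=> /memv_imgP[w _ ->]; rewrite lfunE /= subvsP.
by move=> uU; rewrite -(vsprojK uU) -[vsval _]lfunE memv_img ?memvf.
Qed.

Lemma capWU : (W :&: U = 0)%VS.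
Proof. by rewrite WU orthov_cap. Qed.

(** The range is the direct sum of the ranges of the two blocks. *)
Lemma dsum_rank a h k : a != 0 -> HPD (@subdot _ _ dot U) k ->
  lfun_rank (dsum a h k) = (lfun_rank h + \dim U)%N.
Proof.
move=> a0 pk; rewrite -(oext_rank dot h) /lfun_rank -dimv_disjoint_sum; last first.
  apply/eqP; rewrite -subv0 -capWU; apply: capvS => //.
  by apply/subvP => _ /memv_imgP[v _ ->]; exact: oext_mem.
congr (\dim _); apply/eqP; rewrite eqEsubv; apply/andP; split; apply/subvP => v.
  move=> /memv_imgP[u _ ->]; rewrite dsum.unlock add_lfunE memv_add// ?memv_img ?memvf//.
  by rewrite scale_lfunE memvZ// oext_mem.
move=> /memv_addP[_ /memv_imgP[u _ ->]] [w wU ->]; apply: memvD.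
  by rewrite -(dsum_proj a h k) comp_lfunE memv_img ?memvf.
have : w \in limg (ext k) by rewrite HPD_limg.
move=> /memv_imgP[u' _ ->].
have hU : ext h (a^-1 *: pi U u') = 0.
  by rewrite oextE proj_perp ?linear0// rpredZ// oproj_mem.
have kU : ext k (a^-1 *: pi U u') = a^-1 *: ext k u'.
  by rewrite linearZ /= -[ext k (pi U u')]comp_lfunE oext_oproj.
have -> : ext k u' = dsum a h k (a^-1 *: pi U u').
  by rewrite dsum.unlock add_lfunE scale_lfunE hU kU add0r scalerA (divff a0) scale1r.
by rewrite memv_img ?memvf.
Qed.

Lemma dsum_inj a h h' k k' : a != 0 -> dsum a h k = dsum a h' k' ->
  h = h' /\ k = k'.
Proof.
move=> a0 E; have hh : h = h'.
  by apply: (@oext_inj _ _ dot W); rewrite -(dsum_proj a h k) -(dsum_proj a h' k') E.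
split=> //; apply: (@oext_inj _ _ dot U); move: E; rewrite dsum.unlock -hh => /addrI.
exact: scalerI.
Qed.

Lemma splice_proj h k : (splice h k \o pi W)%VF = ext h.
Proof. exact: dsum_proj. Qed.

Lemma splice_comm h k : (splice h k \o pi W = pi W \o splice h k)%VF.
Proof. by rewrite /splice dsum_proj proj_dsum. Qed.

Lemma splice_HP1 h k : HP (@subdot _ _ dot W) h -> lfun_tr h <= 1 ->
  HPD1 (@subdot _ _ dot U) k -> HP1 dot (splice h k).
Proof.
move=> ph tr1 [pk trk]; split; first by apply: dsum_HP; rewrite ?subr_ge0.
by rewrite dsum_tr trk mulr1 addrC subrK.
Qed.

Lemma splice_rank h k : lfun_tr h < 1 -> HPD (@subdot _ _ dot U) k ->
  lfun_rank (splice h k) = (lfun_rank h + \dim U)%N.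
Proof. by move=> tr1 pk; apply: dsum_rank => //; rewrite subr_eq0 eq_sym lt_eqF. Qed.

Lemma splice_inj h h' k k' : lfun_tr h < 1 -> splice h k = splice h' k' -> h = h' /\ k = k'.
Proof.
move=> tr1 E; have hh : h = h'.
  by apply: (@oext_inj _ _ dot W); rewrite -(splice_proj h k) -(splice_proj h' k') E.
move: E; rewrite /splice -hh => /dsum_inj; apply.
by rewrite subr_eq0 eq_sym lt_eqF.
Qed.

(** [h] and [k] are the diagonal blocks of [f], the second one normalised.  Its
    trace [t] is positive because [f] is positive definite on [U] and [U] is
    nonzero. *)
Lemma split_splice c f : HP1 dot f -> gap dot W c f -> (0 < \dim U)%N ->
  exists h k, [/\ HP (@subdot _ _ dot W) h, lfun_tr h < 1,
        HPD1 (@subdot _ _ dot U) k & splice h k = f].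
Proof.
move=> [pf tr1] gf dU; have [c0 hf cf _] := gf.
have cf' : (f \o pi U = pi U \o f)%VF.
  by rewrite projU comp_lfunDl comp_lfunDr comp_lfunNl comp_lfunNr cf
    comp_lfun1l comp_lfun1r.
have restrHP X : (f \o pi X = pi X \o f)%VF -> HP dot (f \o pi X)%VF.
  move=> cX; split=> [|u]; first exact: Herm_comp hf (oproj_Herm dot X) cX.
  have -> : (f \o pi X = pi X \o (f \o pi X))%VF.
    by rewrite comp_lfunA -cX -comp_lfunA oproj_idem.
  by rewrite comp_lfunE oproj_Herm !comp_lfunE; exact: pf.2.
have fp : forall u, u \in U -> u != 0 -> 0 < dot (f u) u.
  move=> u; rewrite WU => uU u0; apply: lt_trans (gap_perp gf uU u0).
  by rewrite mulr_gt0// dnorm_gt0.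
pose t := lfun_tr (f \o pi U)%VF.
have t0 : 0 < t.
  rewrite lt_def (HP_tr_ge0 (restrHP _ cf')) andbT.
  apply/eqP => /(HP_tr_eq0 (restrHP _ cf')) fp0.
  have : vpick U != 0 by rewrite vpick0 -dimv_eq0 -lt0n.
  move=> /(fp _ (memv_pick _)); rewrite -{1}(oproj_id dot (memv_pick U)).
  by rewrite -comp_lfunE fp0 zero_lfunE dot0l ltxx.
have sumE : ((f \o pi W) + (f \o pi U))%VF = f.
  by rewrite projU -comp_lfunDr addrC subrK comp_lfun1r.
have trE : lfun_tr (f \o pi W)%VF = 1 - t.
  by apply/eqP; rewrite eq_sym subr_eq -tr1 -{1}sumE lfun_trD.
have hE := oext_restr cf; have kE := oext_restr cf'.
have trh : lfun_tr (orestr W f) = 1 - t by rewrite -(oext_tr dot) hE.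
exists (orestr W f), (t^-1 *: orestr U f); split.
- by apply/HP_oext; rewrite hE; exact: restrHP.
- by rewrite trh gtrBl.
- split; last by rewrite lfun_trZ -(oext_tr dot) kE mulVf// gt_eqF.
  apply/HPD_oext; rewrite oextZ kE; split.
    by apply: HermZ; [rewrite realE invr_ge0 ltW|exact: (restrHP _ cf').1].
  move=> u uU u0; rewrite scale_lfunE comp_lfunE oproj_id// dotZl /=.
  by rewrite mulr_gt0 ?invr_gt0// fp.
have -> : splice (orestr W f) (t^-1 *: orestr U f) = dsum t (orestr W f) (t^-1 *: orestr U f).
  by rewrite /splice trh opprB addrC subrK.
by rewrite dsum.unlock oextZ scalerA divff ?gt_eqF// scale1r hE kE.
Qed.

(** At the vertex of the cone, [splice 0 k] is the extension of [k] by zero,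
    which vanishes on [W] and is positive definite on [U]. *)
Lemma gap_splice0 k : HPD1 (@subdot _ _ dot U) k -> exists c, gap dot W c (splice 0 k).
Proof.
move=> pk; have ph : HP (@subdot _ _ dot W) 0 by apply/HP_oext; rewrite oext0; exact: HP0.
have [pg _] : HP1 dot (splice 0 k).
  by apply: splice_HP1 => //; rewrite lfun_tr0 ler01.
move/HPD_oext: pk.1 => [hk kp].
apply: gap_exists => // [u uW|u].
  by rewrite -(oproj_id dot uW) -comp_lfunE splice_proj oext0 zero_lfunE.
rewrite -WU => uU u0.
have -> : splice 0 k = dsum 1 (0 : 'End(subvs_of W)) k by rewrite /splice lfun_tr0 subr0.
by rewrite dsum.unlock oext0 add0r scale1r; exact: kp.
Qed.
End GlueTheory.

End Glue.

(** * Topology and continuity in compatible coordinates *)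
Section LocalCoords.
Variable R : realType.

(** Besides smooth transitions, the domain of one chart must be open in the
    coordinates of every other one. *)
Definition coords_compatible (T : Type) (c : local_coords R T) : Prop :=
  forall a b : lc_idx c,
    smooth_through (lc_map a) (lc_dom a `&` lc_dom b) (lc_map b) /\
    forall x, lc_dom a x -> lc_dom b x ->
      exists2 U, nbhs (lc_map a x) U &
        forall y, lc_dom a y -> U (lc_map a y) -> lc_dom b y.

Section Topology.
Variables (T : topologicalType) (c : local_coords R T).
Hypothesis openT : forall A : set T, open A <-> lc_open c A.
Hypothesis cc : coords_compatible c.

(** Transitions are continuous, so the pullback of an open set through the chart
    [a] is open when seen through any other chart. *)
Lemma lc_nbhs (a : lc_idx c) x (B : set T) : lc_dom a x ->
  nbhs x B <-> exists2 U, nbhs (lc_map a x) U &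
    forall y, lc_dom a y -> U (lc_map a y) -> B y.
Proof.
move=> ax; split=> [|[U nU UB]].
  rewrite nbhsE => -[D [/openT oD Dx] DB].
  have [U nU UD] := oD a x ax Dx.
  by exists U => // y ay Uy; apply: DB; exact: UD.
rewrite nbhsE; exists [set y | lc_dom a y /\ U° (lc_map a y)]; last first.
  by move=> y [ay Uy]; apply: UB => //; exact: interior_subset.
split; last by split.
apply/openT => b y ay' [ay Uy].
have [sb db] := cc b a; have [D nD Da] := db y ay' ay.
have nU' : nbhs (lc_map a y) U° by apply: open_nbhs_nbhs; split=> //; exact: open_interior.
have [D' nD' D'U] := smooth_through_nbhs sb (conj ay' ay) nU'.
exists (D `&` D'); first exact: filterI.
by move=> z bz [Dz D'z]; have az := Da z bz Dz; split=> //; exact: D'U.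
Qed.

(** The open set is the interior of [N] together with the complement of [X]. *)
Lemma lc_rel_open (X N : set T) : N `<=` X ->
  (forall x, N x -> exists2 a : lc_idx c, lc_dom a x & exists2 U, nbhs (lc_map a x) U &
     forall y, X y -> lc_dom a y -> U (lc_map a y) -> N y) ->
  exists2 D, open D & N = X `&` D.
Proof.
move=> NX HN; exists (N `|` ~` X)°; first exact: open_interior.
apply/seteqP; split=> [x Nx|x [Xx /interior_subset [//|]]]; last by move=> /(_ Xx).
split; first exact: NX.
have [a ax [U nU UN]] := HN x Nx; apply/(lc_nbhs _ ax).
exists U => // y ay Uy; have [Xy|] := pselect (X y); last by right.
by left; exact: UN.
Qed.
End Topology.

(** A single pair of charts at each point suffices for continuity. *)
Lemma lc_smooth_continuous (T U : topologicalType) (cT : local_coords R T)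
    (cU : local_coords R U) (A : set T) (f : T -> U) :
  (forall B : set T, open B <-> lc_open cT B) -> coords_compatible cT ->
  (forall B : set U, open B <-> lc_open cU B) -> coords_compatible cU ->
  (forall x, A x -> exists (a : lc_idx cT) (b : lc_idx cU), [/\ lc_dom a x,
     forall y, A y -> lc_dom a y -> lc_dom b (f y) &
     smooth_through (lc_map a) [set y | [/\ A y, lc_dom a y & lc_dom b (f y)]]
       (lc_map b \o f)]) ->
  {within A, continuous f}.
Proof.
move=> oT cT' oU cU' sf; apply/subspace_continuousP => x Ax B.
have [a [b [ax ab sab]]] := sf x Ax.
have bfx : lc_dom b (f x) by exact: ab.
move=> /(lc_nbhs oU cU' _ bfx) [D nD DB].
have [D' nD' D'D] := smooth_through_nbhs sab (And3 Ax ax bfx) nD.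
apply/(lc_nbhs oT cT' _ ax); exists D' => // y ay D'y Ay; apply: DB; first exact: ab.
by apply: D'D => //; split=> //; exact: ab.
Qed.

End LocalCoords.

(** * The charts of the total spaces *)
Section Manifold.
Variables (R : realType) (d : nat) (M : smooth_manifold R d).

Lemma chart_nbhs (a : chart_idx M) (B : set M) m : open B -> chart_dom a m -> B m ->
  exists2 U, nbhs (chart a m) U &
    forall m', chart_dom a m' -> U (chart a m') -> B m'.
Proof.
move=> oB am Bm; pose D := chart_dom a `&` B.
exists (chart a @` D).
  apply: open_nbhs_nbhs; split; last by exists m.
  apply: chart_open; first by move=> y [].
  by apply: openI => //; exact: chart_dom_open.
move=> m' am' [m'' [am'' Bm''] /chart_inj]; rewrite !inE => mm.
by rewrite -mm.
Qed.
End Manifold.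

Lemma frame_mx_change (F : fieldType) (V : vectType F) n (e e' : n.-tuple V)
    (f : 'End(V)) : basis_of {:V} e -> basis_of {:V} e' ->
  frame_mx e' e' f = frame_mx e' e \1%VF *m frame_mx e e f *m frame_mx e e' \1%VF.
Proof.
move=> be be'; rewrite -(frame_mx_comp _ _ _ _ be) -(frame_mx_comp _ _ _ _ be).
by rewrite comp_lfun1l comp_lfun1r.
Qed.

Section Bundle.
Variables (R : realType) (d n : nat) (M : smooth_manifold R d).
Variable (E : hermitian_bundle M n).

(* T stands for the total space of a bundle over M, p for its projection, and phi
   for coordinates that L projects to those of the chart a of M.  This covers
   both total spaces at once. *)
Section Over.
Variables (T : Type) (V : normedModType R) (phi : T -> V) (p : T -> M).
Variables (L : {linear V -> 'rV[R]_d}) (a : chart_idx M).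
Hypothesis cL : continuous L.
Hypothesis Lphi : forall x, L (phi x) = chart a (p x).
Implicit Types (A : set T) (b : frame_idx E).

Lemma smooth_chart A a' : (forall x, A x -> chart_dom a (p x) /\ chart_dom a' (p x)) ->
  smooth_through phi A (fun x => chart a' (p x)).
Proof.
move=> HA.
have := smooth_through_precomp (p := p) cL (A' := A) _ Lphi (@chart_compat _ _ M a a').
by apply => x /HA.
Qed.

Lemma smooth_frame A b b' :
  (forall x, A x -> [/\ chart_dom a (p x), frame_dom b (p x) & frame_dom b' (p x)]) ->
  smooth_mx phi A (fun x => frame_mx (frame b (p x)) (frame b' (p x)) \1%VF).
Proof.
move=> HA; apply/smooth_realifyP.
have := smooth_through_precomp (p := p) cL (A' := A) _ Lphi
  (@frame_compat _ _ M n E a b b').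
move=> /(_ _) H; apply: smooth_through_ext (H _).
  move=> x _ /=; congr realify; apply/matrixP => j k; rewrite !mxE id_lfunE //.
by move=> x /HA [].
Qed.

Lemma smooth_gram A b :
  (forall x, A x -> chart_dom a (p x) /\ frame_dom b (p x)) ->
  smooth_mx phi A (fun x => gram (metric E (p x)) (frame b (p x))).
Proof.
move=> HA; apply/smooth_realifyP.
have := smooth_through_precomp (p := p) cL (A' := A) _ Lphi
  (@metric_smooth _ _ M n E a b).
by apply => x /HA.
Qed.

(** Transition matrices depend smoothly on the base point, hence on the point of
    the total space. *)
Lemma smooth_change_frame A b b' (f : forall x, 'End(E (p x))) :
  (forall x, A x -> [/\ chart_dom a (p x), frame_dom b (p x) & frame_dom b' (p x)]) ->
  smooth_mx phi A (fun x => mx_in (frame b (p x)) (f x)) ->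
  smooth_mx phi A (fun x => mx_in (frame b' (p x)) (f x)).
Proof.
move=> HA sf; have KA := regular_through phi A.
apply: (@class_mx_ext _ _ _ _ KA _ _ (fun x =>
  frame_mx (frame b' (p x)) (frame b (p x)) \1%VF *m mx_in (frame b (p x)) (f x) *m
  frame_mx (frame b (p x)) (frame b' (p x)) \1%VF)).
  move=> x /HA [_ bx bx'].
  by rewrite [RHS](frame_mx_change _ (frame_basis bx) (frame_basis bx')).
apply: (class_mxM KA); last exact: smooth_frame.
apply: (class_mxM KA) => //; apply: smooth_frame => x /HA [//].
Qed.

Lemma over_nbhs (B : set M) x : open B -> chart_dom a (p x) -> B (p x) ->
  exists2 U, nbhs (phi x) U & forall y, chart_dom a (p y) -> U (phi y) -> B (p y).
Proof.
move=> oB ax Bx; have [U nU UB] := chart_nbhs oB ax Bx.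
exists (L @^-1` U); first by apply: cL; rewrite Lphi.
by move=> y ay Uy; apply: UB => //; rewrite -Lphi.
Qed.

End Over.

(* Open sets of the total spaces are by definition those that are open in all
   charts. *)
Lemma open_endE (A : set (endE E)) : open A <-> lc_open (endE_coords E) A.
Proof. by []. Qed.

Lemma open_endSS i (A : set (endSS E i)) : open A <-> lc_open (endSS_coords E i) A.
Proof. by []. Qed.

Lemma smooth_coord (T : Type) (V W : normedModType R) (phi : T -> V) (A : set T)
    (L : {linear V -> W}) : continuous L -> smooth_through phi A (fun x => L (phi x)).
Proof.
move=> cL; apply: (@smooth_through_precomp R W V W T T (L \o phi) phi A A
  id L (L \o phi) cL) => //.
exact: smooth_through_id.
Qed.

Lemma cont_fst (V W : normedModType R) : continuous (fst : V * W -> V).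
Proof. by move=> ?; exact: cvg_fst. Qed.

Lemma cont_snd (V W : normedModType R) : continuous (snd : V * W -> W).
Proof. by move=> ?; exact: cvg_snd. Qed.

Section EndE.
Variables (ab : chart_idx M * frame_idx E).
Local Notation phi := (@lc_map R _ (endE_coords E) ab).
Implicit Type A : set (endE E).

Lemma smooth_end_map A :
  smooth_mx phi A (fun x => mx_in (frame ab.2 (end_pt x)) (end_map x)).
Proof.
apply/smooth_realifyP.
exact: (@smooth_coord _ ('rV[R]_d * 'M[R]_(n, n + n))%type 'M[R]_(n, n + n)
  phi A snd (@cont_snd _ _)).
Qed.

Lemma endE_over x : fst (phi x) = chart ab.1 (end_pt x).
Proof. by []. Qed.
End EndE.

Lemma endE_compatible : coords_compatible (endE_coords E).
Proof.
move=> ab ab'; split=> [|x [ax bx] [ax' bx']].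
  apply: smooth_through_pair.
    by apply: (smooth_chart (@cont_fst _ _) (endE_over ab)) => x [[ax _] [ax' _]].
  apply/smooth_realifyP.
  apply: (smooth_change_frame (@cont_fst _ _) (endE_over ab) (b := ab.2)).
    by move=> x [[ax bx] [_ bx']].
  exact: smooth_end_map.
have oB := openI (chart_dom_open ab'.1) (frame_dom_open ab'.2).
have [U nU UB] := over_nbhs (@cont_fst _ _) (endE_over ab) oB ax (conj ax' bx').
by exists U => // y [ay _] Uy; exact: UB.
Qed.

Lemma ortho_projE m (W : {vspace E m}) : ortho_proj W = oproj (metric E m) W.
Proof. by rewrite oproj.unlock. Qed.

Lemma ext0E m (W : {vspace E m}) (h : 'End(subvs_of W)) :
  ext0 h = oext (metric E m) h.
Proof. by rewrite oext.unlock -ortho_projE. Qed.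

Section EndSS.
Variables (i : nat) (ab : chart_idx M * frame_idx E).
Local Notation phi := (@lc_map R _ (endSS_coords E i) ab).
Implicit Type A : set (endSS E i).
Local Notation mx y f := (mx_in (frame ab.2 (ss_pt y)) f).

Lemma smooth_ss_proj A : smooth_mx phi A (fun y => mx y (ortho_proj (gr_sub (ss_gr y)))).
Proof.
have c : continuous (fst \o snd :
   'rV[R]_d * ('M[R]_(n, n + n) * ('M[R]_(n, n + n) * 'M[R]_(n, n + n))) -> _).
  by move=> x; apply: continuous_comp; [exact: cont_snd|exact: cont_fst].
by apply/smooth_realifyP; exact: (@smooth_coord _
  ('rV[R]_d * ('M[R]_(n, n + n) * ('M[R]_(n, n + n) * 'M[R]_(n, n + n))))%type
  'M[R]_(n, n + n) phi A (fst \o snd) c).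
Qed.

Lemma smooth_ss_h A : smooth_mx phi A (fun y => mx y (ext0 (ss_h y))).
Proof.
have c : continuous (fst \o snd \o snd :
   'rV[R]_d * ('M[R]_(n, n + n) * ('M[R]_(n, n + n) * 'M[R]_(n, n + n))) -> _).
  move=> x; apply: continuous_comp; first exact: cont_snd.
  by apply: continuous_comp; [exact: cont_snd|exact: cont_fst].
by apply/smooth_realifyP; exact: (@smooth_coord _
  ('rV[R]_d * ('M[R]_(n, n + n) * ('M[R]_(n, n + n) * 'M[R]_(n, n + n))))%type
  'M[R]_(n, n + n) phi A (fst \o snd \o snd) c).
Qed.

Lemma smooth_ss_k A : smooth_mx phi A (fun y => mx y (ext0 (ss_k y))).
Proof.
have c : continuous (snd \o snd \o snd :
   'rV[R]_d * ('M[R]_(n, n + n) * ('M[R]_(n, n + n) * 'M[R]_(n, n + n))) -> _).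
  move=> x; apply: continuous_comp; first exact: cont_snd.
  by apply: continuous_comp; [exact: cont_snd|exact: cont_snd].
by apply/smooth_realifyP; exact: (@smooth_coord _
  ('rV[R]_d * ('M[R]_(n, n + n) * ('M[R]_(n, n + n) * 'M[R]_(n, n + n))))%type
  'M[R]_(n, n + n) phi A (snd \o snd \o snd) c).
Qed.

Lemma endSS_over y : fst (phi y) = chart ab.1 (ss_pt y).
Proof. by []. Qed.
End EndSS.

Lemma endSS_compatible i : coords_compatible (endSS_coords E i).
Proof.
move=> ab ab'; split=> [|x [ax bx] [ax' bx']].
  have HA : forall x, (lc_dom ab `&` lc_dom ab' : set (endSS E i)) x ->
      [/\ chart_dom ab.1 (ss_pt x), frame_dom ab.2 (ss_pt x) &
          frame_dom ab'.2 (ss_pt x)] by move=> x [[ax bx] [_ bx']].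
  have change := smooth_change_frame (@cont_fst _ _) (@endSS_over i ab) HA.
  apply: smooth_through_pair.
    by apply: (smooth_chart (@cont_fst _ _) (@endSS_over i ab)) => x [[ax _] [ax' _]].
  apply: smooth_through_pair.
    by apply/smooth_realifyP; apply: change; exact: smooth_ss_proj.
  apply: smooth_through_pair.
    by apply/smooth_realifyP; apply: change; exact: smooth_ss_h.
  by apply/smooth_realifyP; apply: change; exact: smooth_ss_k.
have oB := openI (chart_dom_open ab'.1) (frame_dom_open ab'.2).
have [U nU UB] := over_nbhs (@cont_fst _ _) (@endSS_over i ab) oB ax (conj ax' bx').
by exists U => // y [ay _] Uy; exact: UB.
Qed.

End Bundle.

(** * Smoothness of spectral projections *)
(** [S B - B S] is a solution of [S X + X S = 0]. *)
Lemma posdef_sqrt_comm (C : numClosedFieldType) n (S B : 'M[C]_n) : posdefmx S ->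
  S *m S = B *m B -> S *m B = B *m S.
Proof.
move=> pS SB; apply/eqP; rewrite -subr_eq0; apply/eqP.
apply: (posdef_sylvester pS pS); rewrite mulmxBr mulmxBl !mulmxA SB.
by rewrite -[B *m S *m S]mulmxA SB mulmxA addrA subrK subrr.
Qed.

Lemma natr_close (C : numDomainType) (m n : nat) :
  `|m%:R - n%:R| < 1 :> C -> m = n.
Proof.
wlog mn : m n / (m <= n)%N => [H|].
  by case: (leqP m n) => [|/ltnW] mn; [|rewrite distrC => /H ->]; rewrite ?H//; exact: H.
rewrite distrC -natrB// normr_nat -[ltRHS]/(1%:R) ltr_nat ltnS leqn0 subn_eq0 => nm.
by apply/eqP; rewrite eqn_leq mn.
Qed.

Section Local.
Variables (R : realType) (V : normedModType R) (T : Type) (phi : T -> V).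
Local Notation C := R[i].

Lemma smooth_mx_local m n (A : set T) (F : T -> 'M[C]_(m, n)) :
  (forall x, A x -> exists2 U, nbhs (phi x) U & smooth_mx phi (A `&` phi @^-1` U) F) ->
  smooth_mx phi A F.
Proof.
move=> lF j k; split; apply: smooth_through_local => x /lF [U nU sF];
  by exists U => //; have [] := sF j k.
Qed.

(** [J] is the sign [|B|^(-1) B] of the invertible hermitian matrix [B], where
    [|B|] is the square root of [B B].  At [x0] it is the given [J0], since [J0 B] is
    a positive definite square root of [B B].  The trace of [J] counts positive
    minus negative eigenvalues; keeping it close to that of [J0] will fix the
    dimension of the eigenspaces. *)
Lemma sign_mx_local (A : set T) n (B : T -> 'M[C]_n) x0 J0 e :
  smooth_mx phi A B -> (forall x, A x -> (B x)^t* = B x) -> A x0 ->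
  J0 *m J0 = 1%:M -> J0 *m B x0 = B x0 *m J0 -> posdefmx (J0 *m B x0) -> 0 < e ->
  exists2 U, nbhs (phi x0) U & exists J : T -> 'M[C]_n,
    smooth_mx phi (A `&` phi @^-1` U) J /\
    forall x, A x -> U (phi x) -> [/\ (J x)^t* = J x, J x *m J x = 1%:M,
      J x *m B x = B x *m J x, posdefmx (J x *m B x) & `|\tr (J x) - \tr J0| <= e].
Proof.
move=> sB hB Ax0 JJ JB pJB e0; have KA := regular_through phi A.
have sqrE : (J0 *m B x0) *m (J0 *m B x0) = B x0 *m B x0.
  by rewrite {1}JB -mulmxA (mulmxA J0) JJ mul1mx.
have uB0 : B x0 \in unitmx by have := posdef_unit pJB; rewrite unitmx_mul => /andP[].
have sBB : smooth_mx phi A (fun x => B x *m B x) by exact: (class_mxM KA).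
have hBB x : A x -> (B x *m B x)^t* = B x *m B x by move=> Ax; rewrite adjmxM hB.
have [U nU pU] := smooth_mx_posdef_nbhs sBB hBB Ax0 (herm_sqr_posdef (hB _ Ax0) uB0).
have /choice [S HS] : forall x, exists S : 'M[C]_n,
    A x -> U (phi x) -> posdefmx S /\ S *m S = B x *m B x.
  move=> x; have [[Ax Ux]|nx] := pselect (A x /\ U (phi x)); last first.
    by exists 0 => Ax Ux; case: nx.
  by have [S pS SS] := posdef_sqrt (pU x Ax Ux); exists S.
pose AU := A `&` phi @^-1` U; have KAU := regular_through phi AU.
have sBU : smooth_mx phi AU B by apply: smooth_mx_sub sB => x [].
have sS : smooth_mx phi AU S.
  apply: (smooth_mx_sqrt (F := fun x => B x *m B x)); first exact: (class_mxM KAU).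
    by move=> x [Ax Ux]; have [] := HS x Ax Ux.
  by move=> x [Ax Ux]; have [] := HS x Ax Ux.
pose J x := invmx (S x) *m B x.
have sJ : smooth_mx phi AU J.
  apply: (class_mxM KAU) => //; apply: (class_mx_inv KAU) => // x [Ax Ux].
  by apply: posdef_unit; have [] := HS x Ax Ux.
have Ux0 : U (phi x0) := nbhs_singleton nU.
have Jx0 : J x0 = J0.
  have [pS SS] := HS x0 Ax0 Ux0.
  have SE : S x0 = J0 *m B x0 by apply: posdef_sqrt_unique => //; rewrite SS sqrE.
  rewrite /J; apply: (canLR (mulKmx (posdef_unit pS))).
  by rewrite SE JB -mulmxA JJ mulmx1.
have str : smooth_mx phi AU (fun x => (\tr (J x))%:M : 'M[C]_1).
  move=> j k; rewrite (_ : (fun x => _) = fun x => \tr (J x)); last first.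
    by apply/funext => x; rewrite !ord1 mxE eqxx mulr1n.
  exact: (cplx_in_tr KAU).
have [U' nU' HU'] := smooth_mx_close str (conj Ax0 Ux0) e0.
exists (U `&` U'); first exact: filterI.
exists J; split; first by apply: smooth_mx_sub sJ => x [Ax []].
move=> x Ax [Ux U'x]; have [pS SS] := HS x Ax Ux.
have uS := posdef_unit pS; have SB := posdef_sqrt_comm pS SS.
have BS : invmx (S x) *m B x = B x *m invmx (S x).
  by apply: (canLR (mulKmx uS)); rewrite mulmxA SB mulmxK.
have SBB : invmx (S x) *m (B x *m B x) = S x by rewrite -SS mulKmx.
split.
- by rewrite /J adjmxM adjmx_inv pS.1 hB.
- by rewrite /J {2}BS mulmxA -(mulmxA (invmx (S x))) SBB mulmxV.
- by rewrite /J [RHS]mulmxA -BS.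
- by rewrite /J -mulmxA SBB.
- by have := HU' x (conj Ax Ux) U'x 0 0; rewrite !mxE eqxx !mulr1n Jx0.
Qed.
End Local.

Lemma gap_mx_intro (R : realType) (V : vectType R[i])
    (dot : {dot V for @Num.conj R[i]}) n (e : n.-tuple V) (W : {vspace V}) c f :
  basis_of {:V} e -> gram dot e = 1%:M -> 0 < c -> Herm dot f ->
  (f \o oproj dot W = oproj dot W \o f)%VF ->
  posdefmx (mx_in e (orefl dot W) *m (mx_in e f - c%:M)) -> gap dot W c f.
Proof.
move=> be oe c0 hf cf pd; split=> //; apply/(HPD_mx be oe).
rewrite (mx_in_comp be) mx_in_add mx_in_opp mx_in_scale (mx_in_id be) scalemx1.
exact: pd.
Qed.

Section SpectralBundle.
Variables (R : realType) (d n : nat) (M : smooth_manifold R d).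
Variable (E : hermitian_bundle M n).
Variables (T : Type) (V : normedModType R) (phi : T -> V) (p : T -> M).
Variables (L : {linear V -> 'rV[R]_d}) (a : chart_idx M) (b : frame_idx E).
Hypothesis cL : continuous L.
Hypothesis Lphi : forall x, L (phi x) = chart a (p x).
Variables (A : set T) (f : forall x, 'End(E (p x))).
Hypothesis domA : forall x, A x -> chart_dom a (p x) /\ frame_dom b (p x).
Local Notation C := R[i].
Local Notation e x := (frame b (p x)).
Local Notation dot x := (metric E (p x)).

(** Smooth orthonormal frames exist locally. *)
Lemma smooth_lowdin : exists S : T -> 'M[C]_n,
  [/\ forall x, A x -> posdefmx (S x),
      forall x, A x -> S x *m S x = gram (dot x) (e x) &
      smooth_mx phi A S].
Proof.
have /choice [S HS] : forall x, exists S : 'M[C]_n,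
    A x -> posdefmx S /\ S *m S = gram (dot x) (e x).
  move=> x; have [Ax|nx] := pselect (A x); last by exists 0.
  have [S pS SS] := posdef_sqrt (gram_posdef (dot x) (frame_basis (domA Ax).2)).
  by exists S.
exists S; split=> [x /HS []//|x /HS []//|].
apply: (smooth_mx_sqrt (smooth_gram (E := E) (b := b) cL Lphi domA)).
  by move=> x /HS [].
by move=> x /HS [].
Qed.

Hypothesis sf : smooth_mx phi A (fun x => mx_in (e x) (f x)).
Hypothesis hf : forall x, A x -> Herm (dot x) (f x).

(** A gap of [f] at one point extends to a smooth family of gaps nearby.  In an
    orthonormal frame, the sign [J] of [f - c] near [x0] yields the projection
    [(1 - J) / 2].  The rank of the latter is its trace, which is within 1/2 of the
    rank at [x0], hence equal to it. *)
Lemma spectral_local x0 W0 c : A x0 -> gap (dot x0) W0 c (f x0) ->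
  exists2 U, nbhs (phi x0) U & exists W : forall x, {vspace E (p x)},
    (forall x, A x -> U (phi x) -> \dim (W x) = \dim W0 /\ gap (dot x) (W x) c (f x)) /\
    smooth_mx phi (A `&` phi @^-1` U) (fun x => mx_in (e x) (oproj (dot x) (W x))).
Proof.
move=> Ax0 g0; have c0 : 0 < c by case: g0.
have cr : c^*%R = c by apply/CrealP; rewrite realE ltW.
have [S [pS SS sS]] := smooth_lowdin; have KA := regular_through phi A.
have be x : A x -> basis_of {:E (p x)} (e x) by move=> /domA [_ /frame_basis].
pose l x := lowdin (e x) (S x).
have bl x : A x -> basis_of {:E (p x)} (l x).
  by move=> Ax; apply: lowdin_basis (be x Ax) (pS x Ax).
have ol x : A x -> gram (dot x) (l x) = 1%:M.
  by move=> Ax; apply: lowdin_gram (pS x Ax) (SS x Ax).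
have ml x g : A x -> mx_in (l x) g = invmx (S x) *m mx_in (e x) g *m S x.
  by move=> Ax; apply: lowdin_mx (be x Ax) (pS x Ax) _.
have me x g : A x -> mx_in (e x) g = S x *m mx_in (l x) g *m invmx (S x).
  by move=> Ax; have uS := posdef_unit (pS x Ax); rewrite ml// !mulmxA mulmxV// mul1mx mulmxK.
pose B x := mx_in (l x) (f x) - c%:M.
have sSi : smooth_mx phi A (fun x => invmx (S x)).
  by apply: (class_mx_inv KA) => // x Ax; exact/posdef_unit/pS.
have sB : smooth_mx phi A B.
  apply: (@class_mx_ext _ _ _ _ KA _ _
    (fun x => invmx (S x) *m mx_in (e x) (f x) *m S x + - c%:M)).
    by move=> x Ax; rewrite /B ml.
  apply: (class_mxD KA); last exact: (class_mx_cst KA).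
  by apply: (class_mxM KA) => //; exact: (class_mxM KA).
have hB x : A x -> (B x)^t* = B x.
  move=> Ax; rewrite /B adjmxB tr_scalar_mx map_scalar_mx /= cr.
  by have /(Herm_mx (bl x Ax) (ol x Ax)) -> := hf Ax.
have [com idem pd] := gap_mx (bl _ Ax0) (ol _ Ax0) g0.
set J0 := _ - _ in pd.
have JJ0 : J0 *m J0 = 1%:M.
  rewrite /J0; set q := mx_in _ (oproj _ _) in idem *.
  rewrite mulmxBl mul1mx mulmxBr mulmx1 -scalemxAl -scalemxAr idem.
  by apply/matrixP => j k; rewrite !mxE; ring.
have JB0 : J0 *m B x0 = B x0 *m J0.
  rewrite /J0 /B; set q := mx_in _ (oproj _ _) in com *; set F := mx_in _ (f _) in com *.
  have qF : (1%:M - 2%:R *: q) *m F = F *m (1%:M - 2%:R *: q).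
    by rewrite mulmxBl mulmxBr mul1mx mulmx1 -scalemxAl -scalemxAr com.
  by rewrite [LHS]mulmxBr [RHS]mulmxBl qF mul_mx_scalar mul_scalar_mx.
have e1 : 0 < 1 :> C := ltr01.
have [U nU [J [sJ HJ]]] := sign_mx_local sB hB Ax0 JJ0 JB0 pd e1.
exists U => //.
pose P x : 'M[C]_n := 2%:R^-1 *: (1%:M - J x).
have Hg x : {g : 'End(E (p x)) | A x -> mx_in (l x) g = P x}.
  apply: cid; have [Ax|nx] := pselect (A x); last by exists 0.
  by have [g gE] := mx_in_sur (bl x Ax) (P x); exists g.
pose g x := projT1 (Hg x); have gE x : A x -> mx_in (l x) (g x) = P x := projT2 (Hg x).
have two0 : 2%:R != 0 :> C by rewrite pnatr_eq0.
have gP x : A x -> U (phi x) -> oproj (dot x) (limg (g x)) = g x.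
  move=> Ax Ux; have [hJ JJ JB pJ _] := HJ x Ax Ux.
  apply: Herm_idem_oproj.
    apply/(Herm_mx (bl x Ax) (ol x Ax)).
    by rewrite gE// /P adjmxZ adjmxB adjmx1 hJ fmorphV rmorph_nat.
  apply: (mx_in_inj (bl x Ax)); rewrite (mx_in_comp (bl x Ax)) gE// /P.
  rewrite -scalemxAl -scalemxAr mulmxBl mul1mx mulmxBr mulmx1 JJ.
  by apply/matrixP => j k; rewrite !mxE; field.
have JE x : A x -> U (phi x) -> mx_in (l x) (orefl (dot x) (limg (g x))) = J x.
  move=> Ax Ux; rewrite (orefl_mx _ _ (bl x Ax)) gP// gE// /P scalerA divff//.
  by rewrite scale1r opprB addrC subrK.
exists (fun x => limg (g x)); split.
  move=> x Ax Ux; have [hJ JJ JB pJ trJ] := HJ x Ax Ux; split.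
    have trP : (\dim (limg (g x)))%:R = \tr (P x) :> C.
      by rewrite -gE// -(lfun_trE _ (bl x Ax)) -(oproj_tr (dot x)) gP.
    have trP0 : (\dim W0)%:R = 2%:R^-1 * (n%:R - \tr J0) :> C.
      rewrite -(oproj_tr (dot x0)) (lfun_trE _ (bl x0 Ax0)) /J0 linearB /= mxtrace1.
      by rewrite mxtraceZ opprB addrC subrK mulrA mulVf// mul1r.
    have : `|(\dim (limg (g x)))%:R - (\dim W0)%:R| < 1 :> C.
      rewrite trP trP0 /P mxtraceZ linearB /= mxtrace1 -mulrBr normrM.
      rewrite opprB addrC addrA subrK distrC.
      rewrite normfV normr_nat mulrC ltr_pdivrMr ?ltr0n// mul1r.
      by apply: le_lt_trans trJ _; rewrite ltr1n.
    exact: natr_close.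
  apply: (gap_mx_intro (bl x Ax) (ol x Ax) c0 (hf Ax)).
    apply: (mx_in_inj (bl x Ax)); rewrite !(mx_in_comp (bl x Ax)) gP// gE// /P.
    rewrite -scalemxAl -scalemxAr mulmxBl mulmxBr mul1mx mulmx1.
    have : J x *m B x + c *: J x = B x *m J x + c *: J x by rewrite JB.
    by rewrite /B mulmxBr mulmxBl mul_mx_scalar mul_scalar_mx !subrK => ->.
  by rewrite JE.
have KAU := regular_through phi (A `&` phi @^-1` U).
apply: (@class_mx_ext _ _ _ _ KAU _ _ (fun x => S x *m P x *m invmx (S x))).
  by move=> x [Ax Ux]; rewrite gP// me// gE.
have sub m q (F : T -> 'M[C]_(m, q)) : smooth_mx phi A F -> smooth_mx phi (A `&` phi @^-1` U) F.
  by apply: smooth_mx_sub => x [].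
apply: (class_mxM KAU); last exact: sub.
apply: (class_mxM KAU); first exact: sub.
apply: (class_mxZ KAU); first exact: (cplx_in_cst KAU).
apply: (class_mxD KAU); first exact: (class_mx_cst KAU).
exact: (class_mxN KAU).
Qed.

(** By uniqueness [W] agrees near each point with the smooth family that extends
    its value there, however the cuts [c x] were chosen. *)
Lemma smooth_gap_proj (W : forall x, {vspace E (p x)}) (c : T -> C) r :
  (forall x, A x -> \dim (W x) = r /\ gap (dot x) (W x) (c x) (f x)) ->
  smooth_mx phi A (fun x => mx_in (e x) (oproj (dot x) (W x))).
Proof.
move=> HW; apply: smooth_mx_local => x0 Ax0; have [dW0 g0] := HW x0 Ax0.
have [U nU [W' [HW' sW']]] := spectral_local Ax0 g0.
exists U => //; have KAU := regular_through phi (A `&` phi @^-1` U).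
apply: (class_mx_ext KAU _ sW') => x [Ax Ux]; have [dW' g'] := HW' x Ax Ux.
have [dW g] := HW x Ax.
by rewrite (gap_unique g' g) // dW' dW0 dW.
Qed.
End SpectralBundle.

(** * The bijection between the two tubes *)
Lemma exists_subspace (F : fieldType) (V : vectType F) k : (k <= \dim {:V})%N ->
  exists W : {vspace V}, \dim W = k.
Proof.
move=> kV; exists <<take k (vbasis {:V})>>%VS.
have fk : free (take k (vbasis {:V})).
  have := basis_free (vbasisP {:V}).
  by rewrite -{1}(cat_take_drop k (vbasis {:V})) => /catl_free.
by move: fk; rewrite /free => /eqP ->; rewrite size_takel// size_tuple.
Qed.

Section Tubes.
Variables (R : realType) (d n i : nat) (M : smooth_manifold R d).
Variable (E : hermitian_bundle M n).
Hypothesis hi : (1 <= i <= n)%N.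
Local Notation C := R[i].
Local Notation dot m := (metric E m).

Lemma dim_fib m : \dim {:E m} = n.
Proof. by have [b bm] := frame_cover E m; exact: size_basis (frame_basis bm). Qed.

(** Equality of dependent pairs over the same point of [M]; the point itself has
    only one proof of equality with itself. *)
Lemma EndE_inj m (f g : 'End(E m)) : EndE f = EndE g -> f = g.
Proof.
pose cast (x : endE E) (h : end_pt x = m) : 'End(E m) :=
  eq_rect _ (fun m' => 'End(E m')) (end_map x) _ h.
move=> fg; suff H x (h : end_pt x = m) : x = EndE g -> cast x h = g.
  exact: (H (EndE f) erefl fg).
by move=> xg; move: h; rewrite xg => h; rewrite (Prop_irrelevance h erefl).
Qed.

Lemma gr_perpE (w : grass E i) : gr_perp w = orthov (dot (gr_base w)) (gr_sub w).
Proof. by []. Qed.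

Lemma dim_gr_perp (w : grass E i) : \dim (gr_perp w) = i.
Proof.
have := dim_orthov (dot (gr_base w)) (gr_sub w).
rewrite -gr_perpE gr_dim dim_fib => H; apply/eqP.
by rewrite -(eqn_add2l (n - i)) H subnK//; case/andP: hi.
Qed.

Definition recombine (y : endSS E i) : endE E :=
  EndE (splice (dot (ss_pt y)) (ss_h y) (ss_k y)).

Definition gap_at (y : endSS E i) c :=
  gap (dot (ss_pt y)) (gr_sub (ss_gr y)) c (end_map (recombine y)).

Definition tubeE : set (endE E) := [set x | HP1_E E x /\
  exists (W : {vspace E (end_pt x)}) c, \dim W = (n - i)%N /\
    gap (dot (end_pt x)) W c (end_map x)].

Definition tubeSS : set (endSS E i) := [set y |
  [/\ coneHPD E i y, lfun_tr (ss_h y) < 1 & exists c, gap_at y c]].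

Lemma coneHPDP (y : endSS E i) : coneHPD E i y <->
  [/\ HP (@subdot _ _ (dot (ss_pt y)) (gr_sub (ss_gr y))) (ss_h y),
      lfun_tr (ss_h y) <= 1 &
      HPD1 (@subdot _ _ (dot (ss_pt y)) (gr_perp (ss_gr y))) (ss_k y)].
Proof.
split=> [[/(@coneHP1P _ _ (dot (ss_pt y))) [ph tr1] pk]|[ph tr1 pk]]; first by split.
by split=> //; apply/(@coneHP1P _ _ (dot (ss_pt y))).
Qed.

Lemma recombine_HP1 y : coneHPD E i y -> HP1_E E (recombine y).
Proof. by move=> /coneHPDP [ph tr1 pk]; exact: splice_HP1. Qed.

Lemma recombine_tube y : tubeSS y -> tubeE (recombine y).
Proof.
move=> [cy tr1 [c gy]]; split; first exact: recombine_HP1.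
by exists (gr_sub (ss_gr y)), c; split; [exact: gr_dim|].
Qed.

(** The subspace is recovered as the gap subspace of dimension [n - i], then [h]
    and [k] as blocks. *)
Lemma recombine_inj y y' : tubeSS y -> tubeSS y' -> recombine y = recombine y' -> y = y'.
Proof.
case: y => [[m W dW] h k]; case: y' => [[m' W' dW'] h' k'] [_ tr1 [c gy]] [_ tr1' [c' gy']].
move=> jj; have mm : m = m' := congr1 (@end_pt _ _ _ _ _) jj.
subst m'; have {jj} ff := EndE_inj jj.
have WW : W = W'.
  apply: (gap_unique (dot := dot m) (f := splice (dot m) h k) gy); last by rewrite dW dW'.
  by rewrite ff; exact: gy'.
subst W'; have dd := Prop_irrelevance dW dW'; subst dW'.
by have [/= -> ->] := splice_inj (gr_perpE (Grass dW)) tr1 ff.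
Qed.

Lemma recombine_surj x : tubeE x -> exists2 y, tubeSS y & recombine y = x.
Proof.
case: x => [m f] [pf [W [c [dW g]]]]; pose w := Grass dW.
have dU : (0 < \dim (gr_perp w))%N by rewrite dim_gr_perp; case/andP: hi.
have [h [k [ph tr1 pk hk]]] := split_splice (gr_perpE w) pf g dU.
exists (@EndSS _ _ _ _ _ _ w h k); last by rewrite /recombine /= hk.
split=> //; first by apply/coneHPDP; split=> //; exact: ltW.
by exists c; rewrite /gap_at /= hk.
Qed.

(** The inverse is chosen on the tube.  Off the tube its value is arbitrary, but
    taken over the same point of [M], so that matrices in the frames at [end_pt x]
    and at [ss_pt (F x)] can be compared without side conditions. *)
Lemma exists_split : exists F : endE E -> endSS E i,
  (forall x, ss_pt (F x) = end_pt x) /\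
  (forall x, tubeE x -> tubeSS (F x) /\ recombine (F x) = x).
Proof.
have /choice [F HF] : forall x, exists y : endSS E i,
    ss_pt y = end_pt x /\ (tubeE x -> tubeSS y /\ recombine y = x).
  move=> x; have [tx|ntx] := pselect (tubeE x).
    have [y ty jy] := recombine_surj tx; exists y; split=> //.
    by rewrite -jy.
  have [W dW] : exists W : {vspace E (end_pt x)}, \dim W = (n - i)%N.
    by apply: exists_subspace; rewrite dim_fib leq_subr.
  by exists (@EndSS _ _ _ _ _ _ (Grass dW) 0 0).
by exists F; split=> x; have [] := HF x.
Qed.

Lemma recombine_rank y : tubeSS y -> lfun_rank (end_map (recombine y)) = (lfun_rank (ss_h y) + i)%N.
Proof.
move=> [/coneHPDP [ph _ [pk _]] tr1 _].
by rewrite (splice_rank (gr_perpE _) tr1 pk) dim_gr_perp.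
Qed.

Lemma Sigma0_tube : Sigma0 E i `<=` tubeE.
Proof.
move=> x [px rx]; split=> //; have [c g] := gap_of_rank px.1.
exists (lker (end_map x)), c; split=> //.
have := limg_ker_dim (end_map x) fullv; rewrite capfv dim_fib.
by rewrite -[X in (_ + X)%N]/(lfun_rank (end_map x)) rx => H; apply/eqP;
  rewrite -(eqn_add2r i) H subnK//; case/andP: hi.
Qed.

Lemma zeroHPD_tube : zeroHPD E i `<=` tubeSS.
Proof.
case=> [w h k] [/= h0 pk]; subst h.
have ph : HP (@subdot _ _ (dot (gr_base w)) (gr_sub w)) 0.
  by apply/HP_oext; rewrite oext0; exact: HP0.
split; [apply/coneHPDP; split=> //=|by rewrite /= lfun_tr0 ltr01|].
  by rewrite lfun_tr0 ler01.
exact: (gap_splice0 (gr_perpE w) pk).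
Qed.

End Tubes.

(** * Smoothness of the bijection and openness of the tubes *)
Section SmoothTubes.
Variables (R : realType) (d n i : nat) (M : smooth_manifold R d).
Variable (E : hermitian_bundle M n).
Local Notation C := R[i].
Local Notation dot m := (metric E m).
Local Notation tubeE := (@tubeE R d n i M E).
Local Notation tubeSS := (@tubeSS R d n i M E).
Local Notation recombine := (@recombine R d n i M E).

Section SmoothRecombine.
Variables (ab : chart_idx M * frame_idx E) (A : set (endSS E i)).
Hypothesis domA : forall y, A y -> chart_dom ab.1 (ss_pt y) /\ frame_dom ab.2 (ss_pt y).
Local Notation phi := (@lc_map R _ (endSS_coords E i) ab).
Local Notation mx y f := (mx_in (frame ab.2 (ss_pt y)) f).

Let be y : A y -> basis_of {:E (ss_pt y)} (frame ab.2 (ss_pt y)).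
Proof. by move=> /domA [_ /frame_basis]. Qed.

Lemma smooth_oext_h : smooth_mx phi A (fun y => mx y (oext (dot (ss_pt y)) (ss_h y))).
Proof.
apply: (class_mx_ext (regular_through phi A) _ (smooth_ss_h ab A)) => y Ay.
by rewrite (@ext0E R d n M E).
Qed.

Lemma smooth_oext_k : smooth_mx phi A (fun y => mx y (oext (dot (ss_pt y)) (ss_k y))).
Proof.
apply: (class_mx_ext (regular_through phi A) _ (smooth_ss_k ab A)) => y Ay.
by rewrite (@ext0E R d n M E).
Qed.

Lemma smooth_oproj_gr :
  smooth_mx phi A (fun y => mx y (oproj (dot (ss_pt y)) (gr_sub (ss_gr y)))).
Proof.
apply: (class_mx_ext (regular_through phi A) _ (smooth_ss_proj ab A)) => y Ay.
by rewrite (@ortho_projE R d n M E).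
Qed.

Lemma smooth_tr_h :
  cplx_in (fun f : endSS E i -> R => smooth_through phi A f) (fun y => lfun_tr (ss_h y)).
Proof.
have KA := regular_through phi A.
apply: (cplx_in_ext KA _ (cplx_in_tr KA smooth_oext_h)) => y Ay.
by rewrite -(lfun_trE _ (be Ay)) oext_tr.
Qed.

(** The formula [h + (1 - tr h) k] is polynomial in the coordinates. *)
Lemma smooth_recombine_map : smooth_mx phi A (fun y => mx y (end_map (recombine y))).
Proof.
have KA := regular_through phi A.
apply: (@class_mx_ext _ _ _ _ KA _ _ (fun y =>
  mx y (oext (dot (ss_pt y)) (ss_h y)) +
  (1 + - lfun_tr (ss_h y)) *: mx y (oext (dot (ss_pt y)) (ss_k y)))).
  by move=> y Ay; rewrite /recombine /splice dsum.unlock /= mx_in_add mx_in_scale.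
apply: (class_mxD KA); first exact: smooth_oext_h.
apply: (class_mxZ KA); last exact: smooth_oext_k.
apply: (cplx_inD KA); first exact: (cplx_in_cst KA).
by apply: (cplx_inN KA); exact: smooth_tr_h.
Qed.
End SmoothRecombine.

Lemma smooth_recombine ab ab' : smooth_through (@lc_map R _ (endSS_coords E i) ab)
  [set y | [/\ tubeSS y, lc_dom ab y & @lc_dom R _ (endE_coords E) ab' (recombine y)]]
  (@lc_map R _ (endE_coords E) ab' \o recombine).
Proof.
set A := [set y | _]; apply: smooth_through_pair.
  by apply: (smooth_chart (@cont_fst _ _ _) (@endSS_over _ _ _ _ E i ab)) =>
    y [_ [ay _] [ay' _]].
apply/smooth_realifyP.
apply: (smooth_change_frame (@cont_fst _ _ _) (@endSS_over _ _ _ _ E i ab) (b := ab.2)).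
  by move=> y [_ [ay by_] [_ by']].
by apply: smooth_recombine_map => y [_ [ay by_] _].
Qed.

Section SmoothSplit.
Variable F : endE E -> endSS E i.
Hypothesis Fpt : forall x, ss_pt (F x) = end_pt x.
Hypothesis FN : forall x, tubeE x -> tubeSS (F x) /\ recombine (F x) = x.

(** The coordinates of [F x] are [pi], [f pi] and [(f - f pi) / (1 - tr (f pi))],
    for [f] the endomorphism [x] and [pi] its spectral projection. *)
Lemma smooth_split ab ab' : smooth_through (@lc_map R _ (endE_coords E) ab)
  [set x | [/\ tubeE x, lc_dom ab x & @lc_dom R _ (endSS_coords E i) ab' (F x)]]
  (@lc_map R _ (endSS_coords E i) ab' \o F).
Proof.
set A := [set x | _]; set phi := lc_map ab; have KA := regular_through phi A.
have Lphi x : fst (phi x) = chart ab.1 (ss_pt (F x)) by rewrite Fpt.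
have domA x : A x -> chart_dom ab.1 (ss_pt (F x)) /\ frame_dom ab.2 (ss_pt (F x)).
  by rewrite Fpt => -[_ []].
have domA' x : A x -> [/\ chart_dom ab.1 (ss_pt (F x)), frame_dom ab.2 (ss_pt (F x))
    & frame_dom ab'.2 (ss_pt (F x))].
  by move=> Ax; have [ax bx] := domA x Ax; case: Ax => _ _ [_ bx'].
pose mx x f := mx_in (frame ab.2 (ss_pt (F x))) f.
have be x : A x -> basis_of {:E (ss_pt (F x))} (frame ab.2 (ss_pt (F x))).
  by move=> /domA [_ /frame_basis].
pose f x := end_map (recombine (F x)).
have sf : smooth_mx phi A (fun x => mx x (f x)).
  apply: (class_mx_ext KA _ (smooth_end_map ab A)) => x [tx _ _].
  exact: (congr1 (fun z : endE E => mx_in (frame ab.2 (end_pt z)) (end_map z))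
    (esym (FN tx).2)).
have tr1 x : A x -> lfun_tr (ss_h (F x)) < 1.
  by move=> [tx _ _]; have [[_ ? _] _] := FN tx.
have hf x : A x -> Herm (dot (ss_pt (F x))) (f x).
  by move=> [tx _ _]; have [[/recombine_HP1 [[]]]] := FN tx.
have [c Hc] : exists c : endE E -> C, forall x, A x -> gap_at (F x) (c x).
  have /choice [c Hc] : forall x, exists c, A x -> gap_at (F x) c.
    move=> x; have [Ax|nx] := pselect (A x); last by exists 0.
    by case: (Ax) => tx _ _; have [[_ _ [c gc]] _] := FN tx; exists c.
  by exists c.
have sP : smooth_mx phi A (fun x => mx x (oproj (dot (ss_pt (F x))) (gr_sub (ss_gr (F x))))).
  apply: (smooth_gap_proj (@cont_fst _ _ _) Lphi domA sf hf (c := c) (r := (n - i)%N)).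
  by move=> x Ax; split; [exact: gr_dim|exact: Hc].
have sh : smooth_mx phi A (fun x => mx x (oext (dot (ss_pt (F x))) (ss_h (F x)))).
  apply: (class_mx_ext KA _ (class_mxM KA sP sf)) => x Ax.
  rewrite /mx -(mx_in_comp (be x Ax)); congr mx_in.
  exact: (splice_proj (gr_perpE (ss_gr (F x)))).
pose t x := 1 + - \tr (mx x (oext (dot (ss_pt (F x))) (ss_h (F x)))).
have tE x : A x -> t x = 1 - lfun_tr (ss_h (F x)).
  by move=> Ax; rewrite /t /mx -(lfun_trE _ (be x Ax)) oext_tr.
have t0 x : A x -> t x != 0.
  by move=> Ax; rewrite tE// subr_eq0 eq_sym lt_eqF// tr1.
have st : cplx_in (fun g : endE E -> R => smooth_through phi A g) (fun x => (t x)^-1).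
  apply: (cplx_inV KA t0); apply: (cplx_inD KA); first exact: (cplx_in_cst KA).
  by apply: (cplx_inN KA); exact: (cplx_in_tr KA sh).
have sk : smooth_mx phi A (fun x => mx x (oext (dot (ss_pt (F x))) (ss_k (F x)))).
  apply: (class_mx_ext KA _ (class_mxZ KA st (class_mxD KA sf (class_mxN KA sh)))) => x Ax.
  have fE : mx x (f x) = mx x (oext (dot (ss_pt (F x))) (ss_h (F x))) +
      t x *: mx x (oext (dot (ss_pt (F x))) (ss_k (F x))).
    by rewrite tE// /f /recombine /splice dsum.unlock /= /mx mx_in_add mx_in_scale.
  by rewrite fE addrC addKr scalerA mulVf ?scale1r// t0.
have change := smooth_change_frame (@cont_fst _ _ _) Lphi domA'.
apply: smooth_through_pair.
  apply: (smooth_chart (@cont_fst _ _ _) Lphi) => x Ax.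
  by split; [have [] := domA x Ax|case: Ax => _ _ []].
apply: smooth_through_pair.
  apply/smooth_realifyP; apply: change; apply: (class_mx_ext KA _ sP) => x Ax.
  by rewrite (@ortho_projE R d n M E).
apply: smooth_through_pair.
  apply/smooth_realifyP; apply: change; apply: (class_mx_ext KA _ sh) => x Ax.
  by rewrite (@ext0E R d n M E).
apply/smooth_realifyP; apply: change; apply: (class_mx_ext KA _ sk) => x Ax.
by rewrite (@ext0E R d n M E).
Qed.
End SmoothSplit.

Lemma chart_frame (m : M) : exists ab : chart_idx M * frame_idx E,
  chart_dom ab.1 m /\ frame_dom ab.2 m.
Proof.
by have [a am] := chart_cover m; have [b bm] := frame_cover E m; exists (a, b).
Qed.

(** A gap persists nearby, in the same dimension. *)
Lemma tubeE_open : exists2 D, open D & tubeE = HP1_E E `&` D.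
Proof.
apply: (lc_rel_open (@open_endE _ _ _ _ E) (@endE_compatible _ _ _ _ E)).
  by move=> x [].
move=> x0 [px0 [W0 [c [dW0 g0]]]]; have [ab ab0] := chart_frame (end_pt x0).
exists ab => //; pose A := [set x | HP1_E E x /\ @lc_dom R _ (endE_coords E) ab x].
have domA x : A x -> chart_dom ab.1 (end_pt x) /\ frame_dom ab.2 (end_pt x) by case.
have hf x : A x -> Herm (dot (end_pt x)) (end_map x) by move=> [[[]]].
have [U nU [W [HW _]]] := spectral_local (@cont_fst _ _ _) (endE_over ab) domA
  (smooth_end_map ab A) hf (conj px0 ab0) g0.
exists U => // x px ax Ux; have [dW g] := HW x (conj px ax) Ux.
by split=> //; exists (W x), c; rewrite dW dW0.
Qed.

(** Here [W] is part of the data, so both conditions, [tr h < 1] and the positive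
    definiteness that expresses the gap with the cut [c] kept fixed, are open. *)
Lemma tubeSS_open : exists2 D, open D & tubeSS = coneHPD E i `&` D.
Proof.
apply: (lc_rel_open (@open_endSS _ _ _ _ E i) (@endSS_compatible _ _ _ _ E i)).
  by move=> y [].
move=> y0 [cy0 tr0 [c g0]]; have [ab ab0] := chart_frame (ss_pt y0).
exists ab => //; pose A := [set y | coneHPD E i y /\ @lc_dom R _ (endSS_coords E i) ab y].
have domA y : A y -> chart_dom ab.1 (ss_pt y) /\ frame_dom ab.2 (ss_pt y) by case.
have Ay0 : A y0 by [].
have [str _] := smooth_tr_h domA.
have ntr : nbhs (complex.Re (lfun_tr (ss_h y0))) [set r | r < 1].
  apply: open_nbhs_nbhs; split; first exact: open_lt.
  by move: tr0; rewrite ltcE => /andP[].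
have [U nU HU] := smooth_through_nbhs str Ay0 ntr.
have [S [pS SS sS]] := smooth_lowdin (E := E) (b := ab.2) (@cont_fst _ _ _)
  (@endSS_over _ _ _ _ E i ab) domA.
set phi := @lc_map R _ (endSS_coords E i) ab in nU sS HU *; have KA := regular_through phi A.
pose e (y : endSS E i) := frame ab.2 (ss_pt y); pose l (y : endSS E i) := lowdin (e y) (S y).
have be y : A y -> basis_of {:E (ss_pt y)} (e y) by move=> /domA [_ /frame_basis].
have bl y : A y -> basis_of {:E (ss_pt y)} (l y).
  by move=> Ay; apply: lowdin_basis (be y Ay) (pS y Ay).
have ol y : A y -> gram (dot (ss_pt y)) (l y) = 1%:M.
  by move=> Ay; apply: lowdin_gram (pS y Ay) (SS y Ay).
pose f (y : endSS E i) := end_map (recombine y).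
pose B (y : endSS E i) : 'End(E (ss_pt y)) :=
  ((f y - c *: \1) \o orefl (dot (ss_pt y)) (gr_sub (ss_gr y)))%VF.
have c0 : 0 < c by case: g0.
have hf y : A y -> Herm (dot (ss_pt y)) (f y) by move=> [/recombine_HP1 [[]]].
have cf (y : endSS E i) : (f y \o oproj (dot (ss_pt y)) (gr_sub (ss_gr y)) =
             oproj (dot (ss_pt y)) (gr_sub (ss_gr y)) \o f y)%VF.
  exact: (splice_comm (gr_perpE (ss_gr y))).
have hB y : A y -> (mx_in (l y) (B y))^t* = mx_in (l y) (B y).
  move=> Ay; apply/(Herm_mx (bl y Ay) (ol y Ay)); apply: Herm_gap (hf y Ay) (cf y).
  by rewrite realE ltW.
have sB : smooth_mx phi A (fun y => mx_in (l y) (B y)).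
  have sP := smooth_oproj_gr ab A; have sf := smooth_recombine_map domA.
  apply: (@class_mx_ext _ _ _ _ KA _ _ (fun y => invmx (S y) *m
    ((1%:M + - (2%:R *: mx_in (e y) (oproj (dot (ss_pt y)) (gr_sub (ss_gr y))))) *m
     (mx_in (e y) (f y) + - c%:M)) *m S y)).
    move=> y Ay; rewrite [RHS](lowdin_mx (be y Ay) (pS y Ay)); congr (_ *m _ *m _).
    rewrite (mx_in_comp (be y Ay)) (orefl_mx _ _ (be y Ay)) mx_in_add mx_in_opp.
    by rewrite mx_in_scale (mx_in_id (be y Ay)) scalemx1.
  apply: (class_mxM KA) => //; apply: (class_mxM KA).
    by apply: (class_mx_inv KA) => // y Ay; exact/posdef_unit/pS.
  apply: (class_mxM KA).
    apply: (class_mxD KA); first exact: (class_mx_cst KA).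
    by apply: (class_mxN KA); apply: (class_mxZ KA) => //; exact: (cplx_in_cst KA).
  by apply: (class_mxD KA) => //; exact: (class_mx_cst KA).
have pB0 : posdefmx (mx_in (l y0) (B y0)).
  by apply/(HPD_mx (bl _ Ay0) (ol _ Ay0)); case: g0.
have [U' nU' HU'] := smooth_mx_posdef_nbhs sB hB Ay0 pB0.
exists (U `&` U'); first exact: filterI.
move=> y cy ay [Uy U'y]; have Ay : A y by [].
split=> //.
  have /coneHPDP [/HP_oext ph _ _] := cy.
  have := HP_tr_ge0 ph; rewrite oext_tr => tr_ge0.
  by rewrite ltcE (ger0_Im tr_ge0) /= eqxx; exact: HU.
exists c; split=> //; first exact: hf.
by apply/(HPD_mx (bl y Ay) (ol y Ay)); exact: HU'.
Qed.

End SmoothTubes.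

Theorem theorem18 (R : realType) (d n i : nat)
  (M : smooth_manifold R d) (E : hermitian_bundle M n) :
  (1 <= i <= n)%N ->
  exists (N : set (endE E)) (N' : set (endSS E i)),
    [/\ rel_open_nbhd (HP1_E E) (Sigma0 E i) N,
        rel_open_nbhd (coneHPD E i) (zeroHPD E i) N',
        N' `<=` coneHPD_lt1 E i &
        stratified_iso (endE_coords E) (endSS_coords E i)
          N (strata_E E N) N' (strata_cone E i N')].
Proof.
move=> hi; have [F [Fpt FN]] := exists_split E hi.
pose G := @recombine R d n i M E.
pose N := @tubeE R d n i M E; pose N' := @tubeSS R d n i M E.
have FN1 x : N x -> N' (F x) by move=> /FN [].
have GF x : N x -> G (F x) = x by move=> /FN [].
have GN y : N' y -> N (G y) by exact: recombine_tube.
have FG y : N' y -> F (G y) = y.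
  by move=> Ny; apply: (recombine_inj (FN1 _ (GN _ Ny)) Ny); exact/GF/GN.
have cF : {within N, continuous F}.
  apply: (lc_smooth_continuous (cT := endE_coords E) (cU := endSS_coords E i)).
  - by [].
  - exact: endE_compatible.
  - by [].
  - exact: endSS_compatible.
  move=> x Nx; have [ab ab0] := chart_frame E (end_pt x); exists ab, ab; split=> //.
    by move=> y Ny aby; rewrite /= Fpt.
  exact: (smooth_split Fpt FN).
have cG : {within N', continuous G}.
  apply: (lc_smooth_continuous (cT := endSS_coords E i) (cU := endE_coords E)).
  - by [].
  - exact: endSS_compatible.
  - by [].
  - exact: endE_compatible.
  move=> y Ny; have [ab ab0] := chart_frame E (ss_pt y); exists ab, ab; split=> //.
  exact: smooth_recombine.
exists N, N'; split.
- by split; [exact: Sigma0_tube|exact: tubeE_open].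
- by split; [exact: zeroHPD_tube|exact: tubeSS_open].
- by move=> y [].
exists F, G; split=> //.
  by split=> // [_ [x Nx <-]|_ [y Ny <-]]; [exact: FN1|exact: GN].
move=> _ [r rn [-> [x0 [Nx0 [px0 rx0]]]]].
have rankF x : N x -> lfun_rank (end_map x) = (lfun_rank (ss_h (F x)) + i)%N.
  by move=> Nx; rewrite -(recombine_rank hi (FN1 _ Nx)) -/G GF.
(* Nonempty strata of N have rank at least i, so the subtraction is exact. *)
have FS : F @` (N `&` Sigma0 E r) = N' `&` cone_stratum E i (r - i)%N.
  apply/seteqP; split=> [_ [x [Nx [px rx]] <-]|y [Ny [cy ry]]].
    split; first exact: FN1.
    split; first by have [] := FN1 _ Nx.
    by rewrite -rx (rankF _ Nx) addnK.
  exists (G y); last exact: FG.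
  split; first exact: GN.
  split; first by have [] := GN _ Ny.
  rewrite recombine_rank// ry subnK// -rx0 (rankF _ Nx0); exact: leq_addl.
split.
- exists (r - i)%N; first by apply: leq_sub2r; case/andP: rn.
  by split; [exact: FS|exists (F x0), x0].
- split; first by apply: continuous_subspaceW cF => x [].
  move=> ab ab'; apply: (smooth_through_sub _ (smooth_split Fpt FN (ab := ab) (ab' := ab'))) => x.
  by move=> [[Nx _] abx ab'x].
rewrite FS; split; first by apply: continuous_subspaceW cG => y [].
move=> ab ab'; apply: (smooth_through_sub _ (smooth_recombine (ab := ab) (ab' := ab'))) => y.
by move=> [[Ny _] aby ab'y].
Qed.
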